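(* Let $M$ be a compact $n$-dimensional $C^\infty$ smooth manifold with Riemannian distance $\operatorname{dist}$, and let $f\in \operatorname{Diff}^1(M)$ be partially hyperbolic and dynamically coherent. Then $f$ satisfies the Lipschitz central shadowing property, i.e. there exist $d_0>0$ and $\mathcal{L}>0$ such that for any $d\in(0,d_0)$ and any sequence $\{x_k\}_{k\in\mathbb{Z}}\subset M$ with $\operatorname{dist}(f(x_k),x_{k+1})\le d$ for all $k\in\mathbb{Z}$, there exists a sequence $\{y_k\}_{k\in\mathbb{Z}}\subset M$ which is an $\varepsilon$-central pseudotrajectory of $f$ with $\varepsilon=\mathcal{L}d$ and satisfies $$\operatorname{dist}(x_k,y_k)\le \mathcal{L}d,\qquad k\in\mathbb{Z}.$$
   Context: $M$ is a compact $n$-dimensional $C^\infty$ manifold with a Riemannian metric; $\operatorname{dist}$ is the induced distance and $|\cdot|$ the induced norm on tangent spaces. Partial hyperbolicity: $f\in\operatorname{Diff}^1(M)$ is called partially hyperbolic if there exists $m\in\mathbb{N}$ such that $f^m$ satisfies the following. There exist a continuous invariant splitting $$T_xM=E^s(x)\oplus E^c(x)\oplus E^u(x),\qquad x\in M,$$ and continuous positive functions $\nu,\hat\nu,\gamma,\hat\gamma:M\to\mathbb{R}$ such that $\nu,\hat\nu<1$, $\nu<\gamma<\hat\gamma<\hat\nu^{-1}$, and for all $x\in M$ and all $v\in T_xM$ with $|v|=1$: $$|Df^m(x)v|\le\nu(x)\ \text{ if } v\in E^s(x);$$ $$\gamma(x)\le|Df^m(x)v|\le\hat\gamma(x)\ \text{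 if } v\in E^c(x);$$ $$|Df^m(x)v|\ge\hat\nu^{-1}(x)\ \text{ if } v\in E^u(x).$$ Write $E^{cs}(x)=E^s(x)\oplus E^c(x)$ and $E^{cu}(x)=E^c(x)\oplus E^u(x)$. Unique integrability: a $k$-dimensional distribution $E$ in $TM$ is uniquely integrable if there exists a $k$-dimensional continuous foliation $W$ of $M$ whose leaves are tangent to $E$ at every point and such that any $C^1$-smooth path tangent to $E$ is contained in a unique leaf of $W$. Dynamical coherence: a partially hyperbolic diffeomorphism $f$ is dynamically coherent if both distributions $E^{cs}$ and $E^{cu}$ are uniquely integrable; denote the corresponding foliations by $W^{cs}$ and $W^{cu}$. In this case $E^c$ is also uniquely integrable, and the corresponding foliation $W^c$ is a subfoliation of both $W^{cs}$ and $W^{cu}$. For $y\in W^c(x)$ (the leaf of $W^c$ through $x$), $\operatorname{dist}_c(x,y)$ denotes the inner distance from $x$ to $y$ on the leaf $W^c(x)$, and $W^c_\varepsilon(x)=\{y\in W^c(x):\operatorname{dist}_c(x,y)<\varepsilon\}$. Central pseudotrajectory: a sequence $\{y_k\}_{k\in\mathbb{Z}}\subset M$ is called a $d$-pseudotrajectory ($d>0$) of $f$ if $\operatorname{dist}(f(y_k),y_{k+1})\le d$ for all $k\in\mathbb{Z}$. An $\varepsilon$-pseudotrajectory $\{y_k\}$ is called central (an $\varepsilon$-central pseudotrajectory) if $f(y_k)\in W^c_\varepsilon(y_{k+1})$ for all $k\in\mathbb{Z}$. *)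

(* Defs.v *)
From HB Require Import structures.
From mathcomp Require Import all_boot all_order all_algebra.
From mathcomp Require Import all_classical all_reals all_analysis.
Set Implicit Arguments.
Unset Strict Implicit.
Unset Printing Implicit Defensive.
Import Order.TTheory GRing.Theory Num.Theory.
Import numFieldNormedType.Exports.
Local Open Scope classical_set_scope.
Local Open Scope ring_scope.

(* [D] is meant to be open: [differentiable] and ['D_v] look at a full
   neighbourhood of each point of [D]. *)
Fixpoint Ck (R : realType) (U V : normedModType R) (k : nat)
    (D : set U) (f : U -> V) : Prop :=
  if k is k'.+1 then
    (forall x, D x -> differentiable f x) /\
    (forall v : U, Ck k' D ('D_v f))
  else forall x, D x -> {for x, continuous f}.

(* [pmap] and [pinv] are total functions, relevant only on [pdom], [pcod]. *)
Record partial_homeo (X Y : topologicalType) := PartialHomeo {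
  pdom : set X;
  pcod : set Y;
  pmap : X -> Y;
  pinv : Y -> X;
  pdom_open : open pdom;
  pcod_open : open pcod;
  pmap_cod : forall x, pdom x -> pcod (pmap x);
  pinv_dom : forall y, pcod y -> pdom (pinv y);
  pmapK : forall x, pdom x -> pinv (pmap x) = x;
  pinvK : forall y, pcod y -> pmap (pinv y) = y;
  pmap_cont : forall x, pdom x -> {for x, continuous pmap};
  pinv_cont : forall y, pcod y -> {for y, continuous pinv}
}.

Definition chart (R : realType) (n : nat) (M : topologicalType) :=
  partial_homeo M 'rV[R]_n.

(* A C^oo atlas, with a preferred chart around every point.  The tangent space
   at [x] is represented by ['rV[R]_n] via the coordinates of [chart_at x]; a
   distribution on [M] is then a function [M -> {vspace 'rV[R]_n}].  The
   Hausdorff property is a separate hypothesis, and second countability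
   follows from compactness. *)
Record smooth_atlas (R : realType) (n : nat) (M : topologicalType) :=
  SmoothAtlas {
  charts : set (chart R n M);
  chart_at : M -> chart R n M;
  chart_at_in : forall x, charts (chart_at x);
  chart_at_dom : forall x, pdom (chart_at x) x;
  transition_smooth : forall a b, charts a -> charts b -> forall k,
    Ck k (pcod a `&` (pinv a @^-1` pdom b)) (pmap b \o pinv a)
}.

(* The tangent vector at [x] whose coordinates in the chart [b] are [u],
   expressed in the coordinates of [chart_at x]. *)
Definition tangent_of_coord (R : realType) (n : nat) (M : topologicalType)
    (S : smooth_atlas R n M) (b : chart R n M) (x : M) (u : 'rV[R]_n) :
    'rV[R]_n :=
  'd (pmap (chart_at S x) \o pinv b) (pmap b x) u.

Definition C1_into (R : realType) (n : nat) (M : topologicalType)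
    (S : smooth_atlas R n M) (U : normedModType R) (D : set U)
    (p : U -> M) : Prop :=
  (forall z, D z -> {for z, continuous p}) /\
  (forall b, charts S b -> Ck 1 (D `&` (p @^-1` pdom b)) (pmap b \o p)).

Definition C1_map (R : realType) (n : nat) (M : topologicalType)
    (S : smooth_atlas R n M) (f : M -> M) : Prop :=
  forall a, charts S a -> C1_into S (pcod a) (f \o pinv a).

Definition Diff1 (R : realType) (n : nat) (M : topologicalType)
    (S : smooth_atlas R n M) (f : M -> M) : Prop :=
  C1_map S f /\
  exists h : M -> M, [/\ C1_map S h, cancel f h & cancel h f].

Definition tangent_map (R : realType) (n : nat) (M : topologicalType)
    (S : smooth_atlas R n M) (f : M -> M) (x : M) (v : 'rV[R]_n) : 'rV[R]_n :=
  'd (pmap (chart_at S (f x)) \o f \o pinv (chart_at S x))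
     (pmap (chart_at S x) x) v.

(* A C^1 path is given by a C^1 map on all of [R], of which only the
   restriction to [0, 1] matters; every C^1 map on [0, 1] extends so. *)
Definition C1_path (R : realType) (n : nat) (M : topologicalType)
    (S : smooth_atlas R n M) (p : R -> M) : Prop :=
  C1_into S (setT : set R) p.

Definition velocity (R : realType) (n : nat) (M : topologicalType)
    (S : smooth_atlas R n M) (p : R -> M) (t : R) : 'rV[R]_n :=
  derive1 (pmap (chart_at S (p t)) \o p) t.

(* The metric at [x] is given by its Gram matrix in the coordinates of
   [chart_at x]; it has to be smooth when read in any chart. *)
Record riemannian_metric (R : realType) (n : nat) (M : topologicalType)
    (S : smooth_atlas R n M) := RiemannianMetric {
  gram : M -> 'M[R]_n;
  inner := fun (x : M) (v w : 'rV[R]_n) => (v *m gram x *m w^T) 0 0;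
  gram_sym : forall x, (gram x)^T = gram x;
  gram_pos : forall x v, v != 0 -> 0 < inner x v v;
  gram_smooth : forall b, charts S b -> forall (u v : 'rV[R]_n) (k : nat),
    Ck k (pcod b) (fun z : 'rV[R]_n =>
      inner (pinv b z) (tangent_of_coord S b (pinv b z) u)
                       (tangent_of_coord S b (pinv b z) v) : R)
}.

Definition tnorm (R : realType) (n : nat) (M : topologicalType)
    (S : smooth_atlas R n M) (g : riemannian_metric S)
    (x : M) (v : 'rV[R]_n) : R :=
  Num.sqrt (inner g x v v).

Definition path_length (R : realType) (n : nat) (M : topologicalType)
    (S : smooth_atlas R n M) (g : riemannian_metric S) (p : R -> M) : \bar R :=
  (\int[@lebesgue_measure R]_(t in `[0%R, 1%R])
     (tnorm g (p t) (velocity S p t))%:E)%E.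

(* Distance inside the subset [A]; it is [+oo] when no C^1 path joins [x] to
   [y] in [A].  Restricting to C^1 (rather than piecewise C^1) paths does not
   change the infimum: a path can be reparametrized so as to stop at its
   corners. *)
Definition dist_in (R : realType) (n : nat) (M : topologicalType)
    (S : smooth_atlas R n M) (g : riemannian_metric S) (A : set M)
    (x y : M) : \bar R :=
  ereal_inf [set path_length g p | p in [set p : R -> M |
    [/\ C1_path S p, p 0 = x, p 1 = y & p @` `[0, 1] `<=` A]]].

(* [M] is not assumed connected: points of different components are at
   distance [+oo]. *)
Definition rdist (R : realType) (n : nat) (M : topologicalType)
    (S : smooth_atlas R n M) (g : riemannian_metric S) (x y : M) : \bar R :=
  dist_in g setT x y.

(* Local existence of continuous frames. *)
Definition continuous_distribution (R : realType) (n : nat)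
    (M : topologicalType) (S : smooth_atlas R n M)
    (E : M -> {vspace 'rV[R]_n}) : Prop :=
  forall x, exists (k : nat) (X : 'I_k -> M -> 'rV[R]_n),
    (forall i, \forall y \near x, {for y, continuous (X i)}) /\
    \forall y \near x,
      basis_of (E y)
        [seq tangent_of_coord S (chart_at S x) y (X i y) | i <- enum 'I_k].

Definition invariant_distribution (R : realType) (n : nat)
    (M : topologicalType) (S : smooth_atlas R n M) (f : M -> M)
    (E : M -> {vspace 'rV[R]_n}) : Prop :=
  forall x, tangent_map S f x @` [set` E x] = [set` E (f x)].

(* [m] is positive: for [m = 0] the condition on [f ^ m] would not involve
   [f]. *)
Definition partially_hyperbolic (R : realType) (n : nat) (M : topologicalType)
    (S : smooth_atlas R n M) (g : riemannian_metric S) (f : M -> M)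
    (Es Ec Eu : M -> {vspace 'rV[R]_n}) : Prop :=
  exists m : nat, (0 < m)%N /\
  let fm := iter m f in
  [/\ forall x, directv (Es x + Ec x + Eu x) /\
                (Es x + Ec x + Eu x)%VS = fullv,
      [/\ continuous_distribution S Es, continuous_distribution S Ec
        & continuous_distribution S Eu],
      [/\ invariant_distribution S fm Es, invariant_distribution S fm Ec
        & invariant_distribution S fm Eu]
    & exists nu nuh gam gamh : M -> R,
      [/\ [/\ continuous nu, continuous nuh, continuous gam
            & continuous gamh],
          forall x, [/\ 0 < nu x, 0 < nuh x, 0 < gam x & 0 < gamh x],
          forall x, [/\ nu x < 1, nuh x < 1, nu x < gam x, gam x < gamh x
            & gamh x < (nuh x)^-1]
        & forall x v, tnorm g x v = 1 ->
          let s := tnorm g (fm x) (tangent_map S fm x v) in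
          [/\ v \in Es x -> s <= nu x,
              v \in Ec x -> gam x <= s <= gamh x
            & v \in Eu x -> (nuh x)^-1 <= s]]].

(* A foliation is given by the map sending a point to the leaf through it. *)
Definition foliation_box (R : realType) (k n : nat) (M : topologicalType)
    (S : smooth_atlas R n M) (W : M -> set M)
    (h : partial_homeo M ('rV[R]_k * 'rV[R]_(n - k))%type) : Prop :=
  [/\ pcod h = setT,
      forall y, pdom h y ->
        connected_component (W y `&` pdom h) y =
        pdom h `&` [set z | (pmap h z).2 = (pmap h y).2]
    & forall c : 'rV[R]_(n - k),
        let plaque := fun u : 'rV[R]_k => pinv h (u, c) in
        C1_into S setT plaque /\
        forall u, injective ('d (pmap (chart_at S (plaque u)) \o plaque) u)].

(* k-dimensional continuous foliation with C^1 leaves.  A path that is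
   continuous for the topology of [M] and stays in a leaf stays, locally, in
   one plaque, because the plaques are the connected components of the trace
   of the leaf on a box; it is thus continuous for the leaf topology, and the
   second clause says that leaves are connected for that topology. *)
Definition foliation (R : realType) (k n : nat) (M : topologicalType)
    (S : smooth_atlas R n M) (W : M -> set M) : Prop :=
  [/\ (forall x, W x x) /\ (forall x y, W x y -> W y = W x),
      forall x y, W x y -> exists p : R -> M,
        [/\ continuous p, p 0 = x, p 1 = y & p @` `[0, 1] `<=` W x]
    & (k <= n)%N /\
      forall x, exists h : partial_homeo M ('rV[R]_k * 'rV[R]_(n - k))%type,
        pdom h x /\ foliation_box S W h].

Definition leaf_tangent (R : realType) (n : nat) (M : topologicalType)
    (S : smooth_atlas R n M) (W : M -> set M) (x : M) : set 'rV[R]_n :=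
  [set v | exists p : R -> M,
    [/\ C1_path S p, p 0 = x, velocity S p 0 = v & range p `<=` W x]].

Definition uniquely_integrates (R : realType) (n : nat) (M : topologicalType)
    (S : smooth_atlas R n M) (E : M -> {vspace 'rV[R]_n})
    (W : M -> set M) : Prop :=
  exists k : nat,
  [/\ forall x, \dim (E x) = k,
      foliation k S W,
      forall x, leaf_tangent S W x = [set` E x]
    & forall p : R -> M, C1_path S p ->
        (forall t, 0 <= t <= 1 -> velocity S p t \in E (p t)) ->
        exists! L : set M, (exists x, L = W x) /\ p @` `[0, 1] `<=` L].

Definition uniquely_integrable (R : realType) (n : nat) (M : topologicalType)
    (S : smooth_atlas R n M) (E : M -> {vspace 'rV[R]_n}) : Prop :=
  exists W : M -> set M, uniquely_integrates S E W.

Definition dynamically_coherent (R : realType) (n : nat) (M : topologicalType)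
    (S : smooth_atlas R n M) (Es Ec Eu : M -> {vspace 'rV[R]_n}) : Prop :=
  uniquely_integrable S (fun x => Es x + Ec x)%VS /\
  uniquely_integrable S (fun x => Ec x + Eu x)%VS.

Definition leaf_ball (R : realType) (n : nat) (M : topologicalType)
    (S : smooth_atlas R n M) (g : riemannian_metric S) (W : M -> set M)
    (eps : R) (x : M) : set M :=
  [set y | W x y /\ (dist_in g (W x) x y < eps%:E)%E].

Definition pseudotrajectory (R : realType) (n : nat) (M : topologicalType)
    (S : smooth_atlas R n M) (g : riemannian_metric S) (f : M -> M)
    (d : R) (y : int -> M) : Prop :=
  forall k : int, (rdist g (f (y k)) (y (k + 1)%R) <= d%:E)%E.

Definition central_pseudotrajectory (R : realType) (n : nat)
    (M : topologicalType) (S : smooth_atlas R n M) (g : riemannian_metric S)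
    (f : M -> M) (Wc : M -> set M) (eps : R) (y : int -> M) : Prop :=
  pseudotrajectory g f eps y /\
  forall k : int, leaf_ball g Wc eps (y (k + 1)%R) (f (y k)).

Definition lipschitz_central_shadowing (R : realType) (n : nat)
    (M : topologicalType) (S : smooth_atlas R n M) (g : riemannian_metric S)
    (f : M -> M) (Wc : M -> set M) : Prop :=
  exists d0 L : R, [/\ 0 < d0, 0 < L &
    forall d : R, 0 < d < d0 ->
    forall x : int -> M, pseudotrajectory g f d x ->
    exists y : int -> M,
      central_pseudotrajectory g f Wc (L * d) y /\
      forall k : int, (rdist g (x k) (y k) <= (L * d)%:E)%E].

(* Main.v *)
(* Let F be an iterate of f that contracts E^s and expands E^u strongly enough to
   beat the distortion of the charts.  Given a pseudotrajectory x of F, the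
   shadowing points are sought as y_k = x_k + v_k, in a chart, with v_k in
   E^s + E^u, and the central correction from F(y_k) to y_{k+1} as an Euler
   polygon of the continuous field x |-> w_{k+1} P^c(x), where P^c is the
   projection on E^c along E^s + E^u.  On a finite window of times and for a
   fixed number of Euler steps, the unknowns (v_k, w_k) are a fixed point of a
   continuous map of a ball of radius O(d), since stable components are
   contracted forward and unstable ones backward: Brouwer's theorem applies, and
   no Lipschitz regularity of the splitting is needed.  Letting the window and
   the number of steps grow along an ultrafilter, the Euler polygons converge to
   C^1 curves tangent to E^c, which unique integrability places in leaves of W^c.
   Finally y is extended to all times by exact orbits of f. *)
Require Import Defs.
From HB Require Import structures.
From mathcomp Require Import all_boot all_order all_algebra.
From mathcomp Require Import all_classical all_reals all_analysis.
From mathcomp Require Import lra zify ring.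
(* [seq.pmap] would otherwise hide the field [pmap] of [partial_homeo]. *)
Import Defs.
Set Implicit Arguments.
Unset Strict Implicit.
Unset Printing Implicit Defensive.
Import Order.TTheory GRing.Theory Num.Theory.
Import numFieldNormedType.Exports.
Local Open Scope classical_set_scope.
Local Open Scope ring_scope.

(** * Convergence of matrices *)

(** The constants are fixed in a strict order. Charts and frames of a finite cover give a distortion
    bound [Kc] that does not involve the iterate; the iterate is then chosen so that its hyperbolic
    rate beats [Kc ^+ 3]; the Jacobian bounds of that iterate come next, and the tolerance [dl] for
    nonlinearity and for the variation of the projections is taken last. The central direction
    offers neither contraction nor expansion, but the central unknown does not propagate: at each
    time it is set so as to cancel the central part of the defect. It may be much larger than the
    hyperbolic unknowns, because it acts on their equations only through errors of order [dl].
    Tangent vectors are coordinates in a preferred chart that may jump from point to point, so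
    everything is read in one fixed chart at each time. Brouwer's theorem is itself deduced from
    Kuhn's labelling lemma on a cube, a parity count made with mod 2 cochains; cubes are the balls
    of the sup norm used for matrices. *)

Section MatrixTopology.
Variable R : realType.

Lemma coord_norm_le m n (A : 'M[R]_(m, n)) i j : `|A i j| <= `|A|.
Proof. by rewrite [leRHS]/Num.Def.normr/= mx_normrE (le_bigmax _ _ (i, j)). Qed.

Lemma mx_norm_le m n (A : 'M[R]_(m, n)) c :
  0 <= c -> (forall i j, `|A i j| <= c) -> `|A| <= c.
Proof.
by move=> c0 h; rewrite [leLHS]/Num.Def.normr/= mx_normrE bigmax_le// => -[i j].
Qed.

Lemma mx_norm_lt m n (A : 'M[R]_(m, n)) c :
  0 < c -> (forall i j, `|A i j| < c) -> `|A| < c.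
Proof.
by move=> c0 h; rewrite [ltLHS]/Num.Def.normr/= mx_normrE bigmax_lt// => -[i j].
Qed.

Lemma norm_mulmx_le m n p (A : 'M[R]_(m, n)) (B : 'M[R]_(n, p)) :
  `|A *m B| <= n%:R * `|A| * `|B|.
Proof.
apply: mx_norm_le => [|i j]; first by rewrite !mulr_ge0.
rewrite mxE (le_trans (ler_norm_sum _ _ _))//.
apply: (@le_trans _ _ (\sum_(k < n) `|A| * `|B|)).
  apply: ler_sum => k _; rewrite normrM.
  by apply: ler_pM => //; apply: coord_norm_le.
by rewrite sumr_const card_ord -mulrA mulr_natl.
Qed.

Section Cvg.
Context {T : Type} {F : set_system T} {FF : Filter F}.

Lemma cvg_mxP m n (f : T -> 'M[R]_(m, n)) (A : 'M[R]_(m, n)) :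
  f x @[x --> F] --> A <-> forall i j, f x i j @[x --> F] --> A i j.
Proof.
split=> [fA i j|h].
  apply/cvgrPdist_lt => e e0; have /cvgrPdist_lt/(_ e e0) := fA.
  by apply: filterS => x; apply: le_lt_trans; have := coord_norm_le (A - f x) i j;
    rewrite !mxE.
apply/cvgrPdist_lt => e e0; near=> x; apply: mx_norm_lt => // i j; rewrite !mxE.
move: i j; near: x; apply: filter_forall => i; apply: filter_forall => j.
by have /cvgrPdist_lt := h i j; apply.
Unshelve. all: by end_near. Qed.

Lemma cvg_mulmx m n p (f : T -> 'M[R]_(m, n)) (g : T -> 'M[R]_(n, p))
    (A : 'M[R]_(m, n)) (B : 'M[R]_(n, p)) :
  f x @[x --> F] --> A -> g x @[x --> F] --> B ->
  f x *m g x @[x --> F] --> A *m B.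
Proof.
move=> /cvg_mxP fA /cvg_mxP gB; apply/cvg_mxP => i j.
rewrite mxE; under eq_cvg do rewrite mxE.
apply: (@cvg_big _ _ +%R 0); [exact: add_continuous|move=> k _].
by apply: cvgM.
Qed.

Lemma cvg_det n (f : T -> 'M[R]_n) (A : 'M[R]_n) :
  f x @[x --> F] --> A -> \det (f x) @[x --> F] --> \det A.
Proof.
move=> /cvg_mxP fA.
apply: (@cvg_big _ _ +%R 0); [exact: add_continuous|move=> s _].
apply: cvgM; first exact: cvg_cst.
apply: (@cvg_big R _ (fun x y : R => x * y) 1); [exact: mul_continuous|move=> k _].
exact: fA.
Qed.

Lemma cvg_invmx n (f : T -> 'M[R]_n) (A : 'M[R]_n) : A \in unitmx ->
  f x @[x --> F] --> A -> invmx (f x) @[x --> F] --> invmx A.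
Proof.
move=> uA fA.
have dA : \det (f x) @[x --> F] --> \det A by exact: cvg_det.
have dA0 : \det A != 0 by rewrite -unitfE -unitmxE.
have uf : \forall x \near F, f x \in unitmx.
  by apply: filterS (cvgr_neq0 _ dA dA0) => x; rewrite unitmxE unitfE.
(* [invmx] returns its argument on singular matrices; it agrees with Cramer's formula, visibly
   continuous, only where the determinant is nonzero, hence near the limit. *)
suff : (\det (f x))^-1 *: \adj (f x) @[x --> F] --> (\det A)^-1 *: \adj A.
  rewrite {2}/invmx uA; apply: cvg_trans; apply: near_eq_cvg.
  by apply: filterS uf => x ux; rewrite /invmx ux.
apply: cvgZ; first exact: cvgV.
apply/cvg_mxP => i j; rewrite mxE; under eq_cvg do rewrite mxE.
apply: cvgM; first exact: cvg_cst.
apply: cvg_det; apply/cvg_mxP => k l; rewrite !mxE; under eq_cvg do rewrite !mxE.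
exact: ((cvg_mxP f A).1 fA).
Qed.

End Cvg.

Lemma ball_closed_compact n (r : R) : compact [set v : 'rV[R]_n | `|v| <= r].
Proof.
apply: bounded_closed_compact.
  by exists r; split=> [|M rM v /= vr]; [exact: num_real|exact: le_trans (ltW rM)].
apply: (@closed_comp _ _ (fun v : 'rV[R]_n => `|v|) [set x | x <= r]).
  by move=> v _; exact: norm_continuous.
exact: closed_le.
Qed.

Lemma ultra_cvg_bounded (U : set_system nat) n (u : nat -> 'rV[R]_n) r :
  UltraFilter U -> (forall k, `|u k| <= r) ->
  exists2 v, `|v| <= r & u k @[k --> U] --> v.
Proof.
move=> UU ur; have := @ball_closed_compact n r.
rewrite compact_ultra => /(_ (u @ U)).
have UuU : UltraFilter (u @ U).
  constructor; first exact: fmap_proper_filter.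
  move=> G GG UG; apply/seteqP; split=> // A GA.
  have [//|UA] := in_ultra_setVsetC (u @^-1` A) UU.
  have /filter_ex[x []//] : G (A `&` ~` A) by apply: filterI => //; exact: UG.
move=> /(_ UuU)[|v [vr uv]]; last by exists v.
by apply: (@filterE _ U) => k; exact: ur.
Qed.

(** Along one such ultrafilter every bounded sequence converges, so limits are taken at once for all
    integer times and all real parameters of a curve, without extracting subsequences. *)
Lemma nat_ultra : exists U : set_system nat, UltraFilter U /\ \oo `<=` U.
Proof. exact: ultraFilterLemma. Qed.

End MatrixTopology.

(** * Kuhn's lemma and Brouwer's fixed point theorem *)

Section Cochains.
Local Open Scope nat_scope.
Local Open Scope seq_scope.
Variable T : eqType.
Implicit Types (phi psi : seq T -> bool) (s : seq T).

(* A mod 2 simplicial cochain is a boolean function of the list of the vertices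
   of a simplex. *)
Fixpoint coboundary phi s : bool :=
  if s is p :: s' then phi s' (+) coboundary (fun x => phi (p :: x)) s'
  else false.

(** The prism operator of singular homology, mod 2: the sum over [i] of the values of [phi] at
    [b p_0, ..., b p_i, t p_i, ..., t p_k], the simplices that triangulate the cylinder between the
    images of [s] under [b] and [t]. *)
Fixpoint prism (b t : T -> T) phi s : bool :=
  if s is p :: s' then
    phi [:: b p, t p & map t s'] (+) prism b t (fun x => phi (b p :: x)) s'
  else false.

End Cochains.

Section CochainTheory.
Local Open Scope nat_scope.
Local Open Scope seq_scope.
Variable T : eqType.
Implicit Types (phi psi : seq T -> bool) (s : seq T).

Lemma eq_coboundary phi psi s : (forall x, {subset x <= s} -> phi x = psi x) ->
  coboundary phi s = coboundary psi s.
Proof.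
elim: s phi psi => //= p s IH phi psi h; rewrite h; last first.
  by move=> y ys; rewrite inE ys orbT.
congr (_ (+) _); apply: IH => x xs; apply: h => y.
by rewrite !inE => /orP[->//|/xs ->]; rewrite orbT.
Qed.

Lemma eq_prism b t phi psi s :
  (forall x, (forall y, y \in x -> exists2 z, z \in s & (y = b z \/ y = t z)) ->
     phi x = psi x) -> prism b t phi s = prism b t psi s.
Proof.
elim: s phi psi => //= p s IH phi psi h; congr (_ (+) _).
  apply: h => y; rewrite !inE => /or3P[/eqP->|/eqP->|/mapP[z zs ->]].
  - by exists p; [rewrite inE eqxx|left].
  - by exists p; [rewrite inE eqxx|right].
  - by exists z; [rewrite inE zs orbT|right].
apply: IH => x hx; apply: h => y; rewrite inE => /orP[/eqP->|/hx[z zs yz]].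
  by exists p; [rewrite inE eqxx|left].
by exists z; rewrite // inE zs orbT.
Qed.

Lemma coboundary_map (T' : eqType) (f : T' -> T) phi (s : seq T') :
  coboundary phi (map f s) = coboundary (fun x => phi (map f x)) s.
Proof. by elim: s phi => //= p s IH phi; rewrite IH. Qed.

Lemma coboundary_addb phi psi s :
  coboundary (fun x => phi x (+) psi x) s = coboundary phi s (+) coboundary psi s.
Proof.
elim: s phi psi => //= p s IH phi psi; rewrite IH.
by rewrite -!addbA; congr (_ (+) _); rewrite addbCA.
Qed.

Lemma prism_addb b t phi psi s :
  prism b t (fun x => phi x (+) psi x) s = prism b t phi s (+) prism b t psi s.
Proof.
elim: s phi psi => //= p s IH phi psi; rewrite IH.
by rewrite -!addbA; congr (_ (+) _); rewrite addbCA.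
Qed.

Lemma coboundary_false s : coboundary (fun=> false) s = false.
Proof. by elim: s => //= p s ->. Qed.

Lemma prism_false b t s : prism b t (fun=> false) s = false.
Proof. by elim: s. Qed.

(** The chain homotopy identity: the boundary of a prism consists of its top, its bottom and the
    prism over the boundary, and signs disappear mod 2. *)
Lemma prism_coboundary b t phi s :
  prism b t (coboundary phi) s =
  phi (map t s) (+) phi (map b s) (+) coboundary (prism b t phi) s.
Proof.
elim: s phi => [|p s IH] phi /=; first by rewrite addbb.
rewrite prism_addb IH coboundary_addb coboundary_map.
set a1 := phi (t p :: _); set a2 := phi (b p :: _).
set a3 := coboundary _ s; set a4 := prism b t phi s.
set a5 := phi (b p :: map b s); set a6 := coboundary _ s; set a7 := phi (b p :: map t s).
by move: a1 a2 a3 a4 a5 a6 a7; do 7 case.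
Qed.

(** The door count of Sperner's lemma: the coboundary counts mod 2 the entries of [L] whose deletion
    leaves a permutation of [t]. There is one if [L] is [t] plus a new entry, two if the extra entry
    repeats one of [t], and none otherwise. *)
Lemma coboundary_perm_eq (t L : seq T) : uniq t ->
  coboundary (fun x => perm_eq x t) L =
  [&& size L == (size t).+1, uniq L & all (fun y => y \in L) t].
Proof.
elim: L t => [|a L IH] t ut //=; rewrite eqSS.
have permE (u : seq T) : uniq u ->
    perm_eq L u = [&& size L == size u, uniq L & all (fun y => y \in L) u].
  move=> uu; apply/idP/and3P => [pLu|[/eqP sLu uL /allP suL]].
    split; [by rewrite (perm_size pLu)|by rewrite (perm_uniq pLu)|].
    by apply/allP => y; rewrite (perm_mem pLu).
  apply: uniq_perm => // y; apply/idP/idP; last exact: suL.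
  by have [|_ ->] := uniq_min_size uu suL; rewrite ?sLu.
have [at_|ant] := boolP (a \in t).
  under eq_coboundary => x _.
    rewrite (perm_sym (a :: x)) (permPl (perm_to_rem at_)) perm_cons perm_sym.
    over.
  rewrite IH ?rem_uniq// (size_rem at_) permE//.
  have st : (size t).-1.+1 = size t by case: (t) at_.
  rewrite st; case: eqP => //= _; case: (uniq L) => //=; last by rewrite andbF.
  have [aL|anL] /= := boolP (a \in L).
    suff -> : all (fun y => y \in L) t = all (fun y => y \in L) (rem a t).
      by rewrite addbb.
    by rewrite (perm_all _ (perm_to_rem at_)) /= aL.
  rewrite (_ : all _ t = false); last first.
    by apply/allPn; exists a.
  rewrite (perm_all _ (perm_to_rem at_)) /= inE eqxx /=.
  apply/eq_in_all => y yr; rewrite inE; case: eqP => //= ya.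
  by move: yr; rewrite ya mem_rem_uniqF.
under eq_coboundary => x _.
  rewrite (_ : perm_eq _ _ = false); last first.
    by apply: contraNF ant => /perm_mem <-; rewrite inE eqxx.
  over.
rewrite coboundary_false addbF permE//.
case: eqP => //= sLt; case uL: (uniq L); rewrite ?andbF//= andbT.
have <- : all (fun y => y \in L) t = all (fun y => y \in a :: L) t.
  apply: eq_in_all => y yt; rewrite inE; case: eqP => // ya.
  by move: ant; rewrite -ya yt.
case: allP => [tL|]; rewrite ?andbF ?andbT//; symmetry.
have [_ eqtL] := uniq_min_size ut tL (eq_leq sLt).
by rewrite -eqtL ant.
Qed.

End CochainTheory.

Section Kuhn.
Local Open Scope nat_scope.
Variables (M N : nat).
Hypothesis N_gt0 : 0 < N.
Let point := {ffun 'I_M -> nat}.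
Implicit Types (p q : point) (phi psi : seq point -> bool) (s : seq point).

Definition set_coord (m j : nat) p : point :=
  [ffun i : 'I_M => if val i == m then j else p i].

(* The value of the cochain [phi] on the Freudenthal triangulation, mod 2, of
   the cube [0, N]^m, which is built by iterating the prism construction. *)
Fixpoint cube_eval (m : nat) phi : bool :=
  if m is m'.+1 then
    \big[addb/false]_(j < N)
      cube_eval m' (prism (set_coord m' j) (set_coord m' j.+1) phi)
  else phi [:: [ffun=> 0] : point].

(** Invariant of the vertex lists met by [cube_eval m]: they lie in the face where the coordinates
    from [m] on vanish, and inside a single grid cell. The second clause is what makes rainbow
    simplices small in [brouwer_discrete]. *)
Definition small_in (m : nat) s :=
  (forall p i, p \in s -> p i <= N /\ (m <= i -> p i = 0)) /\
  (forall p q i, p \in s -> q \in s -> p i <= (q i).+1).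

Lemma small_prism m j s x : j < N -> small_in m s ->
  (forall y, y \in x -> exists2 z, z \in s &
     (y = set_coord m j z \/ y = set_coord m j.+1 z)) ->
  small_in m.+1 x.
Proof.
move=> jN [s1 s2] hx; split=> [p i /hx[z zs pz]|p q i /hx[z zs pz] /hx[w ws qw]].
  have [ziN zi0] := s1 z i zs.
  have [im|im] := eqVneq (i : nat) m.
    by case: pz => ->; rewrite ffunE [val i]im eqxx im ltnn; split=> //; apply: ltnW.
  case: pz => ->; rewrite ffunE (negbTE im); split=> // mi;
    by apply: zi0; rewrite ltnW.
have zw := s2 z w i zs ws.
by case: pz => ->; case: qw => ->; rewrite !ffunE; case: eqP => // _; lia.
Qed.

Lemma eq_cube_eval m phi psi :
  (forall s, small_in m s -> phi s = psi s) -> cube_eval m phi = cube_eval m psi.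
Proof.
elim: m phi psi => [|m IH] phi psi h /=.
  apply: h; split=> [p i|p q i]; rewrite !inE => /eqP->; rewrite ?ffunE //.
apply: eq_bigr => j _; apply: IH => s ss; apply: eq_prism => x hx; apply: h.
exact: small_prism hx.
Qed.

Lemma cube_eval_addb m phi psi :
  cube_eval m (fun s => phi s (+) psi s) = cube_eval m phi (+) cube_eval m psi.
Proof.
elim: m phi psi => //= m IH phi psi; rewrite -big_split/=.
apply: eq_bigr => j _; rewrite -IH; apply: eq_cube_eval => s _.
exact: prism_addb.
Qed.

Lemma cube_eval_false m phi :
  (forall s, small_in m s -> phi s = false) -> cube_eval m phi = false.
Proof.
move=> h; rewrite (eq_cube_eval (psi := fun s => phi s (+) phi s)).
  by rewrite cube_eval_addb addbb.
by move=> s /h ->.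
Qed.

(** Stokes' formula in one coordinate direction: the homotopy identity is summed over the [N] slabs,
    and the inner horizontal faces cancel in pairs. The lateral terms are again coboundaries, left
    to an induction on the dimension. *)
Lemma cube_eval_coboundaryS m phi :
  cube_eval m.+1 (coboundary phi) =
    (cube_eval m (fun s => phi (map (set_coord m N) s)) (+)
     cube_eval m (fun s => phi (map (set_coord m 0) s))) (+)
    \big[addb/false]_(j < N)
      cube_eval m (coboundary (prism (set_coord m j) (set_coord m j.+1) phi)).
Proof.
pose f j := cube_eval m (fun s => phi (map (set_coord m j) s)).
have tele : \big[addb/false]_(j < N) (f j.+1 (+) f j) = f N (+) f 0.
  elim: (N) => [|k IHk]; first by rewrite big_ord0 addbb.
  by rewrite big_ord_recr/= IHk; case: (f k); case: (f 0); case: (f k.+1).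
rewrite -[X in X (+) _]tele -big_split/=; apply: eq_bigr => j _.
rewrite /f -!cube_eval_addb; apply: eq_cube_eval => s _.
exact: prism_coboundary.
Qed.

(** The horizontal faces vanish by hypothesis, and the lateral prism cochains inherit the vanishing
    on the faces of the smaller cube. The condition on [[::]] starts the induction, since the
    coboundary at a single vertex is the value at the empty list. *)
Lemma cube_eval_coboundary m phi : phi [::] = false ->
  (forall s (i : 'I_M), i < m -> s <> [::] -> small_in m s ->
     (forall p, p \in s -> p i = 0) \/ (forall p, p \in s -> p i = N) ->
     phi s = false) ->
  m <= M -> cube_eval m (coboundary phi) = false.
Proof.
elim: m phi => [|m IH] phi phi0 h mM; first by rewrite /= phi0.
rewrite cube_eval_coboundaryS big1 ?addbF => [|j _].
  have small_map k s : k <= N -> small_in m s ->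
      small_in m.+1 (map (set_coord m k) s).
    move=> kN [s1 s2]; split=> [p i|p q i].
      move=> /mapP[z zs ->]; have [ziN zi0] := s1 z i zs.
      rewrite ffunE; case: eqP => [->|/eqP im]; first by rewrite ltnn.
      by split=> // mi; apply: zi0; rewrite ltnW.
    move=> /mapP[z zs ->] /mapP[w ws ->]; rewrite !ffunE.
    by have := s2 z w i zs ws; case: eqP => // _ _; lia.
  have face k : k = 0 \/ k = N ->
      cube_eval m (fun s => phi (map (set_coord m k) s)) = false.
    move=> k0N; apply: cube_eval_false => s ss.
    case: s ss => [//|p0 s0]; set s := p0 :: s0 => ss.
    apply: (h _ (Ordinal mM)) => //; first by apply: small_map => //; case: k0N => ->.
    case: k0N => ->; [left|right] => p /mapP[z _ ->]; by rewrite ffunE eqxx.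
  by rewrite !face ?addbb//; [left|right].
apply: IH; rewrite ?(ltnW mM)// => s i im s0 ss fs.
rewrite (@eq_prism _ _ _ _ (fun=> false)) ?prism_false//.
move=> x hx; have [->//|/eqP x0] := eqVneq x [::].
apply: (h _ i) => //; [by rewrite ltnW|exact: small_prism hx|].
by case: fs => fs; [left|right] => p /hx[z zs [->|->]];
  rewrite ffunE (ltn_eqF im) fs.
Qed.

Variable lab : point -> nat.
Hypothesis lab_le : forall p, (forall i, p i <= N) -> lab p <= M.
Hypothesis lab_0 : forall p i, (forall i, p i <= N) -> p i = 0 -> lab p <= i.
Hypothesis lab_N : forall p i, (forall i, p i <= N) -> p i = N -> lab p <> i.

Let rainbow m s := perm_eq (map lab s) (iota 0 m.+1).

Let lab_small m s p : m <= M -> small_in m s -> p \in s -> lab p <= m.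
Proof.
move=> mM [s1 _] ps; have pN i : p i <= N by case: (s1 p i ps).
move: mM; rewrite leq_eqVlt => /predU1P[->|mM]; first exact: lab_le.
apply: (@lab_0 p (Ordinal mM)) => //; by case: (s1 p (Ordinal mM) ps) => _; apply.
Qed.

Let rainbow_mem m s l : rainbow m s -> l <= m -> exists2 p, p \in s & lab p = l.
Proof.
move=> rs lm; have : l \in map lab s by rewrite (perm_mem rs) mem_iota add0n ltnS.
by move=> /mapP[p ps ->]; exists p.
Qed.

(** Labels on this face are at most [m.+1], so [m.+2] distinct labels are all of them;
    [coboundary_perm_eq] then describes exactly the rainbow lists of the next dimension. *)
Let rainbowS m s : m < M -> small_in m.+1 s ->
  coboundary (rainbow m) s = rainbow m.+1 s.
Proof.
move=> mM ss.
rewrite -(coboundary_map lab (fun x => perm_eq x (iota 0 m.+1))).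
rewrite coboundary_perm_eq ?iota_uniq// size_iota /rainbow.
have labs l : l \in map lab s -> l \in iota 0 m.+2.
  by move=> /mapP[p ps ->]; rewrite mem_iota add0n ltnS (lab_small mM ss ps).
apply/and3P/idP => [[/eqP sz us _]|rs].
  apply: uniq_perm; rewrite ?iota_uniq// => l.
  by have [_ ->] := uniq_min_size us labs (eq_leq (etrans (size_iota _ _) (esym sz))).
split; first by rewrite (perm_size rs) size_iota.
  by rewrite (perm_uniq rs) iota_uniq.
apply/allP => l; rewrite (perm_mem rs) !mem_iota !add0n => /andP[_ lm].
by rewrite leq0n ltnW.
Qed.

(* The rainbow cochain of dimension [m.+1] is the coboundary of that of
   dimension [m], so Stokes' formula on the cube reduces the parity in dimension
   [m.+1] to the face [x_m = N]. *)
Let rainbow_odd m : m <= M -> cube_eval m (rainbow m) = true.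
Proof.
elim: m => [|m IH] mM.
  rewrite /= /rainbow /= (_ : lab _ = 0) //; apply/eqP; rewrite -leqn0.
  apply: (@lab_small 0 [:: [ffun=> 0]]); rewrite ?inE//.
  by split=> [p i|p q i]; rewrite !inE => /eqP->; rewrite ?ffunE.
(* For [i < m], on [x_i = 0] all labels are at most [i], so the label [m] is missing; on [x_i = N]
   the label [i] is missing. *)
have rface s (i : 'I_M) : i < m -> small_in m.+1 s ->
   (forall p, p \in s -> p i = 0) \/ (forall p, p \in s -> p i = N) ->
   rainbow m s = false.
  move=> im [s1 _] fs; apply/negP => rs.
  case: fs => fs.
    have [p ps lp] := rainbow_mem rs (leqnn m).
    have := @lab_0 p i _ (fs p ps); rewrite lp leqNgt im => /(_ _)/notF; apply.
    by move=> k; case: (s1 p k ps).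
  have [p ps lp] := rainbow_mem rs (ltnW im).
  by apply: (@lab_N p i) => //; [move=> k; case: (s1 p k ps)|exact: fs].
rewrite -(eq_cube_eval (fun s ss => rainbowS mM ss)) cube_eval_coboundaryS.
rewrite big1 => [|j _].
  (* The face [x_m = N] contributes nothing, since the label [m] cannot occur there. What survives
     is the face [x_m = 0], where [set_coord m 0] acts as the identity and the induction hypothesis
     applies. *)
  rewrite (cube_eval_false (phi := fun s => rainbow m (map (set_coord m N) s))).
    rewrite addbF/= -(IH (ltnW mM)); apply: eq_cube_eval => s [s1 _].
    rewrite /rainbow -map_comp; congr (perm_eq _ _); apply/eq_in_map => p ps /=.
    congr lab; apply/ffunP => i; rewrite ffunE; case: eqP => // im.
    by have [_ ->] := s1 p i ps; rewrite // im.
  move=> s [s1 _]; apply/negP => rs; have [p /mapP[z zs ->] lp] := rainbow_mem rs (leqnn m).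
  apply: (@lab_N (set_coord m N z) (Ordinal mM)) => //=.
    by move=> i; rewrite ffunE; case: eqP => // _; case: (s1 z i zs).
  by rewrite ffunE eqxx.
apply: cube_eval_coboundary => //; last exact: ltnW.
move=> s i im s0 ss fs.
rewrite (@eq_prism _ _ _ _ (fun=> false)) ?prism_false//.
move=> x hx; apply: (rface _ i) => //; first exact: small_prism hx.
by case: fs => fs; [left|right] => p /hx[z zs [->|->]];
  rewrite ffunE (ltn_eqF im) fs.
Qed.

Theorem kuhn : exists s, small_in M s /\
  forall l, l <= M -> exists2 p, p \in s & lab p = l.
Proof.
have /negP/negP := rainbow_odd (leqnn M).
rewrite -[cube_eval _ _]negbK => /negP H.
have [[s [ss rs]]|no] := pselect (exists s, small_in M s /\ rainbow M s).
  by exists s; split=> // l; apply: rainbow_mem.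
exfalso; apply: H; apply/negP; rewrite cube_eval_false// => s ss.
by apply/negP => rs; apply: no; exists s.
Qed.

End Kuhn.

Section Brouwer.
Variable R : realType.

(** The matrix norm is the sup norm, so the ball of radius [r] is a cube and Kuhn's lemma applies to
    it directly, with [N.+1] cells along each side. *)
Lemma brouwer_discrete M (T : 'rV[R]_M -> 'rV[R]_M) (r : R) (N : nat) :
  0 < r -> (forall v, `|T v| <= r) ->
  exists q : 'I_M.+1 -> 'rV[R]_M,
    [/\ forall l, `|q l| <= r,
        forall k l, `|q k - q l| <= 2 * r / N.+1%:R,
        forall i : 'I_M, q (widen_ord (leqnSn M) i) 0 i <=
                         T (q (widen_ord (leqnSn M) i)) 0 i
      & forall i : 'I_M, T (q ord_max) 0 i <= q ord_max 0 i].
Proof.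
move=> r0 Tr; have Tr' v i : - r <= T v 0 i <= r.
  by rewrite -ler_norml (le_trans (coord_norm_le _ _ _)).
pose vec (p : {ffun 'I_M -> nat}) : 'rV[R]_M :=
  \row_i (- r + 2 * r * (p i)%:R / N.+1%:R).
(* A point is labelled by the first coordinate that [T] does not decrease. *)
pose stop (p : {ffun 'I_M -> nat}) (i : 'I_M) :=
  (p i != N.+1) && ((p i == 0%N) || (vec p 0 i <= T (vec p) 0 i)).
pose lab (p : {ffun 'I_M -> nat}) := find (stop p) (enum 'I_M).
(* The clause [p i == 0] serves Kuhn's boundary condition; it is compatible with the inequality
   because the values of [T] are at least [- r]. *)
have stopP p (i : 'I_M) : stop p i -> vec p 0 i <= T (vec p) 0 i.
  move=> /andP[_ /orP[/eqP pi0|//]].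
  by rewrite mxE pi0 mulr0 mul0r addr0; have /andP[] := Tr' (vec p) i.
have lab_stop p (i : 'I_M) : lab p = i -> stop p i.
  move=> li; have hs : has (stop p) (enum 'I_M).
    by rewrite has_find -/(lab p) li size_enum_ord.
  by have := nth_find i hs; rewrite -/(lab p) li nth_ord_enum.
have [||||s [[s1 s2] sl]] := @kuhn M N.+1 _ lab.
- by [].
- by move=> p _; rewrite /lab (leq_trans (find_size _ _))// size_enum_ord.
- move=> p i _ pi0; rewrite leqNgt; apply/negP => /(before_find i).
  by rewrite nth_ord_enum /stop pi0 eqxx.
- by move=> p i _ piN /lab_stop; rewrite /stop piN eqxx.
have /choice[q qP] : forall l : 'I_M.+1, exists p, p \in s /\ lab p = l.
  by move=> l; have [|p ps lp] := sl l; [rewrite -ltnS|exists p].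
have N0 : 0 < N.+1%:R :> R by rewrite ltr0n.
exists (vec \o q); split=> [l|k l|i|i] /=.
- apply: mx_norm_le => [|i j]; first exact: ltW.
  rewrite mxE; have [pN _] := s1 (q l) j (qP l).1.
  have : (0 <= (q l j)%:R / N.+1%:R :> R) && ((q l j)%:R / N.+1%:R <= 1 :> R).
    by rewrite divr_ge0//= ler_pdivrMr// mul1r ler_nat.
  rewrite -mulrA; set x := _ / _; rewrite ler_norml; nra.
- apply: mx_norm_le => [|i j]; first by rewrite divr_ge0// mulr_ge0// ltW.
  rewrite !mxE opprD addrACA opprK [_ + r]addrC subrr add0r.
  rewrite -mulrBl -mulrBr -mulrA normrM ger0_norm ?mulr_ge0 ?(ltW r0)//.
  rewrite ler_wpM2l ?mulr_ge0 ?(ltW r0)// normrM normfV [`|N.+1%:R|]ger0_norm//.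
  rewrite ler_piMl ?invr_ge0//.
  have h1 := s2 (q k) (q l) j (qP k).1 (qP l).1.
  have h2 := s2 (q l) (q k) j (qP l).1 (qP k).1.
  rewrite ler_norml lerBlDr lerBrDr; move: h1 h2.
  by rewrite -!(ler_nat R) -!natr1; lra.
- by apply: stopP; apply: lab_stop; rewrite (qP _).2.
(* Label [M] means that no coordinate stops. A coordinate that [T] increases could only be one with
   [p i = N.+1], whose value is [r], and [T] never exceeds [r]. *)
- rewrite leNgt; apply/negP => Tq.
  have : ~~ has (stop (q ord_max)) (enum 'I_M).
    by rewrite has_find -/(lab _) (qP _).2 size_enum_ord ltnn.
  move=> /hasPn/(_ i); rewrite mem_enum => /(_ isT); rewrite /stop (ltW Tq) orbT andbT.
  rewrite negbK => /eqP pN; move: Tq; rewrite ltNge mxE pN mulfK ?gt_eqF//.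
  by have /andP[_] := Tr' (vec (q ord_max)) i; lra.
Qed.

(** The vertices of the rainbow simplices have a common limit [v], as the mesh tends to 0: label
    [i < M] yields [v i <= T v i], and label [M] the reverse inequality in every coordinate. *)
Theorem brouwer M (T : 'rV[R]_M -> 'rV[R]_M) (r : R) :
  0 < r -> continuous T -> (forall v, `|T v| <= r) -> exists v, T v = v.
Proof.
move=> r0 cT Tr.
have /choice[q qP] := fun N => brouwer_discrete N r0 Tr.
have [U [UU ooU]] := nat_ultra.
have [v _ qv] : exists2 v, `|v| <= r & q k ord_max @[k --> U] --> v.
  by apply: ultra_cvg_bounded => k; case: (qP k).
have ql l : q k l @[k --> U] --> v.
  apply/cvgrPdist_lt => e e0; near=> k.
  rewrite -(subrK (q k ord_max) v) -addrA (le_lt_trans (ler_normD _ _))//.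
  rewrite [e]splitr ltrD//; near: k.
    by have /cvgrPdist_lt := qv; apply; rewrite divr_gt0.
  apply: ooU; near=> k; have [_ /(_ ord_max l) h _ _] := qP k.
  rewrite (le_lt_trans h)// ltr_pdivrMr// -ltr_pdivrMl ?divr_gt0//.
  rewrite (@lt_trans _ _ k%:R) ?ltr_nat//.
  near: k; exact: nbhs_infty_gtr.
have qT l i : T (q k l) 0 i @[k --> U] --> T v 0 i.
  have h : T (q k l) @[k --> U] --> T v := cvg_comp _ _ (ql l) (cT v).
  exact: (cvg_mxP _ _).1 h _ _.
exists v; apply/rowP => i; apply/eqP; rewrite eq_le; apply/andP; split.
  apply: ler_cvg_to (qT ord_max i) ((cvg_mxP _ _).1 (ql ord_max) 0 i) _.
  by apply: filterE => k; case: (qP k).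
apply: ler_cvg_to ((cvg_mxP _ _).1 (ql (widen_ord (leqnSn M) i)) 0 i)
  (qT (widen_ord (leqnSn M) i) i) _.
by apply: filterE => k; case: (qP k).
Unshelve. all: by end_near. Qed.

End Brouwer.

(** * Shadowing in coordinates *)

Section Euler.
Variables (R : realType) (n : nat).
Implicit Types (X : 'rV[R]_n -> 'rV[R]_n) (h : R) (p w : 'rV[R]_n).

(* [p] is a C^1 integral curve of [X] on [0, 1], with one-sided derivatives at
   the end points: nothing is known about [p] outside [0, 1]. *)
Definition integral_curve X (p : R -> 'rV[R]_n) :=
  forall t0 e : R, 0 <= t0 <= 1 -> 0 < e -> exists2 eta : R, 0 < eta &
    forall t : R, 0 <= t <= 1 -> `|t - t0| < eta ->
    `|p t - p t0 - (t - t0) *: X (p t0)| <= `|t - t0| * e.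

Definition euler h X p (j : nat) : 'rV[R]_n :=
  iter j (fun x => x + h *: X x) p.

Lemma euler_near h X p w e j l : 0 <= h -> (j <= l)%N ->
  (forall i, (j <= i < l)%N -> `|X (euler h X p i) - w| <= e) ->
  `|euler h X p l - euler h X p j - ((l - j)%:R * h) *: w| <= (l - j)%:R * h * e.
Proof.
move=> h0; elim: l => [|l IH].
  by rewrite leqn0 => /eqP-> _; rewrite subnn !mul0r scale0r !subrr normr0.
rewrite leq_eqVlt => /predU1P[-> _|jl Xw].
  by rewrite subnn !mul0r scale0r !subrr normr0.
have -> : euler h X p l.+1 - euler h X p j - ((l.+1 - j)%:R * h) *: w =
    (euler h X p l - euler h X p j - ((l - j)%:R * h) *: w) +
    h *: (X (euler h X p l) - w).
  rewrite subSn// -natr1 mulrDl mul1r scalerDl scalerBr.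
  rewrite -[euler _ _ _ l.+1]/(euler h X p l + h *: X (euler h X p l)).
  set a := euler h X p l; set b := euler h X p j; set c := _ *: w.
  by apply/rowP => k; rewrite !mxE; ring.
rewrite (le_trans (ler_normD _ _))// subSn// -natr1 !mulrDl mul1r lerD//.
  by apply: IH => // i /andP[ji il]; apply: Xw; rewrite ji ltnW.
by rewrite normrZ ger0_norm// ler_wpM2l// Xw// leqnn -ltnS jl.
Qed.

Lemma euler_near0 N X p w e j : (0 < N)%N -> (j <= N)%N -> 0 <= e ->
  (forall x, `|X x - w| <= e) ->
  `|euler N%:R^-1 X p j - p - (j%:R / N%:R) *: w| <= e.
Proof.
move=> N0 jN e0 Xw; have := @euler_near N%:R^-1 X p w e 0 j.
rewrite invr_ge0 ler0n leq0n subn0 => /(_ isT isT) h.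
apply: le_trans (h _) _ => [i _|]; first exact: Xw.
rewrite -[leRHS]mul1r ler_wpM2r// ler_pdivrMr ?ltr0n//.
by rewrite mul1r ler_nat.
Qed.

Lemma cvg_euler {T : Type} (G : set_system T) {FG : Filter G} h
  (Q : 'rV[R]_n -> 'M[R]_n) (wf pf : T -> 'rV[R]_n) w p j :
  continuous Q -> wf z @[z --> G] --> w -> pf z @[z --> G] --> p ->
  euler h (fun x => wf z *m Q x) (pf z) j @[z --> G] -->
  euler h (fun x => w *m Q x) p j.
Proof.
move=> cQ wG pG; elim: j => [//|j IH] /=.
apply: cvgD; first exact: IH.
apply: cvgZr; apply: cvg_mulmx => //.
exact: cvg_comp _ _ IH (cQ _).
Qed.

(** Radial retraction onto a closed ball. It turns maps that are controlled only on that ball into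
    continuous bounded maps of the whole space, as [brouwer] requires. *)
Definition trunc_ball (r : R) (v : 'rV[R]_n) := (r / Num.max r `|v|) *: v.

Lemma trunc_ball_le r v : 0 < r -> `|trunc_ball r v| <= r.
Proof.
move=> r0; rewrite normrZ normrM normfV.
have m0 : 0 < Num.max r `|v| by rewrite lt_max r0.
rewrite !gtr0_norm// mulrAC ler_pdivrMr// ler_pM2l//.
by rewrite le_max lexx orbT.
Qed.

Lemma trunc_ball_id r v : 0 < r -> `|v| <= r -> trunc_ball r v = v.
Proof.
by move=> r0 vr; rewrite /trunc_ball max_l// divff ?gt_eqF// scale1r.
Qed.

Lemma cvg_trunc_ball {T : Type} (G : set_system T) {FG : Filter G} r
  (f : T -> 'rV[R]_n) v : 0 < r -> f z @[z --> G] --> v ->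
  trunc_ball r (f z) @[z --> G] --> trunc_ball r v.
Proof.
move=> r0 fv; apply: cvgZ => //; apply: cvgM; first exact: cvg_cst.
apply: cvgV; first by rewrite gt_eqF// lt_max r0.
have nv : `|f z| @[z --> G] --> `|v| by exact: cvg_norm.
have mc : {for `|v|, continuous (fun x : R => Num.max r x)}.
  by apply: continuous_max; [exact: cvg_cst|exact: cvg_id].
exact: (cvg_comp _ _ nv mc).
Qed.

End Euler.

Lemma brouwer_mx (R : realType) (m n : nat)
    (T : 'M[R]_(m, n) -> 'M[R]_(m, n)) (r : R) :
  0 < r -> continuous T -> (forall v, `|T v| <= r) -> exists v, T v = v.
Proof.
move=> r0 cT Tr.
have [||v vE] := @brouwer R (m * n) (fun z => mxvec (T (vec_mx z))) r r0.
- move=> z; pose H := nbhs z; have FH : Filter H by exact: nbhs_filter.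
  suff : mxvec (T (vec_mx y)) @[y --> H] --> mxvec (T (vec_mx z)) by [].
  have h : T (vec_mx y) @[y --> H] --> T (vec_mx z).
    apply: (@cvg_comp _ _ _ (@vec_mx R m n) T _ _ _ _ (cT _)).
    apply/cvg_mxP => i j; rewrite mxE; under eq_cvg do rewrite mxE.
    exact: coord_continuous.
  apply/cvg_mxP => a b; case/mxvec_indexP: b => i k; rewrite [a]ord1 mxvecE.
  under eq_cvg do rewrite mxvecE.
  exact: (cvg_mxP _ _).1 h _ _.
- move=> v; apply: mx_norm_le => [|a b]; first exact: ltW.
  case/mxvec_indexP: b => i k; rewrite [a]ord1 mxvecE.
  exact: le_trans (coord_norm_le _ _ _) (Tr _).
- by exists (vec_mx v); rewrite -[in RHS]vE mxvecK.
Qed.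

(** The unknowns of a finite window are the rows of one matrix, row [i] being [z i.+1], and are
    extended by 0 outside the window. Each equation may involve past, present and future because
    stable parts are solved forward and unstable parts backward. *)
Lemma brouwer_seq (R : realType) (m n : nat) (r : R)
    (g : nat -> 'rV[R]_n -> 'rV[R]_n -> 'rV[R]_n -> 'rV[R]_n) : 0 < r ->
  (forall i (T : Type) (H : set_system T) (FH : Filter H)
     (f0 f1 f2 : T -> 'rV[R]_n) (z0 z1 z2 : 'rV[R]_n),
     f0 x @[x --> H] --> z0 -> f1 x @[x --> H] --> z1 ->
     f2 x @[x --> H] --> z2 ->
     g i (f0 x) (f1 x) (f2 x) @[x --> H] --> g i z0 z1 z2) ->
  (forall i z0 z1 z2, `|g i z0 z1 z2| <= r) ->
  exists z : nat -> 'rV[R]_n,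
    [/\ z 0%N = 0, forall i, (m <= i)%N -> z i.+1 = 0
      & forall i, (i < m)%N -> z i.+1 = g i (z i) (z i.+1) (z i.+2)].
Proof.
move=> r0 cg gr.
pose zeta (Z : 'M[R]_(m, n)) (j : nat) : 'rV[R]_n :=
  if j is i.+1 then if insub i is Some i' then row i' Z else 0 else 0.
have cvg_zeta j (T : Type) (H : set_system T) (FH : Filter H)
    (f : T -> 'M[R]_(m, n)) (Z : 'M[R]_(m, n)) :
    f x @[x --> H] --> Z -> zeta (f x) j @[x --> H] --> zeta Z j.
  move=> fZ; rewrite /zeta; case: j => [|i] /=; first exact: cvg_cst.
  case: insub => [i'|]; last exact: cvg_cst.
  apply/cvg_mxP => a b; rewrite !mxE; under eq_cvg do rewrite !mxE.
  exact: (cvg_mxP _ _).1 fZ _ _.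
pose TT (Z : 'M[R]_(m, n)) : 'M[R]_(m, n) :=
  \matrix_(i < m) g i (zeta Z i) (zeta Z i.+1) (zeta Z i.+2).
have [||Z TZ] := @brouwer_mx R m n TT r r0.
- move=> Z; pose H := nbhs Z; have FH : Filter H by exact: nbhs_filter.
  suff : TT y @[y --> H] --> TT Z by [].
  apply/cvg_mxP => i k; rewrite mxE; under eq_cvg do rewrite mxE.
  move: k; apply: (fun h k => (cvg_mxP _ _).1 h 0 k).
  by apply: cg; apply: cvg_zeta => //.
- move=> Z; apply: mx_norm_le => [|i j]; first exact: ltW.
  rewrite mxE; apply: le_trans (coord_norm_le _ _ _) _; exact: gr.
exists (zeta Z); split=> // i im; first by rewrite /zeta insubF// ltnNge im.
rewrite {1}/zeta insubT//= -[in LHS]TZ rowK//.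
Qed.

Definition splitting_mx (R : realType) (n : nat) (Ps Pc Pu : 'M[R]_n) :=
  [/\ Ps + Pc + Pu = 1%:M, Ps *m Pc = 0 /\ Ps *m Pu = 0,
      Pc *m Ps = 0 /\ Pc *m Pu = 0 & Pu *m Ps = 0 /\ Pu *m Pc = 0].

Lemma splitting_mx_idem (R : realType) (n : nat) (Ps Pc Pu : 'M[R]_n) :
  splitting_mx Ps Pc Pu ->
  [/\ Ps *m Ps = Ps, Pc *m Pc = Pc & Pu *m Pu = Pu].
Proof.
move=> [e [sc su] [cs cu] [us uc]]; split.
- by rewrite -[RHS]mulmx1 -e !mulmxDr sc su !addr0.
- by rewrite -[RHS]mulmx1 -e !mulmxDr cs cu add0r addr0.
- by rewrite -[RHS]mulmx1 -e !mulmxDr us uc !add0r.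
Qed.

(** * The fixed point problem on a finite window of times *)

Section FiniteShadowing.
Variables (R : realType) (n : nat) (K dl d r0 : R).
Variables (Ps Pc Pu A B : nat -> 'M[R]_n).
Variables (F : nat -> 'rV[R]_n -> 'rV[R]_n) (Q : nat -> 'rV[R]_n -> 'M[R]_n).
Hypotheses (K1 : 1 <= K) (dl0 : 0 <= dl) (dlK : dl * K ^+ 4 <= 40^-1).
Hypotheses (d_gt0 : 0 < d) (dr0 : 8 * K ^+ 2 * d <= r0).
Hypothesis split_j : forall j, splitting_mx (Ps j) (Pc j) (Pu j).
Hypothesis AB : forall j, A j *m B j = 1%:M /\ B j *m A j = 1%:M.
Hypothesis bPs : forall j (u : 'rV[R]_n), `|u *m Ps j| <= K * `|u|.
Hypothesis bPc : forall j (u : 'rV[R]_n), `|u *m Pc j| <= K * `|u|.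
Hypothesis bPu : forall j (u : 'rV[R]_n), `|u *m Pu j| <= K * `|u|.
Hypothesis bA : forall j (u : 'rV[R]_n), `|u *m A j| <= K * `|u|.
Hypothesis bB : forall j (u : 'rV[R]_n), `|u *m B j| <= K * `|u|.
Hypothesis hS : forall j (u : 'rV[R]_n), `|u *m A j *m Ps j.+1| <= 8^-1 * `|u|.
Hypothesis hU : forall j (u : 'rV[R]_n), `|u *m B j *m Pu j| <= 8^-1 * `|u|.
(** If the projections of index [j.+1] were taken exactly at the image point, this bound and the
    next would hold with 0, by invariance of the splitting. They will be taken at a nearby point of
    the pseudotrajectory, which costs [dl]. *)
Hypothesis hUU : forall j (u : 'rV[R]_n), `|u *m Pu j.+1 *m B j *m (1%:M - Pu j)| <= dl * `|u|.
Hypothesis hCU : forall j (u : 'rV[R]_n), `|u *m Pc j.+1 *m B j *m Pu j| <= dl * `|u|.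
Hypothesis cF : forall j, continuous (F j).
Hypothesis hF0 : forall j, `|F j 0| <= d.
Hypothesis hF : forall j (v : 'rV[R]_n), `|v| <= r0 ->
  `|F j v - F j 0 - v *m A j| <= dl * `|v|.
Hypothesis cQ : forall j, continuous (Q j).
Hypothesis hQ : forall j (v u : 'rV[R]_n), `|u *m Q j v - u *m Pc j| <= dl * `|u|.
Variables (N m : nat).
Hypothesis N_gt0 : (0 < N)%N.

(** [r] bounds the stable and unstable unknowns, [r'] the central ones. The jump costs at most
    [K ^+ 2 * d = r / 4] and the hyperbolic terms at most [2 * r / 8], which leaves room for errors.
    The central part is only bounded, by about [2 * K ^+ 2 * r], whence the larger [r']; it enters
    the other components with a factor [dl]. *)
Let r := 4 * K ^+ 2 * d.
Let r' := 4 * K ^+ 2 * r.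
Let K0 : 0 < K. Proof. exact: lt_le_trans K1. Qed.
Let r_gt0 : 0 < r. Proof. by rewrite !mulr_gt0// exprn_gt0. Qed.
Let r'_gt0 : 0 < r'. Proof. by rewrite !mulr_gt0// exprn_gt0. Qed.

Let vv j (z : 'rV[R]_n) := z *m (Ps j + Pu j).
Let ww j (z : 'rV[R]_n) := z *m Pc j.
Let Phi j z z' :=
  euler N%:R^-1 (fun x => ww j.+1 z' *m Q j.+1 x) (F j (vv j z)) N.
Let bnd j (z : 'rV[R]_n) :=
  [/\ `|z *m Ps j| <= r, `|z *m Pc j| <= r' & `|z *m Pu j| <= r].
Let G j (z0 z1 z2 : 'rV[R]_n) :=
  (Phi j z0 z1 - ww j.+1 z1) *m Ps j.+1
  - (Phi j z0 z1 - ww j.+1 z1) *m Pc j.+1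
  + (vv j.+2 z2 - Phi j.+1 z1 z2 + vv j.+1 z1 *m A j.+1) *m B j.+1 *m Pu j.+1.

(* [z j] encodes both unknowns: [vv j z] is the displacement of the shadowing
   point in the stable and unstable directions, [ww j z] the central field that
   drives the Euler polygon [Phi] ending at time [j].  The equation
   [Phi j z_j z_j.+1 = vv j.+1 z_j.+1] is solved forward for its stable and
   central components and backward, through [B], for its unstable one; [G] is
   the corresponding fixed point map. *)
Let PhiE j z z' : exists2 e, `|e| <= dl * `|ww j.+1 z'| &
  Phi j z z' = F j (vv j z) + ww j.+1 z' + e.
Proof.
exists (Phi j z z' - F j (vv j z) - ww j.+1 z'); last first.
  by apply/rowP => k; rewrite !mxE; ring.
have := @euler_near0 _ n N (fun x => ww j.+1 z' *m Q j.+1 x) (F j (vv j z))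
  (ww j.+1 z') (dl * `|ww j.+1 z'|) N N_gt0 (leqnn N).
rewrite mulr_ge0// divff ?pnatr_eq0 -?lt0n// scale1r => /(_ isT); apply => x.
have [_ idc _] := splitting_mx_idem (split_j j.+1).
by rewrite -[X in _ - X](_ : ww j.+1 z' *m Pc j.+1 = _) ?hQ// /ww -mulmxA idc.
Qed.

Let FE j z : bnd j z -> exists2 e, `|e| <= dl * (2 * r) &
  `|vv j z| <= 2 * r /\ F j (vv j z) = F j 0 + vv j z *m A j + e.
Proof.
move=> [zs _ zu].
have vr : `|vv j z| <= 2 * r.
  by rewrite /vv mulmxDr (le_trans (ler_normD _ _))// mulr2n mulrDl !mul1r lerD.
exists (F j (vv j z) - F j 0 - vv j z *m A j).
  apply: le_trans (hF _ _) _; last by rewrite ler_wpM2l.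
  by apply: le_trans vr _; apply: le_trans dr0; rewrite /r; lra.
by split=> //; apply/rowP => k; rewrite !mxE; ring.
Qed.

Let dlK3 : dl * K ^+ 3 <= 40^-1.
Proof.
apply: le_trans dlK; rewrite ler_wpM2l//.
by rewrite [leRHS]exprS ler_peMl// exprn_ge0// ltW.
Qed.
Let dlK2 : dl * K ^+ 2 <= 40^-1.
Proof.
apply: le_trans dlK3; rewrite ler_wpM2l//.
by rewrite [leRHS]exprS ler_peMl// exprn_ge0// ltW.
Qed.
Let dlK1 : dl * K <= 40^-1.
Proof.
by apply: le_trans dlK2; rewrite ler_wpM2l// exprS ler_peMl// ltW.
Qed.
Let K2_ge1 : 1 <= K ^+ 2. Proof. exact: exprn_ege1. Qed.
Let K2d : K ^+ 2 * d = r / 4. Proof. by rewrite /r; field. Qed.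
Let Kd : K * d <= r / 4.
Proof. by rewrite -K2d ler_pM2r// expr2 ler_peMl// ltW. Qed.

Let Phi_sub j z0 z1 : bnd j z0 -> bnd j.+1 z1 -> exists e,
  [/\ `|e| <= dl * (2 * r) + dl * r', `|vv j z0| <= 2 * r &
  Phi j z0 z1 = F j 0 + vv j z0 *m A j + e + ww j.+1 z1].
Proof.
move=> b0 b1; have [e1 h1 [vr E1]] := FE b0; have [e2 h2 E2] := PhiE j z0 z1.
exists (e1 + e2); split=> //.
  rewrite (le_trans (ler_normD _ _))// lerD//; apply: le_trans h2 _.
  by case: b1 => _ b1 _; rewrite ler_wpM2l.
by rewrite E2 E1 addrAC !addrA.
Qed.

Let norm3 (a b c : 'rV[R]_n) : `|a + b + c| <= `|a| + `|b| + `|c|.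
Proof. by rewrite (le_trans (ler_normD _ _))// lerD2r ler_normD. Qed.

(** Multiplying [G] by one projection isolates one component. In the stable one [A] contracts; in
    the unstable one the term in [A] cancels the linear part of [Phi], and what is left is
    contracted by [B]. The fractions 6/40 and 4/40 come from [dlK]. *)
Let G_bnd j z0 z1 z2 : bnd j z0 -> bnd j.+1 z1 -> bnd j.+2 z2 ->
  bnd j.+1 (G j z0 z1 z2).
Proof.
move=> b0 b1 b2; have [e [he vr E]] := Phi_sub b0 b1.
have [e' [he' vr' E']] := Phi_sub b1 b2.
have [sum [sc su] [cs cu] [us uc]] := split_j j.+1.
have [ss cc uu] := splitting_mx_idem (split_j j.+1).
have v2r : `|vv j.+2 z2| <= 2 * r by case: (FE b2) => ? _ [].
have e_le : dl * (2 * r) + dl * r' <= (2 * dl + 4 * (dl * K ^+ 2)) * r.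
  by rewrite /r'; lra.
have Ke (k : R) : 0 <= k -> k * dl <= 40^-1 -> k * (dl * K ^+ 2) <= 40^-1 ->
    k * (dl * (2 * r) + dl * r') <= 6 / 40 * r.
  move=> k0 k1 k2; apply: le_trans (ler_wpM2l k0 e_le) _.
  rewrite [leLHS]mulrA (ler_pM2r r_gt0); lra.
have K2r : r <= K ^+ 2 * r by rewrite ler_peMl// ltW.
split.
- rewrite /G mulmxDl mulmxBl -!mulmxA ss cs us !mulmx0 subr0 addr0.
  rewrite E addrK !mulmxDl; apply: le_trans (norm3 _ _ _) _.
  have h1 : `|F j 0 *m Ps j.+1| <= r / 4.
    by apply: le_trans (bPs _ _) _; apply: le_trans Kd; rewrite ler_pM2l.
  have h2 : `|vv j z0 *m A j *m Ps j.+1| <= r / 4.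
    apply: le_trans (hS _ _) _; apply: le_trans (ler_wpM2l _ vr) _ => //; lra.
  have h3 : `|e *m Ps j.+1| <= 6 / 40 * r.
    apply: le_trans (bPs _ _) _; apply: le_trans (ler_wpM2l (ltW K0) he) _.
    by apply: Ke; [exact: ltW|rewrite mulrC|rewrite mulrCA -exprS].
  apply: le_trans (lerD (lerD h1 h2) h3) _; have := r_gt0; lra.
- rewrite /G mulmxDl mulmxBl -!mulmxA sc cc uc !mulmx0 sub0r addr0 normrN.
  rewrite E addrK !mulmxDl; apply: le_trans (norm3 _ _ _) _.
  have h1 : `|F j 0 *m Pc j.+1| <= r / 4.
    by apply: le_trans (bPc _ _) _; apply: le_trans Kd; rewrite ler_pM2l.
  have h2 : `|vv j z0 *m A j *m Pc j.+1| <= K ^+ 2 * (2 * r).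
    apply: le_trans (bPc _ _) _; rewrite expr2 -mulrA ler_pM2l//.
    by apply: le_trans (bA _ _) _; rewrite ler_pM2l.
  have h3 : `|e *m Pc j.+1| <= 6 / 40 * r.
    apply: le_trans (bPc _ _) _; apply: le_trans (ler_wpM2l (ltW K0) he) _.
    by apply: Ke; [exact: ltW|rewrite mulrC|rewrite mulrCA -exprS].
  apply: le_trans (lerD (lerD h1 h2) h3) _; rewrite /r'; have := r_gt0; have := K2r; lra.
- rewrite /G mulmxDl mulmxBl -!mulmxA su cu uu !mulmx0 subrr add0r !mulmxA.
  have -> : (vv j.+2 z2 - Phi j.+1 z1 z2 + vv j.+1 z1 *m A j.+1) =
     vv j.+2 z2 - (F j.+1 0 + e') - ww j.+2 z2.
    rewrite E'; set a := vv _ _; set b := F _ _; set c := vv _ _ *m _.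
    by set f := ww _ _; apply/rowP => k; rewrite !mxE; ring.
  rewrite !mulmxBl; apply: le_trans (norm3 _ _ _) _; rewrite !normrN.
  have h1 : `|vv j.+2 z2 *m B j.+1 *m Pu j.+1| <= r / 4.
    apply: le_trans (hU _ _) _; apply: le_trans (ler_wpM2l _ v2r) _ => //; lra.
  have h2 : `|(F j.+1 0 + e') *m B j.+1 *m Pu j.+1| <= r / 4 + 6 / 40 * r.
    apply: le_trans (bPu _ _) _.
    apply: le_trans (ler_wpM2l (ltW K0) (bB _ _)) _; rewrite mulrA -expr2.
    apply: le_trans (ler_wpM2l _ (ler_normD _ _)) _; first exact: ltW (lt_le_trans ltr01 _).
    rewrite mulrDr lerD//.
      by rewrite -K2d ler_pM2l// exprn_gt0.
    apply: le_trans (ler_wpM2l _ he') _; first exact: ltW (lt_le_trans ltr01 _).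
    apply: Ke; [exact: ltW (lt_le_trans ltr01 _)|by rewrite mulrC|].
    by rewrite mulrCA -exprD.
  have h3 : `|ww j.+2 z2 *m B j.+1 *m Pu j.+1| <= 4 / 40 * r.
    have [_ idc _] := splitting_mx_idem (split_j j.+2).
    rewrite (_ : ww j.+2 z2 = ww j.+2 z2 *m Pc j.+2); last by rewrite /ww -mulmxA idc.
    apply: le_trans (hCU _ _) _.
    apply: le_trans (_ : dl * r' <= _); first by rewrite ler_wpM2l//; case: b2.
    rewrite /r' mulrA (ler_pM2r r_gt0); have := dlK2; lra.
  apply: le_trans (lerD (lerD h1 h2) h3) _; have := r_gt0; lra.
Qed.

(* The fixed point equation at [j.+1] kills the stable and central components of
   the defect [D]; the one at [j] kills the unstable component of [D *m B], which
   is all of [D *m B] up to [dl], so [D = 0]. *)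
Let G_eq j z0 z1 z2 z3 : z1 = G j z0 z1 z2 -> z2 = G j.+1 z1 z2 z3 ->
  Phi j.+1 z1 z2 = vv j.+2 z2.
Proof.
move=> e1 e2; apply/eqP; rewrite -subr_eq0 -normr_eq0.
have small (a x : R) : 0 <= x -> a <= 40^-1 -> x <= a * x -> x <= 0 by nra.
set D := _ - _.
have [sum2 [sc2 su2] [cs2 cu2] [us2 uc2]] := split_j j.+2.
have [ss2 cc2 uu2] := splitting_mx_idem (split_j j.+2).
have [sum1 [sc1 su1] [cs1 cu1] [us1 uc1]] := split_j j.+1.
have [ss1 cc1 uu1] := splitting_mx_idem (split_j j.+1).
have Ds : D *m Ps j.+2 = 0.
  have := congr1 (mulmx^~ (Ps j.+2)) e2.
  rewrite /G mulmxDl mulmxBl -!mulmxA ss2 cs2 us2 !mulmx0 subr0 addr0.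
  rewrite /D !mulmxBl /vv /ww -!mulmxA mulmxDl ss2 cs2 us2 !mulmx0 subr0 addr0.
  by move=> ->; rewrite subrr.
have Dc : D *m Pc j.+2 = 0.
  have := congr1 (mulmx^~ (Pc j.+2)) e2.
  rewrite /G mulmxDl mulmxBl -!mulmxA sc2 cc2 uc2 !mulmx0 sub0r addr0.
  rewrite /D !mulmxBl /vv /ww -!mulmxA mulmxDl sc2 cc2 uc2 !addr0 !mulmx0 subr0.
  by rewrite opprB => /eqP; rewrite eq_sym -subr_eq0 addrAC subrr sub0r oppr_eq0 => /eqP.
have Du : D *m B j.+1 *m Pu j.+1 = 0.
  have vP : vv j.+1 z1 *m Pu j.+1 = z1 *m Pu j.+1.
    by rewrite /vv -mulmxA mulmxDl su1 uu1 add0r.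
  have := congr1 (mulmx^~ (Pu j.+1)) e1; rewrite /G mulmxDl mulmxBl.
  rewrite -[_ *m Pu _ *m Pu _]mulmxA uu1 -[_ *m Ps _ *m Pu _]mulmxA su1.
  rewrite -[_ *m Pc _ *m Pu _]mulmxA cu1 !mulmx0 subrr add0r.
  rewrite (mulmxDl (vv j.+2 z2 - Phi j.+1 z1 z2)) (mulmxDl ((vv j.+2 z2 - _) *m _)).
  rewrite -[_ *m A _ *m _]mulmxA (AB j.+1).1 mulmx1 vP => h.
  apply/eqP; rewrite -oppr_eq0 -!mulNmx opprB; apply/eqP.
  by apply: (addIr (z1 *m Pu j.+1)); rewrite add0r -h.
have DPu : D = D *m Pu j.+2.
  by rewrite -[LHS]mulmx1 -sum2 !mulmxDr Ds Dc !add0r.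
have DB : `|D *m B j.+1| <= dl * `|D|.
  apply: le_trans (hUU j.+1 D); rewrite -DPu mulmxBr mulmx1 Du subr0//.
have : `|D| <= K * (dl * `|D|).
  rewrite -[X in `|X| <= _]mulmx1 -(AB j.+1).2 mulmxA.
  by apply: le_trans (bA _ _) _; rewrite ler_pM2l.
rewrite mulrA => h; rewrite eq_le normr_ge0 andbT.
by apply: small h; [exact: normr_ge0|rewrite mulrC].
Qed.

(** A continuous retraction onto the set [bnd j], component by component. Brouwer is applied to [G]
    with truncated arguments and value; a fixed point is then in [bnd], so the inner truncations
    disappear, and the outer one does by [G_bnd]. *)
Let rho j z := trunc_ball r (z *m Ps j) + trunc_ball r' (z *m Pc j)
  + trunc_ball r (z *m Pu j).

Let rho_bnd j z : bnd j (rho j z).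
Proof.
have [sum [sc su] [cs cu] [us uc]] := split_j j.
have [ss cc uu] := splitting_mx_idem (split_j j).
rewrite /rho /trunc_ball; split; rewrite !mulmxDl -!scalemxAl -!mulmxA
  ?(sc, su, cs, cu, us, uc, ss, cc, uu) !mulmx0 !scaler0 ?add0r ?addr0;
  exact: trunc_ball_le.
Qed.

Let rho_id j z : bnd j z -> rho j z = z.
Proof.
move=> [bs bc bu]; rewrite /rho !trunc_ball_id// -!mulmxDr.
by case: (split_j j) => -> *; rewrite mulmx1.
Qed.

Let bnd_norm j z : bnd j z -> `|z| <= 2 * r + r'.
Proof.
move=> [bs bc bu]; case: (split_j j) => sum *.
rewrite -[z]mulmx1 -sum !mulmxDr; apply: le_trans (norm3 _ _ _) _; lra.
Qed.

Let bnd0 j : bnd j 0.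
Proof. by split; rewrite mul0mx normr0 ltW. Qed.

Let cvg_rho j {T : Type} (H : set_system T) {FH : Filter H} f z :
  f x @[x --> H] --> z -> rho j (f x) @[x --> H] --> rho j z.
Proof.
move=> fz; have c (P : 'M[R]_n) : f x *m P @[x --> H] --> z *m P.
  by apply: cvg_mulmx => //; exact: cvg_cst.
by apply: cvgD; [apply: cvgD|]; apply: cvg_trunc_ball.
Qed.

Let cvg_Phi j {T : Type} (H : set_system T) {FH : Filter H} f f' z z' :
  f x @[x --> H] --> z -> f' x @[x --> H] --> z' ->
  Phi j (f x) (f' x) @[x --> H] --> Phi j z z'.
Proof.
move=> fz fz'; apply: cvg_euler => //.
  by apply: cvg_mulmx => //; exact: cvg_cst.
have h : vv j (f x) @[x --> H] --> vv j z.
  by apply: cvg_mulmx => //; exact: cvg_cst.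
by apply: (@cvg_comp _ _ _ (fun x => vv j (f x)) (F j) _ _ _ h); exact: cF.
Qed.

Let cvg_G i (T : Type) (H : set_system T) (FH : Filter H)
  (f0 f1 f2 : T -> 'rV[R]_n) (z0 z1 z2 : 'rV[R]_n) :
  f0 x @[x --> H] --> z0 -> f1 x @[x --> H] --> z1 ->
  f2 x @[x --> H] --> z2 ->
  G i (f0 x) (f1 x) (f2 x) @[x --> H] --> G i z0 z1 z2.
Proof.
move=> c0 c1 c2.
have cm g (z : 'rV[R]_n) (P : 'M[R]_n) : g x @[x --> H] --> z ->
    g x *m P @[x --> H] --> z *m P.
  by move=> ?; apply: cvg_mulmx => //; exact: cvg_cst.
have p0 := @cvg_Phi i T H FH _ _ _ _ c0 c1; have p1 := @cvg_Phi i.+1 T H FH _ _ _ _ c1 c2.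
apply: cvgD.
  by apply: cvgB; apply: (cm); apply: cvgB => //; exact: (cm f1 z1 (Pc i.+1)).
apply: (cm); apply: (cm); apply: cvgD.
  by apply: cvgB => //; exact: (cm f2 z2 (Ps i.+2 + Pu i.+2)).
by apply: (cm); exact: (cm f1 z1 (Ps i.+1 + Pu i.+1)).
Qed.

(** The bounds depend neither on [N] nor on [m], so both may grow. The equation at time [j] uses the
    fixed point equations of indices [j.-1] and [j], hence the range [0 < j < m]. *)
Lemma finite_shadowing : exists v w : nat -> 'rV[R]_n,
  [/\ forall j, `|v j| <= 8 * K ^+ 2 * d,
      forall j, `|w j| <= 16 * K ^+ 4 * d
    & forall j, (0 < j < m)%N ->
      euler N%:R^-1 (fun x => w j.+1 *m Q j.+1 x) (F j (v j)) N = v j.+1].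
Proof.
have [|i T H FH f0 f1 f2 z0 z1 z2 c0 c1 c2|i z0 z1 z2|z [zz0 zz1 zG]] :=
  @brouwer_seq R m n (2 * r + r') (fun i z0 z1 z2 => rho i.+1
    (G i (rho i z0) (rho i.+1 z1) (rho i.+2 z2))).
- by rewrite addr_gt0// mulr_gt0.
- by apply: cvg_rho; apply: cvg_G; apply: cvg_rho.
- by apply: bnd_norm; exact: rho_bnd.
have z_bnd j : bnd j (z j).
  case: j => [|i]; first by rewrite zz0; exact: bnd0.
  have [im|im] := ltnP i m; first by rewrite zG//; exact: rho_bnd.
  by rewrite zz1//; exact: bnd0.
have zetaG i : (i < m)%N -> z i.+1 = G i (z i) (z i.+1) (z i.+2).
  move=> im; have := zG i im; rewrite !(@rho_id _ (z _))//.
  by rewrite rho_id//; exact: G_bnd.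
exists (fun j => vv j (z j)), (fun j => ww j (z j)); split.
- move=> j; have [_ _ [h _]] := FE (z_bnd j).
  by apply: le_trans h _; rewrite /r; lra.
- move=> j; have [_ h _] := z_bnd j; apply: le_trans h _.
  by rewrite /r' /r; nra.
- case=> [//|j] /andP[_ jm].
  exact: G_eq (zetaG j (ltnW jm)) (zetaG j.+1 jm).
Qed.

End FiniteShadowing.

(** * Limits of Euler polygons *)

Section EulerLimit.
Variables (R : realType) (n : nat).

Lemma euler_near_sym (h : R) (X : 'rV[R]_n -> 'rV[R]_n) (p w : 'rV[R]_n) (e : R)
    (j l : nat) : 0 <= h ->
  (forall i, (minn j l <= i < maxn j l)%N -> `|X (euler h X p i) - w| <= e) ->
  `|euler h X p l - euler h X p j - ((l%:R - j%:R) * h) *: w| <=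
    `|(l%:R - j%:R) * h| * e.
Proof.
move=> h0; have [jl|lj] := leqP j l => Xw.
  rewrite -natrB// [X in _ <= X * _]ger0_norm ?mulr_ge0//.
  exact: euler_near.
have -> : euler h X p l - euler h X p j - ((l%:R - j%:R) * h) *: w =
    - (euler h X p j - euler h X p l - ((j%:R - l%:R) * h) *: w).
  by apply/rowP => k; rewrite !mxE; ring.
rewrite normrN normrM [`|l%:R - _|]distrC -!natrB ?(ltnW lj)// [`|h|]ger0_norm//.
rewrite ger0_norm//.
by apply: euler_near => //; exact: ltnW.
Qed.

Lemma cvg_truncn (t : R) : 0 <= t ->
  (Num.truncn (t * N.+1%:R))%:R / N.+1%:R @[N --> \oo] --> t.
Proof.
move=> t0; apply/cvgrPdist_le => e e0; near=> N.
have T0 : 0 < N.+1%:R :> R by rewrite ltr0n.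
have /truncn_itv/andP[h1 h2] : 0 <= t * N.+1%:R by rewrite mulr_ge0.
rewrite ger0_norm ?subr_ge0 ?ler_pdivrMr//.
rewrite lerBlDl -lerBlDr ler_pdivlMr// mulrBl.
apply: (@le_trans _ _ (t * N.+1%:R - 1)); last first.
  by rewrite lerBlDr natr1 ltW.
rewrite lerD2l lerN2 -ler_pdivrMl// mulr1.
apply: (@le_trans _ _ N%:R); last by rewrite ler_nat.
near: N; exact: nbhs_infty_ger.
Unshelve. all: by end_near. Qed.

Variables (U : set_system nat) (Q : 'rV[R]_n -> 'M[R]_n) (Cw C0 : R).
Variables (wN pN : nat -> 'rV[R]_n) (w p0 : 'rV[R]_n).
Hypotheses (UU : UltraFilter U) (ooU : \oo `<=` U) (cQ : continuous Q).
Hypotheses (Cw0 : 0 <= Cw) (wNw : wN N @[N --> U] --> w).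
Hypothesis pNp0 : pN N @[N --> U] --> p0.
Hypothesis Xw : forall N x, `|wN N *m Q x| <= Cw.
Hypothesis bpN : forall N, `|pN N| <= C0.

Let e_N N := euler N.+1%:R^-1 (fun x => wN N *m Q x) (pN N).

Let e_N_lip N (j l : nat) : `|e_N N l - e_N N j| <= `|l%:R - j%:R| / N.+1%:R * Cw.
Proof.
have T0 : 0 <= N.+1%:R^-1 :> R by rewrite invr_ge0.
have := @euler_near_sym N.+1%:R^-1 (fun x => wN N *m Q x) (pN N) 0 Cw j l T0.
rewrite scaler0 subr0 normrM [`|_^-1|]ger0_norm//; apply => i _.
by rewrite subr0.
Qed.

(** Peano's existence proof, with the ultrafilter in place of Arzela-Ascoli: for each [t] the limit
    is taken at the grid point below [t]. The derivative estimate passes to the limit because, near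
    [p t0], almost all of the fields are uniformly close to the constant [w *m Q (p t0)]. *)
Lemma euler_limit : exists p : R -> 'rV[R]_n,
  [/\ p 0 = p0, e_N N N.+1 @[N --> U] --> p 1,
      forall t : R, 0 <= t <= 1 -> `|p t| <= C0 + Cw
    & integral_curve (fun x => w *m Q x) p].
Proof.
pose q N (t : R) := e_N N (Num.truncn (t * N.+1%:R)).
have T0 N : 0 < N.+1%:R :> R by rewrite ltr0n.
have /choice[p pP] : forall t : R, exists v : 'rV[R]_n, 0 <= t <= 1 ->
    `|v| <= C0 + Cw /\ q N t @[N --> U] --> v.
  move=> t; have [t01|] := boolP (0 <= t <= 1); last by exists 0.
  have [|v v1 v2] := @ultra_cvg_bounded R U n (fun N => q N t) (C0 + Cw) UU.
    move=> N; have [t0 t1] := andP t01.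
    rewrite -(subrK (pN N) (q N t)) addrC (le_trans (ler_normD _ _))// lerD//.
    apply: le_trans (e_N_lip _ 0 _) _; rewrite subr0 ger0_norm//.
    rewrite ler_piMl// ler_pdivrMr// mul1r ler_nat truncn_le_nat.
    by rewrite (@le_lt_trans _ _ N.+1%:R) ?ltr_nat// ler_piMl.
  by exists v.
have qp (t : R) : 0 <= t <= 1 -> q N t @[N --> U] --> p t by move=> /pP[].
have trU (t : R) : 0 <= t <= 1 ->
    (Num.truncn (t * N.+1%:R))%:R / N.+1%:R @[N --> U] --> t.
  move=> /andP[t0 _]; have := cvg_truncn t0; apply: cvg_trans.
  by move=> A /ooU.
exists p; split.
- have h : q N 0 @[N --> U] --> p 0 by apply: qp; rewrite lexx ler01.
  have E : q^~ 0 = pN by apply/funext => N; rewrite /q mul0r truncn0.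
  rewrite E in h; exact: cvg_unique h pNp0.
- have h : q N 1 @[N --> U] --> p 1 by apply: qp; rewrite lexx ler01.
  suff <- : q^~ 1 = (fun N => e_N N N.+1) by [].
  by apply/funext => N; rewrite /q mul1r natrK.
- by move=> t /pP[].
move=> t0 e t01 e0.
have [eta' eta'0 Heta] : exists2 eta', 0 < eta' & \forall N \near U,
    forall x : 'rV[R]_n, `|p t0 - x| < eta' -> `|wN N *m Q x - w *m Q (p t0)| <= e.
  have /cvgrPdist_le/(_ e e0) : (z.1 *m Q z.2) @[z --> (nbhs w, nbhs (p t0))] -->
      w *m Q (p t0).
    apply: cvg_mulmx; first exact: cvg_fst.
    by apply: (@cvg_comp _ _ _ snd Q _ _ _ cvg_snd); exact: cQ.
  move=> [[A B]] /= [wA /nbhs_ballP[eta' eta'0 pB]] AB.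
  have UA : U (wN @^-1` A) by exact: wNw.
  exists eta' => //; near=> N; move=> x px; have AN : A (wN N) by near: N.
  rewrite distrC; apply: (AB (wN N, x)); split => //=; apply: pB.
  by rewrite -ball_normE.
have Cw1 : 0 < Cw + 1 by rewrite ltr_wpDl.
(* The bound on [t - t0] and the rounding to the grid each use [eta' / 8]. At speed at most [Cw] the
   polygon then stays within [eta' / 4] of its position at [t0], itself within [eta' / 2] of [p t0].
   The [+ 1] covers [Cw = 0]. *)
exists (eta' / 8 / (Cw + 1)); first by rewrite !divr_gt0.
move=> t t'01 tt0.
pose a N : R := (Num.truncn (t * N.+1%:R))%:R / N.+1%:R -
                (Num.truncn (t0 * N.+1%:R))%:R / N.+1%:R.
have at0 : a N @[N --> U] --> t - t0 by apply: cvgB; exact: trU.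
have L : `|q N t - q N t0 - a N *: (w *m Q (p t0))| @[N --> U] -->
    `|p t - p t0 - (t - t0) *: (w *m Q (p t0))|.
  apply: cvg_norm; apply: cvgB; first by apply: cvgB; exact: qp.
  by apply: cvgZ => //; exact: cvg_cst.
have L' : `|a N| * e @[N --> U] --> `|t - t0| * e.
  by apply: cvgM; [exact: cvg_norm|exact: cvg_cst].
apply: ler_cvg_to L L' _.
have d8 : 0 < eta' / 8 / (Cw + 1) by rewrite !divr_gt0.
near=> N.
have aE : a N = ((Num.truncn (t * N.+1%:R))%:R -
                (Num.truncn (t0 * N.+1%:R))%:R) * N.+1%:R^-1 by rewrite mulrBl.
rewrite aE; apply: euler_near_sym; first by rewrite invr_ge0 ltW.
move=> i iN.
have HN : forall x : 'rV[R]_n, `|p t0 - x| < eta' -> `|wN N *m Q x - w *m Q (p t0)| <= e.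
  by near: N.
apply: HN.
have h1 : `|p t0 - q N t0| < eta' / 2.
  by near: N; have /cvgrPdist_lt := qp t0 t01; apply; rewrite divr_gt0.
have h2 : `|(t - t0) - a N| < eta' / 8 / (Cw + 1).
  by near: N; have /cvgrPdist_lt := at0; apply.
rewrite -(subrK (q N t0) (p t0)) -addrA (le_lt_trans (ler_normD _ _))//.
have h3 : `|q N t0 - e_N N i| <= `|a N| * Cw.
  apply: le_trans (e_N_lip _ _ _) _; rewrite ler_wpM2r// aE normrM.
  rewrite [`|_^-1|]ger0_norm ?invr_ge0 ?(ltW (T0 N))// ler_pM2r ?invr_gt0//.
  move: iN; set j1 := Num.truncn _; set j2 := Num.truncn _.
  case: (leqP j1 j2) => [j12|/ltnW j21] /andP[i1 i2].
    rewrite ger0_norm ?subr_ge0 ?ler_nat ?(ltnW i2)// ler0_norm ?subr_le0 ?ler_nat//.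
    by rewrite opprB lerD2r ler_nat ltnW.
  rewrite ler0_norm ?subr_le0 ?ler_nat//.
  rewrite ger0_norm ?subr_ge0 ?ler_nat ?(ltnW i2)//.
  by rewrite opprB lerD2l lerN2 ler_nat.
have h4 : `|a N| < eta' / 4 / (Cw + 1).
  have -> : a N = (t - t0) - ((t - t0) - a N) by rewrite subKr.
  apply: le_lt_trans (ler_normB _ _) _.
  apply: lt_le_trans (ltrD tt0 h2) _.
  by rewrite -mulrDl -mulrDr; set c := (Cw + 1)^-1; rewrite ler_pM2r ?invr_gt0//; lra.
rewrite (splitr eta'); apply: ltrD => //; apply: le_lt_trans h3 _.
apply: (@le_lt_trans _ _ (eta' / 4 / (Cw + 1) * (Cw + 1))).
  by apply: ler_pM => //; [exact: ltW|rewrite lerDl].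
by rewrite divfK ?gt_eqF//; lra.
Unshelve. all: by end_near. Qed.

End EulerLimit.

(** * Passage to all integer times *)

Section InfiniteShadowing.
Variables (R : realType) (n : nat) (K dl d r0 : R).
Variables (Ps Pc Pu A B : int -> 'M[R]_n).
Variables (F : int -> 'rV[R]_n -> 'rV[R]_n) (Q : int -> 'rV[R]_n -> 'M[R]_n).
Hypotheses (K1 : 1 <= K) (dl0 : 0 <= dl) (dlK : dl * K ^+ 4 <= 40^-1).
Hypotheses (d_gt0 : 0 < d) (dr0 : 8 * K ^+ 2 * d <= r0).
Hypothesis split_k : forall k, splitting_mx (Ps k) (Pc k) (Pu k).
Hypothesis AB : forall k, A k *m B k = 1%:M /\ B k *m A k = 1%:M.
Hypothesis bPs : forall k (u : 'rV[R]_n), `|u *m Ps k| <= K * `|u|.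
Hypothesis bPc : forall k (u : 'rV[R]_n), `|u *m Pc k| <= K * `|u|.
Hypothesis bPu : forall k (u : 'rV[R]_n), `|u *m Pu k| <= K * `|u|.
Hypothesis bA : forall k (u : 'rV[R]_n), `|u *m A k| <= K * `|u|.
Hypothesis bB : forall k (u : 'rV[R]_n), `|u *m B k| <= K * `|u|.
Hypothesis hS : forall k (u : 'rV[R]_n), `|u *m A k *m Ps (k + 1)| <= 8^-1 * `|u|.
Hypothesis hU : forall k (u : 'rV[R]_n), `|u *m B k *m Pu k| <= 8^-1 * `|u|.
Hypothesis hUU : forall k (u : 'rV[R]_n),
  `|u *m Pu (k + 1) *m B k *m (1%:M - Pu k)| <= dl * `|u|.
Hypothesis hCU : forall k (u : 'rV[R]_n),
  `|u *m Pc (k + 1) *m B k *m Pu k| <= dl * `|u|.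
Hypothesis cF : forall k, continuous (F k).
Hypothesis hF0 : forall k, `|F k 0| <= d.
Hypothesis hF : forall k (v : 'rV[R]_n), `|v| <= r0 ->
  `|F k v - F k 0 - v *m A k| <= dl * `|v|.
Hypothesis cQ : forall k, continuous (Q k).
Hypothesis hQ : forall k (v u : 'rV[R]_n), `|u *m Q k v - u *m Pc k| <= dl * `|u|.

Let dl1 : dl <= 1.
Proof.
have K4 : 1 <= K ^+ 4 by exact: exprn_ege1.
have : dl <= dl * K ^+ 4 by rewrite ler_peMr.
have := dlK; lra.
Qed.

Lemma infinite_shadowing : exists (v w : int -> 'rV[R]_n) (p : int -> R -> 'rV[R]_n),
  [/\ forall k, `|v k| <= 8 * K ^+ 2 * d,
      forall k, `|w k| <= 16 * K ^+ 4 * d,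
      forall k, p k 0 = F k (v k) /\ p k 1 = v (k + 1),
      forall k (t : R), 0 <= t <= 1 -> `|p k t| <= 50 * K ^+ 5 * d
    & forall k, integral_curve (fun x => w (k + 1) *m Q (k + 1) x) (p k)].
Proof.
(* Index [j] stands for time [j - (N + 1)], so the equations for [0 < j < 2 * N + 1] cover the times
   from [- N] to [N - 1]. There are also [N.+1] Euler steps: a single limit enlarges the window and
   refines the polygons. *)
pose sh N (j : nat) : int := j%:Z - N.+1%:Z.
have shS N j : sh N j.+1 = sh N j + 1 by rewrite /sh -addn1 PoszD addrAC.
have /choice[vw vwP] : forall N, exists vw : (nat -> 'rV[R]_n) * (nat -> 'rV[R]_n),
    [/\ forall j, `|vw.1 j| <= 8 * K ^+ 2 * d,
      forall j, `|vw.2 j| <= 16 * K ^+ 4 * d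
    & forall j, (0 < j < (2 * N).+1)%N ->
      euler N.+1%:R^-1 (fun x => vw.2 j.+1 *m Q (sh N j.+1) x)
        (F (sh N j) (vw.1 j)) N.+1 = vw.1 j.+1].
  move=> N; have [|||v [w [h1 h2 h3]]] := @finite_shadowing R n K dl d r0 (Ps \o sh N) (Pc \o sh N)
    (Pu \o sh N) (A \o sh N) (B \o sh N) (F \o sh N) (Q \o sh N) K1 dl0 dlK d_gt0 dr0
    (fun j => split_k _) (fun j => AB _) (fun j => bPs _) (fun j => bPc _)
    (fun j => bPu _) (fun j => bA _) (fun j => bB _)
    _ (fun j => hU _) _ _ (fun j => @cF (sh N j)) (fun j => hF0 _) (fun j => hF _)
    (fun j => @cQ (sh N j)) (fun j => hQ _) N.+1 (2 * N).+1 isT.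
  - by move=> j u /=; rewrite shS.
  - by move=> j u /=; rewrite shS.
  - by move=> j u /=; rewrite shS.
  by exists (v, w).
have [U [UU ooU]] := nat_ultra.
(* [absz] only makes the index total: for fixed [k] it is [k + N + 1] once [N] is large. *)
pose ix N (k : int) : nat := absz (k + N.+1%:Z).
pose V N k := (vw N).1 (ix N k); pose W N k := (vw N).2 (ix N k).
have bV N k : `|V N k| <= 8 * K ^+ 2 * d by case: (vwP N) => h _ _; exact: h.
have bW N k : `|W N k| <= 16 * K ^+ 4 * d by case: (vwP N) => _ h _; exact: h.
have /choice[v vP] : forall k, exists v : 'rV[R]_n,
    `|v| <= 8 * K ^+ 2 * d /\ V N k @[N --> U] --> v.
  by move=> k; have [v h1 h2] := ultra_cvg_bounded UU (fun N => bV N k); exists v.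
have /choice[w wP] : forall k, exists w : 'rV[R]_n,
    `|w| <= 16 * K ^+ 4 * d /\ W N k @[N --> U] --> w.
  by move=> k; have [w h1 h2] := ultra_cvg_bounded UU (fun N => bW N k); exists w.
have VW k : \forall N \near U, euler N.+1%:R^-1
    (fun x => W N (k + 1) *m Q (k + 1) x) (F k (V N k)) N.+1 = V N (k + 1).
  apply: ooU; exists (absz k).+1 => // N /= kN.
  have ixS : ix N (k + 1) = (ix N k).+1 by rewrite /ix; lia.
  have shix : sh N (ix N k) = k by rewrite /sh /ix; lia.
  have [_ _ /(_ (ix N k))] := vwP N; rewrite shS shix /V /W ixS; apply.
  by rewrite /ix; lia.
have K0 : 0 < K by exact: lt_le_trans K1.
have K0' := ltW K0; have d0' := ltW d_gt0.
(* 17 is 1 + 8 + 8, from [F k 0], the linear part and the remainder. With the 32 of the field bound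
   below it gives 49, rounded to 50. *)
have FV N k : `|F k (V N k)| <= 17 * K ^+ 3 * d.
  have h1 : `|F k (V N k) - F k 0 - V N k *m A k| <= 8 * K ^+ 2 * d.
    apply: le_trans (hF _ _) _; first exact: le_trans dr0.
    by apply: le_trans (bV N k); rewrite ler_piMl.
  have -> : F k (V N k) = F k 0 + V N k *m A k + (F k (V N k) - F k 0 - V N k *m A k).
    by apply/rowP => i; rewrite !mxE; ring.
  apply: le_trans (ler_normD _ _) _; apply: le_trans (lerD (ler_normD _ _) h1) _.
  have h2 : `|V N k *m A k| <= K * (8 * K ^+ 2 * d).
    by apply: le_trans (bA _ _) _; rewrite ler_pM2l.
  apply: le_trans (lerD (lerD (hF0 k) h2) (lexx _)) _.
  have Kd2 : K ^+ 2 * d <= K ^+ 3 * d.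
    by rewrite ler_wpM2r// [leRHS]exprS ler_peMl// exprn_ge0.
  have Kd1 : d <= K ^+ 2 * d by rewrite ler_peMl// exprn_ege1.
  have -> : K * (8 * K ^+ 2 * d) = 8 * (K ^+ 3 * d) by ring.
  by rewrite -!mulrA; lra.
have XW N k x : `|W N k *m Q k x| <= 32 * K ^+ 5 * d.
  have -> : W N k *m Q k x = W N k *m Pc k + (W N k *m Q k x - W N k *m Pc k).
    by rewrite subrKC.
  apply: le_trans (ler_normD _ _) _.
  apply: le_trans (lerD (bPc _ _) (hQ _ _ _)) _.
  rewrite -mulrDl; apply: le_trans (_ : (2 * K) * (16 * K ^+ 4 * d) <= _); last first.
    by rewrite le_eqVlt; apply/orP; left; apply/eqP; ring.
  apply: ler_pM => //; [by rewrite addr_ge0|].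
  have := K1; have := dl1; lra.
have /choice[p pP] : forall k, exists p : R -> 'rV[R]_n,
  [/\ p 0 = F k (v k) /\ p 1 = v (k + 1),
      forall t : R, 0 <= t <= 1 -> `|p t| <= 50 * K ^+ 5 * d
    & integral_curve (fun x => w (k + 1) *m Q (k + 1) x) p].
  move=> k.
  have cFV : F k (V N k) @[N --> U] --> F k (v k).
    apply: (@cvg_comp _ _ _ (V^~ k) (F k) _ _ _ (vP k).2); exact: cF.
  have [||p [p0 p1 pb pd]] := @euler_limit R n U (Q (k + 1)) (32 * K ^+ 5 * d)
    (17 * K ^+ 3 * d) (W^~ (k + 1)) (fun N => F k (V N k)) (w (k + 1)) (F k (v k))
    UU ooU (@cQ (k + 1)) _ (wP (k + 1)).2 cFV (fun N x => XW N (k + 1) x).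
  - by rewrite !mulr_ge0// exprn_ge0.
  - by move=> N; exact: FV.
  exists p; split=> //.
    split=> //; have h := (vP (k + 1)).2.
    have h' : V N (k + 1) @[N --> U] --> p 1.
      by apply: cvg_trans p1; apply: near_eq_cvg; exact: VW.
    exact: cvg_unique h' h.
  move=> t t01; apply: le_trans (pb t t01) _.
  have Kd2 : K ^+ 3 * d <= K ^+ 5 * d.
    by rewrite ler_wpM2r// (@exprD _ K 3 2) ler_peMr ?exprn_ge0// exprn_ege1.
  rewrite -!mulrA; have := mulr_ge0 (exprn_ge0 5 K0') d0'; lra.
exists v, w, p; split=> //.
- by move=> k; case: (vP k).
- by move=> k; case: (wP k).
- by move=> k; case: (pP k).
- by move=> k; case: (pP k).
- by move=> k; case: (pP k).
Qed.

End InfiniteShadowing.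

(** * Calculus in charts *)

Section Differentials.
Variable R : realType.

Lemma diff_eps (V W : normedModType R) (f : V -> W) (x : V) :
  differentiable f x -> forall e : R, 0 < e ->
  \forall y \near x, `|f y - f x - 'd f x (y - x)| <= e * `|y - x|.
Proof.
move=> /diff_locally /eqaddoP h e e0.
have /nbhs_ballP[r r0 hr] := h e e0.
apply/nbhs_ballP; exists r => // y; rewrite -ball_normE /= => xy.
have : `|(f \o shift x - (cst (f x) + 'd f x)) (y - x)| <= e * `|y - x|.
  by apply: hr; rewrite -ball_normE /= sub0r opprB.
by rewrite !fctE /= subrK opprD addrA.
Qed.

Lemma eps_diff (V W : normedModType R) (f : V -> W) (x : V) (L : {linear V -> W}) :
  continuous L ->
  (forall e : R, 0 < e ->
     \forall y \near x, `|f y - f x - L (y - x)| <= e * `|y - x|) ->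
  differentiable f x /\ 'd f x = L :> (V -> W).
Proof.
move=> cL h.
have o : f \o shift x = cst (f x) + L +o_ 0 id.
  apply/eqaddoP => e e0; have /nbhs_ballP[r r0 hr] := h e e0.
  apply/nbhs_ballP; exists r => // y; rewrite -ball_normE /= sub0r normrN => yr.
  have : `|f (y + x) - f x - L (y + x - x)| <= e * `|y + x - x|.
    by apply: hr; rewrite -ball_normE /= opprD addrCA subrr addr0 normrN.
  by rewrite addrK !fctE /= opprD addrA.
have dE := diff_unique cL o; split=> //.
by apply/diff_locallyP; rewrite dE.
Qed.

Lemma near_eq_diff (V W : normedModType R) (f g : V -> W) (x : V) :
  (\forall y \near x, f y = g y) -> differentiable f x ->
  differentiable g x /\ 'd g x = 'd f x :> (V -> W).
Proof.
move=> fg df; apply: eps_diff; first exact: diff_continuous.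
move=> e e0; have h := diff_eps df e0; near=> y.
have <- : f y = g y by near: y.
have <- : f x = g x by exact: nbhs_singleton fg.
by near: y.
Unshelve. all: by end_near. Qed.

Definition has_diff (V W : normedModType R) (f : V -> W) (x : V) (L : V -> W) :=
  differentiable f x /\ 'd f x = L :> (V -> W).

Lemma has_diff_unique (V W : normedModType R) (f : V -> W) (x : V) L L' :
  has_diff f x L -> has_diff f x L' -> L = L'.
Proof. by move=> [_ <-] [_ <-]. Qed.

Lemma has_diff_near (V W : normedModType R) (f g : V -> W) (x : V) L :
  (\forall y \near x, f y = g y) -> has_diff f x L -> has_diff g x L.
Proof. by move=> fg [df <-]; exact: near_eq_diff. Qed.

Lemma has_diff_comp (U V W : normedModType R) (f : U -> V) (g : V -> W) (x : U)
    L L' :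
  has_diff f x L -> has_diff g (f x) L' -> has_diff (g \o f) x (L' \o L).
Proof.
move=> [df <-] [dg <-]; split; first exact: differentiable_comp.
exact: diff_comp.
Qed.

Lemma has_diff_id (V : normedModType R) (x : V) : has_diff id x id.
Proof. have [d1 d2] := is_diff_id x; split; [exact: d1|exact: d2]. Qed.

(* Locked, to keep unification from unfolding differentials. *)
Definition jac n m (f : 'rV[R]_n -> 'rV[R]_m) z : 'M[R]_(n, m) :=
  locked (jacobian f z).

Lemma has_diff_jac n m (f : 'rV[R]_n -> 'rV[R]_m) z : differentiable f z ->
  has_diff f z (fun u => u *m jac f z).
Proof.
by move=> df; split=> //; apply/funext => u; rewrite /jac -lock /jacobian mul_rV_lin1.
Qed.

Lemma jac_continuous n m (D : set 'rV[R]_n) (f : 'rV[R]_n -> 'rV[R]_m)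
    (z : 'rV[R]_n) : nbhs z D -> Ck 1 D f -> {for z, continuous (jac f)}.
Proof.
move=> nD [df cf]; have Dz := nbhs_singleton nD.
have FZ : Filter (nbhs z) by exact: nbhs_filter.
apply: (@cvg_mxP R _ (nbhs z) FZ _ _ (jac f) (jac f z)).2 => i j.
pose e := delta_mx 0 i : 'rV[R]_n.
have E y : D y -> ('D_e f y) 0 j = jac f y i j.
  move=> Dy; have [_ h] := has_diff_jac (df y Dy).
  rewrite deriveE; last exact: df.
  by rewrite h -rowE mxE.
have h := (@cvg_mxP R _ (nbhs z) FZ _ _ _ _).1 (cf e z Dz) 0 j.
rewrite (E z Dz) in h; apply: cvg_trans h; apply: near_eq_cvg.
by apply: filterS nD => y /E.
Qed.

Lemma eq_mx_mul n m (A B : 'M[R]_(n, m)) :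
  (forall u : 'rV[R]_n, u *m A = u *m B) -> A = B.
Proof. by move=> h; apply/row_matrixP => i; rewrite !rowE. Qed.

End Differentials.

Section Charts.
Variables (R : realType) (n : nat) (M : topologicalType).
Variable S : smooth_atlas R n M.
Implicit Types (a b c : chart R n M) (x : M) (u : 'rV[R]_n).

Definition transition a b := pmap b \o pinv a.

Lemma near_pdom a x : pdom a x -> \forall y \near x, pdom a y.
Proof. by move=> ax; apply: open_nbhs_nbhs; split=> //; exact: pdom_open. Qed.

Lemma near_pcod a z : pcod a z -> \forall y \near z, pcod a y.
Proof. by move=> ax; apply: open_nbhs_nbhs; split=> //; exact: pcod_open. Qed.

Lemma pinv_cont_at a x : pdom a x -> {for pmap a x, continuous (pinv a)}.
Proof. by move=> ax; exact/pinv_cont/pmap_cod. Qed.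

Lemma near_chart a x (P : set M) : pdom a x -> (\forall y \near x, P y) ->
  \forall z \near pmap a x, P (pinv a z).
Proof.
move=> ax nP; have nP' : \forall y \near pinv a (pmap a x), P y by rewrite pmapK.
by have := pinv_cont_at ax; apply.
Qed.

Lemma near_overlap a b z : pcod a z -> pdom b (pinv a z) ->
  \forall y \near z, (pcod a `&` (pinv a @^-1` pdom b)) y.
Proof.
move=> az bz; apply: filterI; first exact: near_pcod.
by have := pinv_cont az; apply; exact: near_pdom.
Qed.

Lemma differentiable_transition a b z : charts S a -> charts S b ->
  pcod a z -> pdom b (pinv a z) -> differentiable (transition a b) z.
Proof.
by move=> Sa Sb az bz; have [h _] := transition_smooth Sa Sb 1; apply: h.
Qed.

Definition tjac a b z := jac (transition a b) z.

Lemma has_diff_transition a b x : charts S a -> charts S b ->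
  pdom a x -> pdom b x ->
  has_diff (transition a b) (pmap a x) (fun u => u *m tjac a b (pmap a x)).
Proof.
move=> Sa Sb ax bx; apply: has_diff_jac.
by apply: differentiable_transition => //; [exact: pmap_cod|rewrite pmapK].
Qed.

Lemma tjac_continuous a b z : charts S a -> charts S b ->
  pcod a z -> pdom b (pinv a z) -> {for z, continuous (tjac a b)}.
Proof.
move=> Sa Sb az bz; apply: (jac_continuous (near_overlap az bz)).
exact: transition_smooth Sa Sb 1.
Qed.

Lemma target_change (U : normedModType R) (p : U -> M) z b c L :
  charts S b -> charts S c -> {for z, continuous p} ->
  pdom b (p z) -> pdom c (p z) -> has_diff (pmap b \o p) z L ->
  has_diff (pmap c \o p) z (fun s => L s *m tjac b c (pmap b (p z))).
Proof.
move=> Sb Sc cp bz cz df.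
apply: (@has_diff_near _ _ _ (transition b c \o (pmap b \o p))).
  have : \forall y \near z, pdom b (p y) by have := cp _ (near_pdom bz).
  by apply: filterS => y by_; rewrite /transition /= pmapK.
exact: has_diff_comp df (has_diff_transition Sb Sc bz cz).
Qed.

Lemma tjacM a b c x : charts S a -> charts S b -> charts S c ->
  pdom a x -> pdom b x -> pdom c x ->
  tjac a b (pmap a x) *m tjac b c (pmap b x) = tjac a c (pmap a x).
Proof.
move=> Sa Sb Sc ax bx cx; apply: eq_mx_mul => u.
have ca : {for pmap a x, continuous (pinv a)} by exact/pinv_cont/pmap_cod.
have pa : pinv a (pmap a x) = x by rewrite pmapK.
have h := @target_change _ (pinv a) (pmap a x) b c _ Sb Sc ca.
rewrite pa in h; have := h _ bx cx (has_diff_transition Sa Sb ax bx).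
move=> /has_diff_unique/(_ (has_diff_transition Sa Sc ax cx)).
by move=> /(congr1 (fun k => k u)) <-; rewrite mulmxA.
Qed.

Lemma tjac_id a x : charts S a -> pdom a x -> tjac a a (pmap a x) = 1%:M.
Proof.
move=> Sa ax; apply: eq_mx_mul => u; rewrite mulmx1.
have h : has_diff (transition a a) (pmap a x) id.
  apply: has_diff_near (has_diff_id _).
  by apply: filterS (near_pcod (pmap_cod ax)) => y ay /=; rewrite /transition/= pinvK.
by have := has_diff_unique (has_diff_transition Sa Sa ax ax) h;
  move=> /(congr1 (fun k => k u)).
Qed.

(** Vectors at [x] are coordinates in [chart_at S x], which may jump as [x] moves, so this matrix
    need not be continuous in [x]. It converts from the fixed chart [a], in which frames, metric and
    differentials do vary continuously. *)
Definition tangent_mx a x : 'M[R]_n := tjac a (chart_at S x) (pmap a x).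

Lemma tangent_of_coordE a x u : charts S a -> pdom a x ->
  tangent_of_coord S a x u = u *m tangent_mx a x.
Proof.
move=> Sa ax; rewrite /tangent_of_coord.
have [_ h] := has_diff_transition Sa (chart_at_in S x) ax (chart_at_dom S x).
exact: (congr1 (fun k => k u) h).
Qed.

Lemma tangent_mx_unit a x : charts S a -> pdom a x -> tangent_mx a x \in unitmx.
Proof.
move=> Sa ax; have Sc := chart_at_in S x; have cx := chart_at_dom S x.
have := tjacM Sa Sc Sa ax cx ax; rewrite tjac_id// => h.
exact: (proj1 (mulmx1_unit h)).
Qed.

Section Path.
Variables (p : R -> M).

Lemma velocityE a t (v : 'rV[R]_n) : charts S a -> {for t, continuous p} ->
  pdom a (p t) -> has_diff (pmap a \o p) t (fun s => s *: v) ->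
  velocity S p t = v *m tangent_mx a (p t).
Proof.
move=> Sa cp ax dp; rewrite /velocity.
have [d1 d2] := target_change Sa (chart_at_in S (p t)) cp ax (chart_at_dom S (p t)) dp.
by rewrite derive1E' // d2 scale1r.
Qed.

End Path.

Lemma chart_path a (q q' : R -> 'rV[R]_n) : charts S a ->
  (forall t, has_diff q t (fun s => s *: q' t)) -> continuous q' ->
  (forall t, pcod a (q t)) ->
  C1_path S (pinv a \o q) /\
  forall t, velocity S (pinv a \o q) t = q' t *m tangent_mx a (pinv a (q t)).
Proof.
move=> Sa dq cq' aq.
have cq t : {for t, continuous q} by apply: differentiable_continuous; case: (dq t).
have cp t : {for t, continuous (pinv a \o q)}.
  by apply: continuous_comp; [exact: cq|apply: pinv_cont; exact: aq].
have pd t : pdom a (pinv a (q t)) by apply: pinv_dom; exact: aq.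
have dp t : has_diff (pmap a \o (pinv a \o q)) t (fun s => s *: q' t).
  by apply: has_diff_near (dq t); apply: (@filterE _ (nbhs t)) => s /=; rewrite pinvK.
split; last by move=> t; apply: velocityE => //; exact: pd.
split=> [t _|b Sb]; first exact: cp.
have db t : pdom b (pinv a (q t)) ->
    has_diff (pmap b \o (pinv a \o q)) t (fun s => (s *: q' t) *m tjac a b (q t)).
  move=> bt; have := target_change Sa Sb (cp t) (pd t) bt (dp t).
  by rewrite [(pinv a \o q) t]/= pinvK.
split=> [t [_ bt]|v t [_ bt]]; first by case: (db t bt).
have nb : \forall s \near t, pdom b (pinv a (q s)).
  by have := cp t _ (near_pdom bt).
have h : v *: q' s *m tjac a b (q s) @[s --> t] --> v *: q' t *m tjac a b (q t).
  apply: cvg_mulmx.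
    by apply: cvgZr; exact: cq'.
  have := @continuous_comp _ _ _ q (tjac a b) t (cq t).
  by apply; apply: tjac_continuous.
suff : 'D_v (pmap b \o (pinv a \o q)) s @[s --> t] -->
    'D_v (pmap b \o (pinv a \o q)) t by [].
have E s : pdom b (pinv a (q s)) -> 
    v *: q' s *m tjac a b (q s) = 'D_v (pmap b \o (pinv a \o q)) s.
  move=> bs; have [d1 d2] := db s bs.
  by rewrite deriveE// d2.
rewrite -(E t bt); apply: cvg_trans h; apply: near_eq_cvg.
by apply: filterS nb => s /E.
Qed.

End Charts.

(** * Lengths and distances *)

Lemma near_continuous (T U : topologicalType) (f h : T -> U) (x : T) :
  (\forall y \near x, f y = h y) -> {for x, continuous f} -> {for x, continuous h}.
Proof.
move=> fh cf.
suff : h y @[y --> x] --> h x by [].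
rewrite -(nbhs_singleton fh); apply: cvg_trans cf.
by apply: near_eq_cvg; apply: filterS fh.
Qed.

Section Reparametrization.
Variables (R : realType) (n : nat).

Lemma has_diff_scaler (v : 'rV[R]_n) (t : R) :
  has_diff (fun s : R => s *: v) t (fun s => s *: v).
Proof. by have [d1 d2] := is_diff_scalel t v; split. Qed.

(** [P] is controlled only on [0, 1], but [th] never leaves [0, 1], so the one-sided estimate of
    [integral_curve] applies on both sides of every [t], even where [th] reaches an end point. *)
Lemma has_diff_reparam (P : R -> 'rV[R]_n) G (th dth : R -> R) t :
  integral_curve G P ->
  (forall s, 0 <= th s <= 1) -> has_diff th t (fun s => s * dth t) ->
  has_diff (P \o th) t (fun s => s *: (dth t *: G (P (th t)))).
Proof.
move=> dP th01 [dth1 dth2].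
set x := G (P (th t)); set v := dth t *: x.
have [k1 k2] := has_diff_scaler v 0.
have [||h1 h2] := @eps_diff R _ _ (P \o th) t ('d (fun s : R => s *: v) 0).
- exact: diff_continuous.
- move=> e e0; rewrite k2.
  pose D := `|dth t| + 1; have D0 : 0 < D by rewrite ltr_wpDl.
  have x0 : 0 < `|x| + 1 by rewrite ltr_wpDl.
  have e1 : 0 < e / 2 / D by rewrite !divr_gt0.
  have e2 : 0 < e / 2 / (`|x| + 1) by rewrite !divr_gt0.
  have [eta eta0 Heta] := dP (th t) _ (th01 t) e1.
  have near1 := diff_eps dth1 (@ltr01 R).
  have near2 := diff_eps dth1 e2.
  have near3 : \forall s \near t, `|th t - th s| < eta.
    by have /cvgrPdist_lt := differentiable_continuous dth1; apply.
  rewrite dth2 in near1 near2; near=> s.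
  have n1 : `|th s - th t - (s - t) * dth t| <= 1 * `|s - t| by near: s.
  have n2 : `|th s - th t - (s - t) * dth t| <= e / 2 / (`|x| + 1) * `|s - t|.
    by near: s.
  have n3 : `|th s - th t| < eta by rewrite distrC; near: s.
  have n4 : `|th s - th t| <= D * `|s - t|.
    rewrite -(subrK ((s - t) * dth t) (th s - th t)).
    apply: le_trans (ler_normD _ _) _; rewrite normrM.
    have -> : D * `|s - t| = 1 * `|s - t| + `|s - t| * `|dth t|.
      by rewrite /D mulrDl addrC [`|s - t| * _]mulrC.
    exact: lerD.
  have n5 := Heta (th s) (th01 s) n3.
  have -> : (P \o th) s - (P \o th) t - (s - t) *: v =
      (P (th s) - P (th t) - (th s - th t) *: x) +
      (th s - th t - (s - t) * dth t) *: x.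
    by rewrite /v /=; apply/rowP => i; rewrite !mxE; ring.
  apply: le_trans (ler_normD _ _) _; rewrite [e in leRHS]splitr (mulrDl (e / 2)).
  apply: lerD.
    apply: le_trans n5 _.
    apply: le_trans (ler_wpM2r (ltW e1) n4) _.
    by rewrite mulrAC [D * _]mulrC divfK ?gt_eqF.
  rewrite normrZ; apply: le_trans (ler_wpM2r (normr_ge0 x) n2) _.
  rewrite mulrAC ler_wpM2r// mulrAC ler_pdivrMr// ler_wpM2l ?divr_ge0 ?(ltW e0)//.
  by rewrite lerDl.
split; [exact: h1|exact: (etrans h2 k2)].
Unshelve. all: by end_near. Qed.

(* Since a C^1 path has to be C^1 on the whole real line, curves defined on
   [0, 1] are precomposed with this C^1 map from the line onto [0, 1]. *)
Definition ramp (t : R) : R := (1 - cos (pi * t)) / 2.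
Definition ramp' (t : R) : R := pi * sin (pi * t) / 2.

Lemma ramp_itv t : 0 <= ramp t <= 1.
Proof.
rewrite /ramp; have := cos_geN1 (pi * t); have := cos_le1 (pi * t); lra.
Qed.

Lemma ramp0 : ramp 0 = 0.
Proof. by rewrite /ramp mulr0 cos0 subrr mul0r. Qed.

Lemma ramp1 : ramp 1 = 1.
Proof. by rewrite /ramp mulr1 cospi; lra. Qed.

Lemma ramp'_le t : `|ramp' t| <= 2.
Proof.
rewrite /ramp' mulrAC normrM; have h2 := pihalf_lt2 R; have p0 := pi_gt0 R.
rewrite (@ger0_norm _ (pi / 2)) ?divr_ge0 ?(ltW p0)//.
apply: le_trans (_ : pi / 2 * 1 <= _); last by rewrite mulr1 ltW.
rewrite ler_wpM2l ?divr_ge0 ?(ltW p0)// ler_norml.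
by rewrite sin_geN1 sin_le1.
Qed.

Lemma has_diff_ramp t : has_diff ramp t (fun s => s * ramp' t).
Proof.
have h1 : is_derive t 1 (fun t : R => pi * t) pi.
  apply/is_derive1_caratheodory; exists (cst pi).
  by split=> [z||//]; [rewrite /= mulrBr|exact: cst_continuous].
have h2 := is_derive1_comp (is_derive_cos (pi * t)) h1.
have h3 : is_derive (cos (pi * t)) 1 (fun c : R => (1 - c) / 2) (- 2^-1).
  apply/is_derive1_caratheodory; exists (cst (- 2^-1)).
  by split=> [z||//]; [rewrite /=; lra|exact: cst_continuous].
have [d1 d2] := is_derive1_comp h3 h2.
have /derivable1_diffP d3 := d1.
split; first exact: d3.
have e : (fun h : R => h *: derive1 ramp t) = (fun s : R => s * ramp' t).
  apply/funext => h; congr (_ * _); rewrite derive1E d2 /ramp'.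
  by field.
by rewrite -e; exact: diff1E.
Qed.

Lemma continuous_ramp' : continuous ramp'.
Proof.
move=> t; apply: cvgM; last exact: cvg_cst.
apply: cvgM; first exact: cvg_cst.
apply: (@continuous_comp _ _ _ (fun t : R => pi * t) sin t); last exact: continuous_sin.
by apply: cvgM; [exact: cvg_cst|exact: cvg_id].
Qed.

End Reparametrization.

Section Metric.
Variables (R : realType) (n : nat) (M : topologicalType).
Variables (S : smooth_atlas R n M) (g : riemannian_metric S).
Implicit Types (a b c : chart R n M) (x : M) (u v : 'rV[R]_n).

(** The Gram matrix in the coordinates of the fixed chart [a]; the jumps of [gram] and of
    [tangent_mx] compensate, and the product is continuous. *)
Definition chart_gram a x : 'M[R]_n :=
  tangent_mx S a x *m gram g x *m (tangent_mx S a x)^T.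

Lemma inner_tangent a x u v :
  inner g x (u *m tangent_mx S a x) (v *m tangent_mx S a x) =
  (u *m chart_gram a x *m v^T) 0 0.
Proof. by rewrite /inner /chart_gram trmx_mul !mulmxA. Qed.

Lemma chart_gram_continuous a x : charts S a -> pdom a x ->
  {for x, continuous (chart_gram a)}.
Proof.
move=> Sa ax.
apply: (@cvg_mxP R _ (nbhs x) _ _ _ (chart_gram a) (chart_gram a x)).2 => i j.
pose ei := delta_mx 0 i : 'rV[R]_n; pose ej := delta_mx 0 j : 'rV[R]_n.
have E y : pdom a y -> inner g (pinv a (pmap a y))
    (tangent_of_coord S a (pinv a (pmap a y)) ei)
    (tangent_of_coord S a (pinv a (pmap a y)) ej) = chart_gram a y i j.
  move=> ay; rewrite pmapK// !tangent_of_coordE// inner_tangent.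
  by rewrite /ei -rowE trmx_delta -colE !mxE.
have h1 := @gram_smooth _ _ _ _ g a Sa ei ej 0%N _ (pmap_cod ax).
have h2 := pmap_cont ax.
have h3 := @continuous_comp _ _ _ (pmap a) _ x h2 h1.
apply: (@near_continuous _ _ _ (fun y => chart_gram a y i j) x _ h3).
by apply: filterS (near_pdom ax) => y /E.
Qed.

Lemma tnormZ x (s : R) v : tnorm g x (s *: v) = `|s| * tnorm g x v.
Proof.
rewrite /tnorm /inner -scalemxAl -scalemxAl linearZ /= -scalemxAr !mxE.
by rewrite mulrA -expr2 sqrtrM ?sqr_ge0// sqrtr_sqr.
Qed.

Lemma tnorm_ge0 x v : 0 <= tnorm g x v.
Proof. exact: sqrtr_ge0. Qed.

Definition quad (A : 'M[R]_n) u : R := (u *m A *m u^T) 0 0.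

Lemma quadB (A B : 'M[R]_n) u : quad A u - quad B u = quad (A - B) u.
Proof.
by rewrite /quad mulmxBr mulmxBl [in RHS]mxE; congr (_ + _); rewrite [in RHS]mxE.
Qed.

Lemma quad0 (A : 'M[R]_n) : quad A 0 = 0.
Proof. by rewrite /quad !mul0mx mxE. Qed.

Lemma quadZ (A : 'M[R]_n) (s : R) u : quad A (s *: u) = s ^+ 2 * quad A u.
Proof.
by rewrite /quad -!scalemxAl linearZ /= -scalemxAr !mxE mulrA.
Qed.

(** The quadratic form at [x0] has a positive minimum on the compact unit sphere of the sup norm,
    and a small perturbation of the Gram matrix keeps half of it. *)
Lemma norm_bounds a x0 : charts S a -> pdom a x0 ->
  exists2 K : R, 1 <= K & \forall x \near x0, pdom a x /\ forall u,
    `|u| <= K * tnorm g x (u *m tangent_mx S a x) /\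
    tnorm g x (u *m tangent_mx S a x) <= K * `|u|.
Proof.
move=> Sa ax0; set H0 := chart_gram a x0.
have Qb (H : 'M[R]_n) u : `|quad H u| <= n%:R * n%:R * `|H| * `|u| ^+ 2.
  apply: le_trans (coord_norm_le _ _ _) _.
  apply: le_trans (norm_mulmx_le _ _) _.
  have uT : `|u^T| <= `|u|.
    by apply: mx_norm_le => // i j; rewrite mxE; exact: coord_norm_le.
  apply: le_trans (ler_wpM2l _ uT) _; first by rewrite mulr_ge0.
  apply: le_trans (ler_wpM2r _ (ler_wpM2l _ (norm_mulmx_le u H))) _ => //.
  by rewrite le_eqVlt; apply/orP; left; apply/eqP; ring.
have [c c0 Qc] : exists2 c, 0 < c & forall u, 2 * c * `|u| ^+ 2 <= quad H0 u.
  (* Without unit vectors every vector is 0, as in dimension 0, and any constant will do. *)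
  have [[u1 u1n]|no] := pselect (exists u1 : 'rV[R]_n, `|u1| = 1); last first.
    exists 1 => // u; have [->|u0] := eqVneq u 0.
      by rewrite normr0 expr0n mulr0 quad0.
    exfalso; apply: no; exists (`|u|^-1 *: u).
    by rewrite normrZ normfV normr_id mulVf// normr_eq0.
  have cS : compact [set u : 'rV[R]_n | `|u| = 1].
    rewrite (_ : mkset _ = [set u : 'rV[R]_n | `|u| <= 1] `&`
       [set u : 'rV[R]_n | 1 <= `|u|]); last first.
      apply/seteqP; split=> u /= => [->//|[h1 h2]].
      by apply/eqP; rewrite eq_le h1.
    apply: compact_closedI; first exact: ball_closed_compact.
    apply: (@closed_comp _ _ (fun v : 'rV[R]_n => `|v|) [set x | 1 <= x]).
      by move=> v _; exact: norm_continuous.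
    exact: closed_ge.
  have cQ : continuous (quad H0).
    move=> u; pose F := nbhs u; have FF : Filter F by exact: nbhs_filter.
    suff : quad H0 v @[v --> F] --> quad H0 u by [].
    have h : v *m H0 *m v^T @[v --> F] --> u *m H0 *m u^T.
      apply: cvg_mulmx; first by apply: cvg_mulmx => //; exact: cvg_cst.
      apply/cvg_mxP => i j; rewrite mxE; under eq_cvg do rewrite mxE.
      exact: coord_continuous.
    exact: (cvg_mxP _ _).1 h _ _.
  have [|um um1 umin] := EVT_min_rV _ cS (continuous_subspaceT cQ).
    by exists u1.
  rewrite inE /= in um1.
  have um0 : um != 0 by rewrite -normr_eq0 um1 oner_eq0.
  have Qum : 0 < quad H0 um.
    rewrite /quad -inner_tangent; apply: gram_pos.
    apply: contra um0 => /eqP h; apply/eqP.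
    by rewrite -(mulmxK (tangent_mx_unit Sa ax0) um) h mul0mx.
  exists (quad H0 um / 2); first by rewrite divr_gt0.
  move=> u; rewrite mulrC mulrCA.
  have [->|u0] := eqVneq u 0.
    by rewrite normr0 expr0n mul0r quad0.
  have nu0 : `|u| != 0 by rewrite normr_eq0.
  have -> : quad H0 u = `|u| ^+ 2 * quad H0 (`|u|^-1 *: u).
    by rewrite quadZ mulrA exprVn mulfV ?mul1r// expf_neq0.
  rewrite (_ : 2 * _ = `|u| ^+ 2 * quad H0 um); last by field.
  apply: ler_wpM2l; first exact: sqr_ge0.
  by apply: umin; rewrite inE /= normrZ normfV normr_id mulVf.
set B := n%:R * n%:R * `|H0| + c.
have B0 : 0 < B by rewrite ltr_wpDl// !mulr_ge0.
exists (1 + Num.sqrt c^-1 + Num.sqrt B).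
  by rewrite -addrA lerDl addr_ge0 ?sqrtr_ge0.
(* Through [Qb], which costs a factor [n * n], this tolerance changes the form by at most [c] out of
   its lower bound [2 * c]. *)
have e0 : 0 < c / (n%:R * n%:R + 1) by rewrite divr_gt0// ltr_wpDl// mulr_ge0.
have cg := chart_gram_continuous Sa ax0.
have nH : \forall x \near x0, `|H0 - chart_gram a x| < c / (n%:R * n%:R + 1).
  by have /cvgrPdist_lt := cg; apply.
near=> x; split; first by near: x; exact: near_pdom.
move=> u; have := inner_tangent a x u u; rewrite -/(quad _ _) /tnorm => ->.
have dQ : `|quad H0 u - quad (chart_gram a x) u| <= c * `|u| ^+ 2.
  have -> : quad H0 u - quad (chart_gram a x) u = quad (H0 - chart_gram a x) u.
    exact: quadB.
  apply: le_trans (Qb _ _) _; apply: ler_wpM2r; first exact: sqr_ge0.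
  have nx : `|H0 - chart_gram a x| < c / (n%:R * n%:R + 1) by near: x.
  apply: le_trans (ler_wpM2l _ (ltW nx)) _; first by rewrite mulr_ge0.
  rewrite mulrA ler_pdivrMr; last by rewrite ltr_wpDl// mulr_ge0.
  by rewrite mulrC ler_pM2l// lerDl.
have lo : c * `|u| ^+ 2 <= quad (chart_gram a x) u.
  have q1 := Qc u; move: dQ; rewrite ler_norml => /andP[_ q2].
  rewrite -(lerD2l (c * `|u| ^+ 2)) -mulr2n -mulr_natl mulrA.
  by apply: le_trans q1 _; rewrite -lerBlDr.
have hi : quad (chart_gram a x) u <= B * `|u| ^+ 2.
  have := Qb H0 u; rewrite ler_norml => /andP[_ h1].
  move: dQ; rewrite distrC ler_norml => /andP[_ h2].
  by rewrite /B mulrDl -lerBlDl; apply: le_trans h2; rewrite lerB.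
have Q0 : 0 <= quad (chart_gram a x) u.
  by apply: le_trans lo; rewrite mulr_ge0 ?sqr_ge0// ltW.
split.
  apply: le_trans (_ : Num.sqrt c^-1 * Num.sqrt (quad (chart_gram a x) u) <= _).
    rewrite -sqrtrM ?invr_ge0 ?(ltW c0)// -[leLHS]normr_id -sqrtr_sqr ler_wsqrtr//.
    by rewrite ler_pdivlMl.
  rewrite ler_wpM2r ?sqrtr_ge0// addrAC lerDr addr_ge0 ?sqrtr_ge0//.
apply: le_trans (_ : Num.sqrt B * `|u| <= _).
  by rewrite -[X in _ * X]normr_id -sqrtr_sqr -sqrtrM ?(ltW B0)// ler_wsqrtr.
by rewrite ler_wpM2r// lerDr addr_ge0 ?sqrtr_ge0.
Unshelve. all: by end_near. Qed.

(* No measurability is needed, because the integral of a nonnegative function is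
   a supremum over the simple functions below it. *)
Lemma le_integral_ge0 (A B : set R) (f h : R -> \bar R) :
  A `<=` B -> (forall t, A t -> 0 <= f t)%E -> (forall t, B t -> 0 <= h t)%E ->
  (forall t, A t -> f t <= h t)%E ->
  (\int[@lebesgue_measure R]_(t in A) f t <=
   \int[@lebesgue_measure R]_(t in B) h t)%E.
Proof.
move=> AB f0 h0 fh; rewrite !ge0_integralE//; apply: le_ereal_sup => _ [k kf <-].
exists k => // t; apply: le_trans (kf t) _.
rewrite /patch; case: ifPn => [/set_mem At|_].
  by rewrite mem_set; [exact: fh|exact: AB].
by case: ifPn => [/set_mem|//]; exact: h0.
Qed.

Lemma path_length_le (p : R -> M) (B : R) : 0 <= B ->
  (forall t, 0 <= t <= 1 -> tnorm g (p t) (velocity S p t) <= B) ->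
  (path_length g p <= B%:E)%E.
Proof.
move=> B0 h; rewrite /path_length.
apply: (@le_trans _ _ (\int[@lebesgue_measure R]_(t in `[0%R, 1%R]) (cst B%:E) t)%E).
  apply: le_integral_ge0 => [//|t _|t _|t /=].
  - by rewrite lee_fin; exact: tnorm_ge0.
  - by rewrite lee_fin.
  - by rewrite in_itv /= lee_fin; exact: h.
rewrite integral_cst//= lebesgue_measure_itv /= lte_fin ltr01.
by rewrite -EFinB subr0 mule1.
Qed.

Lemma path_length_ge0 (p : R -> M) : (0 <= path_length g p)%E.
Proof. by apply: integral_ge0 => t _; rewrite lee_fin; exact: tnorm_ge0. Qed.

Lemma dist_in_le (A : set M) (p : R -> M) (B : R) : 0 <= B -> C1_path S p ->
  p @` `[0, 1] `<=` A ->
  (forall t, 0 <= t <= 1 -> tnorm g (p t) (velocity S p t) <= B) ->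
  (dist_in g A (p 0%R) (p 1%R) <= B%:E)%E.
Proof.
move=> B0 cp pA h; apply: le_trans (path_length_le B0 h).
by apply: ereal_inf_lbound; exists p.
Qed.

Lemma dist_in_refl (A : set M) x : A x -> (dist_in g A x x <= 0)%E.
Proof.
move=> Ax; have Sc := chart_at_in S x; have cx := chart_at_dom S x.
pose q (t : R) : 'rV[R]_n := pmap (chart_at S x) x.
have dq t : has_diff q t (fun s => s *: (0 : 'rV[R]_n)).
  have [d1 d2] := is_diff_cst (pmap (chart_at S x) x) t; split=> //.
  by apply: (etrans d2); apply/funext => s /=; rewrite scaler0.
have [||cp vp] := @chart_path R n M S (chart_at S x) q (fun=> 0) Sc dq.
- exact: cst_continuous.
- by move=> t; exact: pmap_cod.
have E : pinv (chart_at S x) \o q = fun=> x by apply/funext => t /=; rewrite pmapK.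
rewrite E in cp vp.
apply: (@dist_in_le A (fun=> x) 0) => //; first by move=> _ [t _ <-].
move=> t _; rewrite vp mul0mx -(scale0r (0 : 'rV[R]_n)) tnormZ normr0 mul0r//.
Qed.

(** For the sup norm it is enough to treat one coordinate: its displacement is the integral of its
    derivative, and the latter is at most [K] times the Riemannian speed. Only the part of the path
    up to [T] has to stay in the chart. *)
Lemma length_lower a (p : R -> M) (K T : R) : charts S a -> C1_path S p ->
  0 < K -> 0 <= T <= 1 ->
  (forall t, 0 <= t <= T -> pdom a (p t) /\
     forall u, `|u| <= K * tnorm g (p t) (u *m tangent_mx S a (p t))) ->
  ((`|pmap a (p T) - pmap a (p 0)| / K)%:E <= path_length g p)%E.
Proof.
move=> Sa [cp cp1] K0 /andP[T0 T1] hp.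
have [->|T0'] := eqVneq T 0; first by rewrite subrr normr0 mul0r path_length_ge0.
have {}T0' : 0 < T by rewrite lt_neqAle eq_sym T0' T0.
pose h := pmap a \o p; pose h' (t : R) : 'rV[R]_n := 'D_1 h t.
have [dh ch] := cp1 a Sa.
have tD t : 0 <= t <= T -> (setT `&` (p @^-1` pdom a)) t.
  by move=> t0T; split=> //; case: (hp t t0T).
have hd t : 0 <= t <= T -> has_diff h t (fun s => s *: h' t).
  move=> t0T; have d1 := dh t (tD t t0T); split=> //.
  by rewrite /h' -derive1E; exact: diff1E.
have ch' t : 0 <= t <= T -> {for t, continuous h'}.
  by move=> t0T; apply: ch; exact: tD.
have hv t : 0 <= t <= T -> `|h' t| <= K * tnorm g (p t) (velocity S p t).
  move=> t0T; have [pt hu] := hp t t0T.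
  by rewrite (velocityE Sa (cp t I) pt (hd t t0T)); exact: hu.
suff H i : ((`|h T 0 i - h 0 0 i| / K)%:E <= path_length g p)%E.
  have [l ll] : exists l : R, path_length g p = l%:E \/ path_length g p = +oo%E.
    have := path_length_ge0 p; case: (path_length g p) => [l _|_|//].
      by exists l; left.
    by exists 0; right.
  case: ll => ll; last by rewrite ll leey.
  rewrite ll lee_fin ler_pdivrMr//.
  have l0 : 0 <= l by rewrite -lee_fin -ll path_length_ge0.
  apply: mx_norm_le => [|j i]; first by rewrite mulr_ge0// ltW.
  by rewrite [j]ord1 !mxE -ler_pdivrMr// -lee_fin -ll; exact: H.
pose f (t : R) : R := h' t 0 i / K; pose F (t : R) : R := h t 0 i / K.
have fc t : 0 <= t <= T -> {for t, continuous f}.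
  move=> t0T; apply: cvgM; last exact: cvg_cst.
  exact: (@cvg_mxP R _ (nbhs t) _ _ _ h' (h' t)).1 (ch' t t0T) 0 i.
have hi t : 0 <= t <= T -> is_derive t 1 (fun s => h s 0 i) (h' t 0 i).
  move=> t0T; have [d1 d2] := hd t t0T.
  have dv : derivable h t 1 by exact: diff_derivable.
  apply: DeriveDef; first by move/derivable_mxP : dv; apply.
  by rewrite /h' derive_mx// mxE.
have Fd t : 0 <= t <= T -> is_derive t 1 F (f t).
  move=> t0T; have h1 := hi t t0T.
  have h2 : is_derive (h t 0 i) 1 (fun c : R => c / K) K^-1.
    apply/is_derive1_caratheodory; exists (cst K^-1).
    by split=> [z||//]; [rewrite /= -mulrBl mulrC|exact: cst_continuous].
  by have := is_derive1_comp h2 h1; rewrite mulrC.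
have Fc t : 0 <= t <= T -> {for t, continuous F}.
  move=> t0T; apply: differentiable_continuous; apply/derivable1_diffP.
  by case: (Fd t t0T).
have fw : {within `[0, T], continuous f}.
  apply: continuous_in_subspaceT => t; rewrite inE /= in_itv /= => t0T.
  exact: fc.
have FTC : (\int[@lebesgue_measure R]_(t in `[0%R, T]) (f t)%:E = (F T)%:E - (F 0)%:E)%E.
  apply: continuous_FTC2 => //.
  - split.
    + move=> t; rewrite in_itv /= => /andP[t0 tT].
      by have [] := Fd t (introT andP (conj (ltW t0) (ltW tT))).
    + by apply: cvg_at_right_filter; apply: Fc; rewrite lexx ltW.
    + by apply: cvg_at_left_filter; apply: Fc; rewrite lexx ltW.
  - move=> t; rewrite in_itv /= => /andP[t0 tT]; rewrite derive1E.
    by have [_] := Fd t (introT andP (conj (ltW t0) (ltW tT))).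
have mf : measurable_fun `[0%R, T] f.
  by apply: measurable_realfun.subspace_continuous_measurable_fun => //; exact: fw.
have -> : (`|h T 0 i - h 0 0 i| / K)%:E =
    (`| \int[@lebesgue_measure R]_(t in `[0%R, T]) (f t)%:E |)%E.
  rewrite FTC -EFinB abse_EFin /F -mulrBl normrM normfV.
  by rewrite (gtr0_norm K0).
apply: le_trans (le_abse_integral _ _ _) _ => //.
  by apply/measurable_realfun.measurable_EFinP.
apply: le_integral_ge0 => //.
- move=> t; rewrite /= !in_itv /= => /andP[-> tT]; exact: le_trans T1.
- by move=> t _; rewrite lee_fin; exact: tnorm_ge0.
move=> t; rewrite /= in_itv /= => t0T; rewrite lee_fin.
rewrite /f normrM normfV (gtr0_norm K0) ler_pdivrMr// mulrC.
apply: le_trans (hv t t0T); exact: coord_norm_le.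
Qed.

Lemma chart_curve a (P : R -> 'rV[R]_n) (G : 'rV[R]_n -> 'rV[R]_n)
    (th dth : R -> R) : charts S a ->
  integral_curve G P ->
  (forall t, 0 <= t <= 1 -> {for P t, continuous G}) ->
  (forall t, 0 <= t <= 1 -> pcod a (P t)) ->
  (forall t, 0 <= th t <= 1) ->
  (forall t, has_diff th t (fun s => s * dth t)) -> continuous dth ->
  C1_path S (pinv a \o (P \o th)) /\
  forall t, velocity S (pinv a \o (P \o th)) t =
    (dth t *: G (P (th t))) *m tangent_mx S a (pinv a (P (th t))).
Proof.
move=> Sa dP cG aP th01 dt cdt.
have dq t : has_diff (P \o th) t (fun s => s *: (dth t *: G (P (th t)))).
  exact: has_diff_reparam.
apply: chart_path => // t; last by apply: aP.
have h1 : {for t, continuous (P \o th)}.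
  by apply: differentiable_continuous; case: (dq t).
have h2 := @continuous_comp _ _ _ (P \o th) G t h1 (cG _ (th01 t)).
by apply: cvgZ; [exact: cdt|exact: h2].
Qed.

(** The two orders of the end points are obtained by running [P] along [ramp] and along [1 - ramp];
    the factor 2 bounds the derivative of [ramp]. *)
Lemma curve_dist a (P : R -> 'rV[R]_n) (G : 'rV[R]_n -> 'rV[R]_n)
    (K B : R) (A : set M) : charts S a -> 0 <= K -> 0 <= B ->
  integral_curve G P ->
  (forall t, 0 <= t <= 1 -> {for P t, continuous G}) ->
  (forall t, 0 <= t <= 1 -> pcod a (P t)) ->
  (forall t, 0 <= t <= 1 -> A (pinv a (P t))) ->
  (forall t, 0 <= t <= 1 -> `|G (P t)| <= B) ->
  (forall t, 0 <= t <= 1 -> forall u,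
     tnorm g (pinv a (P t)) (u *m tangent_mx S a (pinv a (P t))) <= K * `|u|) ->
  (dist_in g A (pinv a (P 0%R)) (pinv a (P 1%R)) <= (K * (2 * B))%:E)%E /\
  (dist_in g A (pinv a (P 1%R)) (pinv a (P 0%R)) <= (K * (2 * B))%:E)%E.
Proof.
move=> Sa K0 B0 dP cG aP AP GB KP.
have key (th dth : R -> R) : (forall t, 0 <= th t <= 1) ->
    (forall t, has_diff th t (fun s => s * dth t)) -> continuous dth ->
    (forall t, `|dth t| <= 2) ->
    (dist_in g A (pinv a (P (th 0%R))) (pinv a (P (th 1%R))) <= (K * (2 * B))%:E)%E.
  move=> th01 dt cdt dt2; have [c v] := chart_curve Sa dP cG aP th01 dt cdt.
  have KB : 0 <= K * (2 * B) by rewrite !mulr_ge0.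
  apply: (dist_in_le KB c) => [_ [t _ <-]|t _]; first exact: AP.
  rewrite v; apply: le_trans (KP _ (th01 t) _) _; apply: ler_wpM2l => //.
  by rewrite normrZ; apply: ler_pM => //; exact: GB.
have cr := @continuous_ramp' R.
split.
  have := key _ _ (@ramp_itv R) (@has_diff_ramp R) cr (@ramp'_le R).
  by rewrite ramp0 ramp1.
have := key (fun t => 1 - ramp t) (fun t => - ramp' t).
rewrite ramp0 ramp1 subr0 subrr; apply.
- by move=> t; have := ramp_itv t; lra.
- move=> t; have [d1 d2] := has_diff_ramp t.
  have [c1 c2] := is_diff_cst (1 : R) t.
  split; first exact: (differentiableB c1 d1).
  apply: (etrans (diffB c1 d1)); rewrite c2 d2.
  by apply/funext => s; rewrite -[LHS]/(0 - s * ramp' t) sub0r mulrN.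
- by move=> t; apply: cvgN; exact: cr.
- by move=> t; rewrite normrN; exact: ramp'_le.
Qed.

Lemma segment_deriv (z v : 'rV[R]_n) (t0 e : R) : 0 < e ->
  exists2 eta : R, 0 < eta & forall t : R, 0 <= t <= 1 -> `|t - t0| < eta ->
   `|z + t *: v - (z + t0 *: v) - (t - t0) *: v| <= `|t - t0| * e.
Proof.
move=> e0; exists 1 => // t _ _.
rewrite (_ : _ - _ = 0) ?normr0 ?mulr_ge0 ?(ltW e0)//.
by apply/rowP => i; rewrite !mxE; ring.
Qed.

Lemma segment_near (z1 z2 z0 : 'rV[R]_n) (r t : R) : 0 <= t <= 1 ->
  `|z1 - z0| < r -> `|z2 - z0| < r -> `|z1 + t *: (z2 - z1) - z0| < r.
Proof.
move=> /andP[t0 t1] h1 h2.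
have -> : z1 + t *: (z2 - z1) - z0 = (1 - t) *: (z1 - z0) + t *: (z2 - z0).
  by apply/rowP => i; rewrite !mxE; ring.
apply: le_lt_trans (ler_normD _ _) _; rewrite !normrZ !ger0_norm ?subr_ge0//.
have [t1'|t1'] := ltP t 1.
  have h3 : (1 - t) * `|z1 - z0| < (1 - t) * r by rewrite ltr_pM2l// subr_gt0.
  have h4 : t * `|z2 - z0| <= t * r by rewrite ler_wpM2l// ltW.
  by apply: lt_le_trans (ltr_leD h3 h4) _; rewrite -mulrDl subrK mul1r.
have -> : t = 1 by apply/eqP; rewrite eq_le t1.
by rewrite subrr mul0r add0r mul1r.
Qed.

Lemma chart_ball a x0 (P : set M) : pdom a x0 -> (\forall x \near x0, P x) ->
  exists2 r : R, 0 < r & forall z, `|z - pmap a x0| < r ->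
    pcod a z /\ P (pinv a z).
Proof.
move=> ax0 nP.
have n1 := near_pcod (pmap_cod ax0).
have n2 := near_chart ax0 nP.
have /nbhs_ballP[r r0 hr] : \forall z \near pmap a x0, pcod a z /\ P (pinv a z).
  exact: filterI n1 n2.
exists r => // z zr; apply: hr.
by rewrite -ball_normE /= distrC.
Qed.

(** The straight segment in the chart is a competitor, and convexity keeps it in the ball where
    [norm_bounds] holds. *)
Lemma rdist_upper a x0 : charts S a -> pdom a x0 ->
  exists r C : R, [/\ 0 < r, 0 < C & forall z1 z2, `|z1 - pmap a x0| < r ->
    `|z2 - pmap a x0| < r ->
    [/\ pcod a z1, pcod a z2 &
       (rdist g (pinv a z1) (pinv a z2) <= (C * `|z1 - z2|)%:E)%E]].
Proof.
move=> Sa ax0; have [K K1 nK] := norm_bounds Sa ax0.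
have K0 : 0 < K by rewrite (lt_le_trans ltr01).
have [r r0 hr] := chart_ball ax0 nK.
exists r, (K * 2); split=> //; first by rewrite mulr_gt0.
move=> z1 z2 h1 h2; have [c1 _] := hr z1 h1; have [c2 _] := hr z2 h2.
split=> //; pose P (t : R) := z1 + t *: (z2 - z1).
have nP t : 0 <= t <= 1 -> `|P t - pmap a x0| < r.
  by move=> t01; exact: segment_near.
have [|||||||h _] := @curve_dist a P (fun=> z2 - z1) K `|z1 - z2| setT Sa (ltW K0).
- by [].
- by move=> t0 e _ e0; exact: segment_deriv.
- by move=> t _; exact: cst_continuous.
- by move=> t /nP /hr[].
- by [].
- by move=> t _; rewrite distrC.
- by move=> t /nP /hr[_ [_ b]] u; case: (b u).
move: h; rewrite /P scale0r addr0 scale1r subrKC mulrA; exact.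
Qed.

(* A path starting near [x0] either stays in a small chart ball, where its length
   bounds the displacement in the chart, or has to cross an annulus of fixed
   width before its first exit, and is then long. *)
Lemma rdist_lower a x0 : hausdorff_space M -> charts S a -> pdom a x0 ->
  exists rho C : R, [/\ 0 < rho, 0 < C & \forall y \near x0, forall x' d,
    0 < d < rho -> (rdist g y x' <= d%:E)%E ->
    [/\ pdom a y, pdom a x' & `|pmap a x' - pmap a y| <= C * d]].
Proof.
move=> haus Sa ax0; have [K K1 nK] := norm_bounds Sa ax0.
have K0 : 0 < K by rewrite (lt_le_trans ltr01).
have [r' r'0 hr'] := chart_ball ax0 nK; set z0 := pmap a x0 in hr'.
pose r := r' / 2; have r0 : 0 < r by rewrite divr_gt0.
have hr z : `|z - z0| <= r -> [/\ pcod a z, pdom a (pinv a z) &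
    forall u, `|u| <= K * tnorm g (pinv a z) (u *m tangent_mx S a (pinv a z))].
  move=> zr; have [|c [d b]] := hr' z.
    by apply: le_lt_trans zr _; rewrite /r; lra.
  by split=> // u; case: (b u).
pose V : set M := [set x | pdom a x /\ `|pmap a x - z0| < r].
pose Vc : set M := pinv a @` [set z | `|z - z0| <= r].
have oV : open V.
  rewrite openE => x [ax xr]; apply: filterI; first exact: near_pdom.
  have cx : {for x, continuous (fun y => `|pmap a y - z0|)}.
    have c1 := pmap_cont ax.
    have c2 : pmap a y - z0 @[y --> x] --> pmap a x - z0.
      by apply: cvgB; [exact: c1|exact: cvg_cst].
    exact: cvg_norm c2.
  exact: (cvgr_lt _ cx).
have cVc : closed Vc.
  apply: compact_closed => //; apply: continuous_compact.
    apply: continuous_in_subspaceT => z; rewrite inE /= => zr.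
    by apply: pinv_cont; case: (hr z zr).
  rewrite (_ : mkset _ = (fun v => v + z0) @` [set v : 'rV[R]_n | `|v| <= r]).
    apply: continuous_compact; last exact: ball_closed_compact.
    apply: continuous_subspaceT => v.
    suff : w + z0 @[w --> nbhs v] --> v + z0 by [].
    have FV : Filter (nbhs v) by exact: nbhs_filter.
    by apply: (@cvgD _ _ _ (nbhs v) FV) => //; exact: cvg_cst.
  apply/seteqP; split=> [z /= zr|_ [v vr <-] /=]; last by rewrite addrK.
  by exists (z - z0); rewrite ?subrK.
have VVc : V `<=` Vc.
  by move=> x [ax xr]; exists (pmap a x); [exact: ltW|rewrite pmapK].
(* A path that leaves [V] moves at least [r / 2] in the chart, so its length is at least
   [r / (2 * K)], which exceeds [2 * d] when [d < r / (4 * K)]. *)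
exists (r / (4 * K)), (2 * K); split; [by rewrite divr_gt0 ?mulr_gt0|by rewrite mulr_gt0|].
have c2 : \forall y \near x0, pdom a y /\ `|pmap a y - z0| < r / 2.
  apply: filterI; first exact: near_pdom.
  have := pmap_cont ax0 => /cvgrPdist_lt /(_ (r / 2)); rewrite divr_gt0//.
  by move=> /(_ isT); apply: filterS => y; rewrite distrC.
apply: filterS c2 => y [ay yr] x' d /andP[d0 dr] yx'.
(* The infimum need not be attained; the strict bound by [2 * d] yields an actual path. *)
have : (rdist g y x' < (2 * d)%:E)%E.
  by apply: le_lt_trans yx' _; rewrite lte_fin; lra.
move=> /ereal_inf_lt[_ [p [cp p0 p1 _] <-]] lp.
have cont t : {for t, continuous p} by case: cp => cp _; exact: cp.
have low T : 0 <= T <= 1 -> (forall t, 0 <= t <= T -> Vc (p t)) ->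
    `|pmap a (p T) - pmap a y| < 2 * K * d.
  move=> T01 hT.
  have : ((`|pmap a (p T) - pmap a (p 0)| / K)%:E <= path_length g p)%E.
    apply: length_lower => // t /hT[z zr <-]; have [c1 c3 c4] := hr z zr.
    by split.
  move=> /le_lt_trans/(_ lp); rewrite lte_fin ltr_pdivrMr// p0.
  by rewrite mulrAC.
have Vy : V y by split=> //; apply: lt_le_trans yr _; lra.
have [allV|/existsNP[s /not_implyP[s01 nVs]]] :=
    pselect (forall t, 0 <= t <= 1 -> V (p t)).
  have /low h : (0 : R) <= 1 <= (1 : R) by rewrite ler01 lexx.
  rewrite p1 in h; have [ax' _] : V x' by rewrite -p1; apply: allV; rewrite ler01 lexx.
  by split=> //; apply/ltW/h => t t01; apply: VVc; exact: allV.
exfalso.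
pose Z : set R := `[0, 1] `&` [set t | ~ V (p t)].
have cZ : compact Z.
  apply: compact_closedI; first exact: segment_compact.
  apply: open_closedC; rewrite openE => t Vt.
  by apply: cont; move: oV; rewrite openE; apply.
have Zne : Z !=set0 by exists s; split=> //; rewrite /= in_itv.
have [T [T01 nVT] Tmin] : exists2 T, Z T & forall t, Z t -> T <= t.
  have [|T ZT hT] := compact_EVT_min Zne cZ (f := fun t : R => t).
    by apply: continuous_subspaceT => t; exact: cvg_id.
  by exists T => [|t Zt]; [exact: set_mem|apply: hT; exact: mem_set].
rewrite /= in_itv /= in T01; have /andP[T0 T1] := T01.
have T0' : 0 < T.
  rewrite lt_neqAle T0 andbT; apply/eqP => E; apply: nVT.
  by rewrite /= -E p0.
have before t : 0 <= t < T -> V (p t).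
  move=> /andP[t0 tT]; apply: contrapT => nV.
  have : Z t by split=> //; rewrite /= in_itv /= t0 (ltW (lt_le_trans tT T1)).
  by move=> /Tmin; rewrite leNgt tT.
(* At the first exit time the path is a limit of points of [V], hence in the closed set [Vc]: the
   length estimate holds up to [T] included. *)
have VcT : Vc (p T).
  apply: contrapT => nVc.
  have nT : \forall t \near T, ~ Vc (p t).
    have oc : nbhs (p T) (~` Vc).
      by apply: open_nbhs_nbhs; split=> //; exact: closed_openC.
    exact: (cont T _ oc).
  have /nbhs_ballP[e e0 he] := nT.
  pose t := Num.max 0 (T - e / 2).
  have tT : 0 <= t < T by rewrite /t le_max lexx /= gt_max T0' ltrBlDr ltrDl divr_gt0.
  apply: (he t _ (VVc _ (before t tT))).
  rewrite -ball_normE /= ger0_norm ?subr_ge0; last by apply: ltW; case/andP: tT.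
  rewrite ltrBlDl -ltrBlDr /t lt_max; apply/orP; right.
    by rewrite ltrD2l ltrN2 ltr_pdivrMr// ltr_pMr// ltr1n.
have [|lt] := lerP (r / 2) `|pmap a (p T) - pmap a y|; last first.
  apply: nVT; have [z zr pz] := VcT; have [c1 c3 c4] := hr z zr.
  rewrite -pz; split=> //; rewrite pz.
  rewrite -(subrK (pmap a y) (pmap a (p T))) -addrA.
  apply: le_lt_trans (ler_normD _ _) _.
  by rewrite [r]splitr; exact: ltrD lt yr.
apply/negP; rewrite -ltNge; apply: lt_le_trans (low T T01 _) _.
  move=> t /andP[t0]; rewrite le_eqVlt => /orP[/eqP->//|tT].
  by apply/VVc/before; rewrite t0.
move: dr; rewrite ltr_pdivlMr ?mulr_gt0// => dr.
rewrite ler_pdivlMr//; apply: le_trans (ltW dr).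
by rewrite (_ : 2 * K * d * 2 = d * (4 * K))//; ring.
Qed.

End Metric.

(** * C^1 maps and continuous splittings *)

Section SmoothMaps.
Variables (R : realType) (n : nat) (M : topologicalType).
Variables (S : smooth_atlas R n M).
Implicit Types (a b c : chart R n M) (x : M) (u v : 'rV[R]_n) (f g h : M -> M).

Definition in_charts a b f := pmap b \o f \o pinv a.

Definition map_jac a b f x : 'M[R]_n := jac (in_charts a b f) (pmap a x).

(** Working form of [C1_map], stated pointwise on [M] for all pairs of charts and with Jacobians as
    functions on [M], so that composition and iteration reduce to the chain rule. *)
Definition smooth1 f := forall x, {for x, continuous f} /\
  forall a b, charts S a -> charts S b -> pdom a x -> pdom b (f x) ->
    has_diff (in_charts a b f) (pmap a x) (fun u => u *m map_jac a b f x) /\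
    {for x, continuous (map_jac a b f)}.

Lemma C1_map_smooth1 f : C1_map S f -> smooth1 f.
Proof.
move=> Cf x.
have cf : {for x, continuous f}.
  have Sa := chart_at_in S x; have ax := chart_at_dom S x; set a := chart_at S x in Sa ax *.
  have [h1 _] := Cf a Sa; have h2 := h1 _ (pmap_cod ax).
  have h3 := @continuous_comp _ _ _ (pmap a) (f \o pinv a) x (pmap_cont ax) h2.
  apply: near_continuous h3.
  by apply: filterS (near_pdom ax) => y ay /=; rewrite pmapK.
split=> // a b Sa Sb ax bfx; have [_ /(_ b Sb) h] := Cf a Sa.
have fz : pdom b (f (pinv a (pmap a x))) by rewrite pmapK.
have dfx : differentiable (in_charts a b f) (pmap a x).
  by case: h => h _; apply: h; split=> //; exact: pmap_cod.
split; first exact: has_diff_jac.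
apply: (@continuous_comp _ _ _ (pmap a) (jac (in_charts a b f))).
  exact: pmap_cont.
apply: jac_continuous h; apply: filterI; first exact: near_pcod (pmap_cod ax).
apply: (near_chart (P := fun y => pdom b (f y)) ax).
by apply: cf; exact: near_pdom.
Qed.

Lemma has_diff_map_comp f g a b c x : smooth1 f -> smooth1 g ->
  charts S a -> charts S b -> charts S c ->
  pdom a x -> pdom b (f x) -> pdom c (g (f x)) ->
  has_diff (in_charts a c (g \o f)) (pmap a x)
    (fun u => u *m (map_jac a b f x *m map_jac b c g (f x))).
Proof.
move=> sf sg Sa Sb Sc ax bx cx.
have [cf /(_ a b Sa Sb ax bx) [df _]] := sf x.
have [cg /(_ b c Sb Sc bx cx) [dg _]] := sg (f x).
have e : in_charts a b f (pmap a x) = pmap b (f x) by rewrite /in_charts /= pmapK.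
rewrite -e in dg; have := has_diff_comp df dg.
rewrite (_ : (fun u => u *m map_jac b c g (f x)) \o (fun u => u *m map_jac a b f x) =
  fun u => u *m (map_jac a b f x *m map_jac b c g (f x))); last first.
  by apply/funext => u /=; rewrite mulmxA.
apply: has_diff_near.
apply: (near_chart (P := fun y => pmap c (g (pinv b (pmap b (f y)))) = pmap c (g (f y))) ax).
have : \forall y \near x, pdom b (f y) by apply: cf; exact: near_pdom.
by apply: filterS => y by_; rewrite pmapK.
Qed.

Lemma map_jacM f g a b c x : smooth1 f -> smooth1 g ->
  charts S a -> charts S b -> charts S c ->
  pdom a x -> pdom b (f x) -> pdom c (g (f x)) ->
  map_jac a c (g \o f) x = map_jac a b f x *m map_jac b c g (f x).
Proof.
move=> sf sg Sa Sb Sc ax bx cx; have h := has_diff_map_comp sf sg Sa Sb Sc ax bx cx.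
have [h1 _] := h; apply: eq_mx_mul => u.
exact: (congr1 (fun k => k u) (has_diff_unique (has_diff_jac h1) h)).
Qed.

Lemma smooth1_comp f g : smooth1 f -> smooth1 g -> smooth1 (g \o f).
Proof.
move=> sf sg x; have [cf df] := sf x; have [cg dg] := sg (f x).
split; first exact: continuous_comp.
move=> a c Sa Sc ax cx; pose b := chart_at S (f x).
have Sb : charts S b by exact: chart_at_in.
have bx : pdom b (f x) by exact: chart_at_dom.
split; first by rewrite (map_jacM sf sg Sa Sb Sc ax bx cx); exact: has_diff_map_comp.
have [_ c1] := df a b Sa Sb ax bx; have [_ c2] := dg b c Sb Sc bx cx.
have c3 := @continuous_comp _ _ _ f (map_jac b c g) x cf c2.
apply: (@near_continuous _ _ (fun y => map_jac a b f y *m map_jac b c g (f y))).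
  have n1 := near_pdom ax.
  have n2 : \forall y \near x, pdom b (f y) by apply: cf; exact: near_pdom.
  have n3 : \forall y \near x, pdom c (g (f y)).
    have cgf : {for x, continuous (g \o f)} by exact: continuous_comp.
    by apply: cgf; exact: near_pdom.
  near=> y; apply/esym/map_jacM => //; by near: y.
exact: cvg_mulmx c1 c3.
Unshelve. all: by end_near. Qed.

Lemma map_jac_id a b x : map_jac a b id x = tjac a b (pmap a x).
Proof. by []. Qed.

Lemma smooth1_id : smooth1 id.
Proof.
move=> x; split; first exact: cvg_id.
move=> a b Sa Sb ax bx; split; first exact: (has_diff_transition Sa Sb ax bx).
apply: (@continuous_comp _ _ _ (pmap a) (tjac a b)); first exact: pmap_cont.
have bz : pdom b (pinv a (pmap a x)) by rewrite pmapK.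
exact: (tjac_continuous Sa Sb (pmap_cod ax) bz).
Qed.

Lemma smooth1_iter k f : smooth1 f -> smooth1 (iter k f).
Proof.
move=> sf; elim: k => [|k IH]; first exact: smooth1_id.
exact: (smooth1_comp IH sf).
Qed.

Definition inverse_pair f h := [/\ smooth1 f, smooth1 h, cancel f h & cancel h f].

Lemma inverse_pair_iter k f h :
  inverse_pair f h -> inverse_pair (iter k f) (iter k h).
Proof.
move=> [sf sh fh hf]; split; [exact: smooth1_iter|exact: smooth1_iter|..].
- by elim: k => [//|k IH] x; rewrite [iter k.+1 h _]iterSr iterS fh IH.
- by elim: k => [//|k IH] x; rewrite [iter k.+1 f _]iterSr iterS hf IH.
Qed.

Lemma map_jac_unit f h a b x : inverse_pair f h -> charts S a -> charts S b ->
  pdom a x -> pdom b (f x) -> map_jac a b f x \in unitmx.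
Proof.
move=> [sf sh fh hf] Sa Sb ax bx.
have hfid : h \o f = id by apply/funext => y /=; rewrite fh.
have ax' : pdom a (h (f x)) by rewrite fh.
have e := map_jacM sf sh Sa Sb Sa ax bx ax'; rewrite hfid in e.
have e1 : 1%:M = map_jac a b f x *m map_jac b a h (f x) := etrans (esym (tjac_id Sa ax)) e.
exact: (proj1 (mulmx1_unit (esym e1))).
Qed.

Lemma mulmx_square (m : nat) (u : 'rV[R]_m) (T A B C D : 'M[R]_m) :
  C = T *m A -> C = B *m D -> u *m T *m A = u *m B *m D.
Proof. by move=> e1 e2; rewrite -!mulmxA -e1 e2. Qed.

Lemma tangent_map_chart f a b x u : smooth1 f -> charts S a -> charts S b ->
  pdom a x -> pdom b (f x) ->
  tangent_map S f x (u *m tangent_mx S a x) =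
  u *m map_jac a b f x *m tangent_mx S b (f x).
Proof.
move=> sf Sa Sb ax bx.
pose a' := chart_at S x; pose b' := chart_at S (f x).
have Sa' : charts S a' by exact: chart_at_in.
have Sb' : charts S b' by exact: chart_at_in.
have ax' : pdom a' x by exact: chart_at_dom.
have bx' : pdom b' (f x) by exact: chart_at_dom.
have [_ /(_ a' b' Sa' Sb' ax' bx')[[_ d] _]] := sf x.
have -> : tangent_map S f x = fun u => u *m map_jac a' b' f x by exact: d.
have h1 : map_jac a b' f x = tangent_mx S a x *m map_jac a' b' f x.
  exact: (map_jacM smooth1_id sf Sa Sa' Sb' ax ax' bx').
have h2 : map_jac a b' f x = map_jac a b f x *m tangent_mx S b (f x).
  exact: (map_jacM sf smooth1_id Sa Sb Sb' ax bx bx').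
exact: mulmx_square h1 h2.
Qed.

End SmoothMaps.

Section StrictDifferentiability.
Variable R : realType.

Lemma has_diff_affine n (z v : 'rV[R]_n) (t : R) :
  has_diff (fun t : R => z + t *: v) t (fun s => s *: v).
Proof.
have [k1 k2] := has_diff_scaler v 0.
have [||h1 h2] := @eps_diff R _ _ (fun t : R => z + t *: v) t
    ('d (fun s : R => s *: v) 0).
- exact: diff_continuous.
- move=> e e0; rewrite k2; apply: filterE => s.
  have -> : z + s *: v - (z + t *: v) - (s - t) *: v = 0.
    by apply/rowP => i; rewrite !mxE; ring.
  by rewrite normr0 mulr_ge0// ltW.
split; [exact: h1|exact: (etrans h2 k2)].
Qed.

(** The scalar mean value theorem is applied to each coordinate along the segment, with its own
    intermediate point; the sup norm recombines them. *)
Lemma mean_value_mx n m (h : 'rV[R]_n -> 'rV[R]_m) (z v : 'rV[R]_n)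
    (A : 'M[R]_(n, m)) (eta : R) : 0 <= eta ->
  (forall t, 0 <= t <= 1 ->
     has_diff h (z + t *: v) (fun u => u *m jac h (z + t *: v)) /\
     `|jac h (z + t *: v) - A| <= eta) ->
  `|h (z + v) - h z - v *m A| <= n%:R * eta * `|v|.
Proof.
move=> eta0 hz.
apply: mx_norm_le => [|i j]; first by rewrite !mulr_ge0.
rewrite [i]ord1 {i}.
pose q (t : R) := z + t *: v.
have dq (t : R) : has_diff q t (fun s => s *: v) by exact: has_diff_affine.
pose k (t : R) : R := h (q t) 0 j; pose k' (t : R) : R := (v *m jac h (q t)) 0 j.
have dk (t : R) : 0 <= t <= 1 -> is_derive t 1 k (k' t).
  move=> t01; have [dh _] := hz t t01; have [e1 e2] := has_diff_comp (dq t) dh.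
  have dv : derivable (h \o q) t 1 by exact: diff_derivable.
  apply: DeriveDef; first by move/derivable_mxP : dv; apply.
  have -> : 'D_1 k t = ('D_1 (h \o q) t) 0 j by rewrite derive_mx// mxE.
  by rewrite deriveE// e2 /= scale1r.
have [||c c01 e] := @MVT R k k' 0 1 (@ltr01 R).
- by move=> t; rewrite in_itv /= => /andP[t0 t1]; apply: dk; rewrite !ltW.
- apply: continuous_in_subspaceT => t; rewrite inE /= in_itv /= => /dk[d _].
  by apply: differentiable_continuous; apply/derivable1_diffP.
have {}c01 : 0 <= c <= 1 by move: c01; rewrite in_itv /= => /andP[? ?]; rewrite !ltW.
have -> : (h (z + v) - h z - v *m A) 0 j = (v *m (jac h (q c) - A)) 0 j.
  have mxB (X Y : 'rV[R]_m) : (X - Y) 0 j = X 0 j - Y 0 j by rewrite !mxE.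
  rewrite mulmxBr !mxB; congr (_ - _); move: e.
  by rewrite /k /k' /q subr0 mulr1 scale1r scale0r addr0.
apply: le_trans (coord_norm_le _ _ _) _; apply: le_trans (norm_mulmx_le _ _) _.
rewrite [leRHS]mulrAC; apply: ler_wpM2l; first by rewrite mulr_ge0.
by have [_] := hz c c01.
Qed.

(** Continuity of the Jacobian at [z0] makes the first order estimate uniform in the base point [z],
    the form that compactness can spread over [M]. *)
Lemma strict_diff n m (h : 'rV[R]_n -> 'rV[R]_m) (z0 : 'rV[R]_n) (eta : R) :
  (\forall z \near z0, has_diff h z (fun u => u *m jac h z)) ->
  {for z0, continuous (jac h)} -> 0 < eta ->
  exists2 rho : R, 0 < rho & forall z v, `|z - z0| < rho -> `|z + v - z0| < rho ->
    `|h (z + v) - h z - v *m jac h z| <= eta * `|v|.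
Proof.
move=> nd cj eta0.
pose e := eta / (n%:R + 1) / 2; have n0 : 0 < n%:R + 1 :> R by rewrite ltr_wpDl.
have e0 : 0 < e by rewrite !divr_gt0.
have nj : \forall z \near z0, `|jac h z0 - jac h z| < e by have /cvgrPdist_lt := cj; apply.
have /nbhs_ballP[r r0 hr] : \forall z \near z0,
    has_diff h z (fun u => u *m jac h z) /\ `|jac h z0 - jac h z| < e.
  exact: filterI nd nj.
exists r => // z v zr zvr.
have near t : 0 <= t <= 1 -> has_diff h (z + t *: v) (fun u => u *m jac h (z + t *: v)) /\
    `|jac h z0 - jac h (z + t *: v)| < e.
  move=> t01; apply: hr; rewrite -ball_normE /= distrC.
  by rewrite -[in t *: v](addKr z v) [- z + _]addrC; exact: segment_near.
have [_ nz] := near 0 ltac:(by rewrite lexx ler01).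
rewrite scale0r addr0 in nz.
have : `|h (z + v) - h z - v *m jac h z| <= n%:R * (eta / (n%:R + 1)) * `|v|.
  apply: mean_value_mx => [|t t01]; first by rewrite divr_ge0// ltW.
  have [d nt] := near t t01; split; first exact: d.
  rewrite -(subrKA (jac h z0)) [eta / _]splitr.
  apply: le_trans (ler_normD _ _) _; apply: lerD; last exact: ltW nz.
  by rewrite distrC; exact: ltW nt.
move=> /le_trans; apply; apply: ler_wpM2r => //.
by rewrite mulrCA ler_piMr ?(ltW eta0)// ler_pdivrMr// mul1r lerDl.
Qed.

End StrictDifferentiability.

Section Frames.
Variables (R : realType) (n : nat) (M : topologicalType).
Variable (S : smooth_atlas R n M).
Implicit Types (a b c : chart R n M) (x y : M) (u v : 'rV[R]_n).

Lemma frame_matrix (E : M -> {vspace 'rV[R]_n}) p : continuous_distribution S E ->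
  exists (k : nat) (X : M -> 'M[R]_(k, n)),
   [/\ \forall y \near p, {for y, continuous X},
     \forall y \near p, forall c : 'rV_k,
       c *m X y *m tangent_mx S (chart_at S p) y \in E y
   & forall v, v \in E p ->
       exists c : 'rV_k, v = c *m X p *m tangent_mx S (chart_at S p) p].
Proof.
move=> /(_ p)[k [X [cX bX]]]; exists k, (fun y => \matrix_(i, j) X i y 0 j).
set a := chart_at S p in bX *.
have Sa : charts S a by exact: chart_at_in.
have ap : pdom a p by exact: chart_at_dom.
have rX (c : 'rV_k) y : c *m (\matrix_(i, j) X i y 0 j) *m tangent_mx S a y =
    \sum_(i < k) c 0 i *: (X i y *m tangent_mx S a y).
  rewrite (mulmx_sum_row c) mulmx_suml; apply: eq_bigr => i _.
  rewrite -scalemxAl; congr (_ *: (_ *m _)).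
  by apply/rowP => j; rewrite !mxE.
split.
- have : \forall y \near p, forall i, {for y, continuous (X i)} by exact: filter_forall.
  apply: filterS => y cy; apply/cvg_mxP => i j; rewrite mxE.
  under eq_cvg do rewrite mxE.
  exact: (cvg_mxP _ _).1 (cy i) 0 j.
- apply: filterS2 bX (near_pdom ap) => y bX ay c; rewrite rX.
  apply: memv_suml => i _; apply: memvZ.
  apply: (basis_mem bX); rewrite -tangent_of_coordE//.
  by apply: map_f; rewrite mem_enum.
move=> v; have /span_basis <- := nbhs_singleton bX.
pose L : 'Hom('rV[R]_k, 'rV[R]_n) :=
  linfun (mulmxr ((\matrix_(i, j) X i p 0 j) *m tangent_mx S a p)).
have LE (c : 'rV_k) : L c = c *m (\matrix_(i, j) X i p 0 j) *m tangent_mx S a p.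
  by rewrite /L lfunE /= mulmxA.
suff : (<<[seq tangent_of_coord S a p (X i p) | i <- enum 'I_k]>> <= limg L)%VS.
  by move=> /subvP h /h /memv_imgP[c _ ->]; exists c; exact: LE.
apply/span_subvP => _ /mapP[i _ ->]; rewrite tangent_of_coordE//.
apply/memv_imgP; exists (delta_mx 0 i); first exact: memvf.
rewrite LE rX (bigD1 i)//= big1 ?addr0 => [|j ji]; rewrite mxE !eqxx/=.
  by rewrite scale1r.
by rewrite (negPf ji) scale0r.
Qed.

(** Once the combination [Z y] of the three frames is invertible, the three terms of
    [invmx (Z y) *m Z y] have values in the three subspaces and add up to the identity. That they
    are the projections follows later, from uniqueness of the decomposition. *)
Lemma splitting_mx_exists (Es Ec Eu : M -> {vspace 'rV[R]_n}) p :
  (forall x, directv (Es x + Ec x + Eu x) /\ (Es x + Ec x + Eu x)%VS = fullv) ->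
  continuous_distribution S Es -> continuous_distribution S Ec ->
  continuous_distribution S Eu ->
  exists Ps Pc Pu : M -> 'M[R]_n, \forall y \near p,
    [/\ {for y, continuous Ps}, {for y, continuous Pc}, {for y, continuous Pu},
     Ps y + Pc y + Pu y = 1%:M
   & forall u, [/\ u *m Ps y *m tangent_mx S (chart_at S p) y \in Es y,
     u *m Pc y *m tangent_mx S (chart_at S p) y \in Ec y
   & u *m Pu y *m tangent_mx S (chart_at S p) y \in Eu y]].
Proof.
move=> dE /(frame_matrix p)[ks [Xs [cs ms es]]] /(frame_matrix p)[kc [Xc [cc mc ec]]]
  /(frame_matrix p)[ku [Xu [cu mu eu]]].
set a := chart_at S p in ms es mc ec mu eu *.
have Sa : charts S a by exact: chart_at_in.
have ap : pdom a p by exact: chart_at_dom.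
(* A left inverse [W] of the frame at [p] remains one near [p] after
   multiplication by the inverse of a matrix close to the identity. *)
have [Ws [Wc [Wu W1]]] : exists Ws Wc Wu,
    Ws *m Xs p + Wc *m Xc p + Wu *m Xu p = 1%:M.
  pose X := col_mx (Xs p) (col_mx (Xc p) (Xu p)).
  have /row_fullP[W WX] : row_full X.
    rewrite -sub1mx; apply/row_subP => i; set e := row i _.
    have : e *m tangent_mx S a p \in fullv by exact: memvf.
    have [_ <-] := dE p.
    move=> /memv_addP[_ /memv_addP[vs /es[c1 ->]] [vc /ec[c2 ->]] ->] [vu /eu[c3 ->]].
    rewrite -!mulmxDl => /(congr1 (mulmxr (invmx (tangent_mx S a p)))) /=.
    rewrite !(mulmxK (tangent_mx_unit Sa ap)) => ->.
    by apply/submxP; exists (row_mx c1 (row_mx c2 c3)); rewrite !mul_row_col addrA.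
  exists (lsubmx W), (lsubmx (rsubmx W)), (rsubmx (rsubmx W)).
  by rewrite -WX -[W in RHS]hsubmxK -[rsubmx W in RHS]hsubmxK !mul_row_col addrA.
pose Z y := Ws *m Xs y + Wc *m Xc y + Wu *m Xu y.
have cZ y : {for y, continuous Xs} -> {for y, continuous Xc} ->
    {for y, continuous Xu} -> {for y, continuous Z}.
  move=> c1 c2 c3; apply: cvgD; [apply: cvgD|].
  - exact: cvg_mulmx (cvg_cst _) c1.
  - exact: cvg_mulmx (cvg_cst _) c2.
  - exact: cvg_mulmx (cvg_cst _) c3.
have nZ : \forall y \near p, Z y \in unitmx.
  have h : \det (Z y) @[y --> p] --> (1 : R).
    rewrite -(det1 R n) -W1; apply: cvg_det.
    exact: cZ p (nbhs_singleton cs) (nbhs_singleton cc) (nbhs_singleton cu).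
  have : \forall y \near p, `|1 - \det (Z y)| < 1 by have /cvgrPdist_lt := h; apply.
  apply: filterS => y; rewrite unitmxE unitfE; apply: contraTneq => ->.
  by rewrite subr0 normr1 ltxx.
exists (fun y => invmx (Z y) *m Ws *m Xs y), (fun y => invmx (Z y) *m Wc *m Xc y),
  (fun y => invmx (Z y) *m Wu *m Xu y).
near=> y.
have Zy : Z y \in unitmx by near: y.
have c1 : {for y, continuous Xs} by near: y.
have c2 : {for y, continuous Xc} by near: y.
have c3 : {for y, continuous Xu} by near: y.
have ci : {for y, continuous (fun y => invmx (Z y))}.
  by apply: cvg_invmx => //; exact: cZ.
split.
- by apply: cvg_mulmx c1; apply: cvg_mulmx ci (cvg_cst _).
- by apply: cvg_mulmx c2; apply: cvg_mulmx ci (cvg_cst _).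
- by apply: cvg_mulmx c3; apply: cvg_mulmx ci (cvg_cst _).
- by rewrite -!mulmxA -!mulmxDr mulVmx.
move=> u; rewrite !mulmxA; split.
- by move: (u *m invmx (Z y) *m Ws); near: y.
- by move: (u *m invmx (Z y) *m Wc); near: y.
- by move: (u *m invmx (Z y) *m Wu); near: y.
Unshelve. all: by end_near. Qed.

End Frames.

(** * Compactness and hyperbolic estimates *)

(* In the uniform estimates below, [r] serves both as a radius and as the inverse
   of a multiplicative constant, so that they weaken when [r] decreases. *)
Section Uniformization.
Variables (R : realType) (M : topologicalType).
Hypothesis cM : compact [set: M].

(** A finite subcover, from the characterization of compactness by near coverings, applied to the
    filter of all large enough lists. *)
Lemma compact_centers (N : M -> set M) : (forall p, nbhs p (N p)) ->
  exists s : seq M, forall x, exists2 p, p \in s & N p x.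
Proof.
move=> nN.
pose F : set_system (seq M) :=
  [set A : set (seq M) | exists s0 : seq M, forall s : seq M, {subset s0 <= s} -> A s].
have FF : Filter F.
  split; first by exists [::].
    move=> A B [s1 h1] [s2 h2]; exists (s1 ++ s2) => s hs; split.
      by apply: h1 => p ps; apply: hs; rewrite mem_cat ps.
    by apply: h2 => p ps; apply: hs; rewrite mem_cat ps orbT.
  by move=> A B AB [s h]; exists s => s' /h /AB.
have := cM; rewrite compact_near_coveringP.
move=> /(_ (seq M) F (fun s x => exists2 p, p \in s & N p x) FF).
case=> [x _|s h].
  exists (N x, [set s : seq M | x \in s]); first split=> //=.
    by exists [:: x] => s; apply; rewrite mem_head.
  by move=> [y s] /= [Ny xs]; exists x.
by exists s => x; exact: (h s (fun p => id) x I).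
Qed.

Lemma compact_unif (G : M -> R -> Prop) :
  (forall x r r', 0 < r' <= r -> G x r -> G x r') ->
  (forall x0 : M, exists2 r, 0 < r & \forall x \near x0, G x r) ->
  exists2 r, 0 < r & forall x, G x r.
Proof.
move=> anti loc; have := cM; rewrite compact_near_coveringP.
move=> /(_ R (at_right 0) (fun r x => G x r) _).
case=> [x _|e e0 h].
  have [r r0 nG] := loc x; exists ([set y | G y r], [set e | 0 < e <= r]); first split=> //=.
    by near=> e; apply/andP; split; near: e; [exact: nbhs_right_gt|exact: nbhs_right_le].
  by move=> [y e] /= [Gy er]; exact: anti Gy.
have e2 : e / 2 < e by rewrite ltr_pdivrMr// ltr_pMr// ltr1n.
exists (e / 2); first by rewrite divr_gt0.
move=> x; apply: (h (e / 2)) => //=; last by rewrite divr_gt0.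
by rewrite sub0r normrN gtr0_norm// divr_gt0.
Unshelve. all: by end_near. Qed.

Lemma seq_unif (T : eqType) (s : seq T) (G : T -> R -> Prop) :
  (forall p r r', 0 < r' <= r -> G p r -> G p r') ->
  (forall p, exists2 r, 0 < r & G p r) ->
  exists2 r, 0 < r & forall p, p \in s -> G p r.
Proof.
move=> anti h; elim: s => [|p s [r1 r10 IH]]; first by exists 1.
have [r2 r20 hr2] := h p; exists (Num.min r1 r2); first by rewrite lt_min r10.
move=> q; rewrite inE => /predU1P[->|qs].
  by apply: (anti _ r2) => //; rewrite lt_min r10 r20 ge_min lexx orbT.
by apply: (anti _ r1); [rewrite lt_min r10 r20 ge_min lexx|exact: IH].
Qed.

Lemma compact_seq_unif (T : eqType) (s : seq T) (G : T -> M -> R -> Prop) :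
  (forall p x r r', 0 < r' <= r -> G p x r -> G p x r') ->
  (forall p (x0 : M), exists2 r, 0 < r & \forall x \near x0, G p x r) ->
  exists2 r, 0 < r & forall p, p \in s -> forall x, G p x r.
Proof.
move=> anti loc; apply: (@seq_unif _ s (fun p r => forall x, G p x r)).
  by move=> p r r' rr h x; apply: anti rr (h x).
by move=> p; apply: compact_unif; [exact: anti|exact: loc].
Qed.

(** Compact Hausdorff spaces are regular. It is used twice, to nest [C p] inside the interior of
    [C' p], and [C' p] inside the interior of the set where the frame centred at [p] is good. *)
Lemma closed_nbhs (p : M) (N : set M) : hausdorff_space M -> nbhs p N ->
  exists C : set M, [/\ closed C, nbhs p C & forall x, C x -> nbhs x N].
Proof.
move=> haus pN.
have h : {for p, regular_space M} by exact: compact_regular haus cM filterT.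
have [B pB BN] := h _ (nbhs_interior pN).
exists (closure B); split; [exact: closed_closure| |exact: BN].
by apply: filterS pB; exact: subset_closure.
Qed.

End Uniformization.

Section Splittings.
Variables (R : realType) (n : nat) (M : topologicalType).
Variables (S : smooth_atlas R n M) (g : riemannian_metric S).
Variables (Es Ec Eu : M -> {vspace 'rV[R]_n}).
Hypothesis dE : forall x,
  directv (Es x + Ec x + Eu x) /\ (Es x + Ec x + Eu x)%VS = fullv.
Implicit Types (x y : M) (u v : 'rV[R]_n) (P : (M -> 'M[R]_n) * (M -> 'M[R]_n) * (M -> 'M[R]_n)).

Lemma directv3_eq0 x (e1 e2 e3 : 'rV[R]_n) : e1 \in Es x -> e2 \in Ec x ->
  e3 \in Eu x -> e1 + e2 + e3 = 0 -> [/\ e1 = 0, e2 = 0 & e3 = 0].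
Proof.
move=> h1 h2 h3 e; have [d _] := dE x; move: d.
rewrite directv_addE /= => /and3P[d12 _ d123].
have e12 : e1 + e2 \in (Es x + Ec x)%VS by exact: memv_add.
have e3E : e3 = - (e1 + e2) by apply/eqP; rewrite -addr_eq0 addrC e.
have e30 : e3 = 0.
  apply/eqP; rewrite -memv0 -(eqP d123) memv_cap h3 andbT e3E.
  by rewrite rpredN.
move: e; rewrite e30 addr0 => e.
have e1E : e1 = - e2 by apply/eqP; rewrite -addr_eq0 e.
have e10 : e1 = 0.
  apply/eqP; rewrite -memv0 -(directv_addP d12) memv_cap h1 e1E.
  by rewrite rpredN.
by split=> //; move: e; rewrite e10 add0r.
Qed.

(** All that the frame centred at [p] has to provide at [x], with one constant that may be
    increased. [Ps], [Pc], [Pu] are not assumed idempotent: values in the subspaces and sum 1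
    determine them, see [adapted_splitting]. *)
Definition adapted (K : R) p (Ps Pc Pu : M -> 'M[R]_n) x :=
  [/\ pdom (chart_at S p) x,
      forall u, `|u| <= K * tnorm g x (u *m tangent_mx S (chart_at S p) x) /\
                tnorm g x (u *m tangent_mx S (chart_at S p) x) <= K * `|u|,
      [/\ {for x, continuous Ps}, {for x, continuous Pc}, {for x, continuous Pu}
        & Ps x + Pc x + Pu x = 1%:M],
      forall u, [/\ u *m Ps x *m tangent_mx S (chart_at S p) x \in Es x,
                    u *m Pc x *m tangent_mx S (chart_at S p) x \in Ec x
                  & u *m Pu x *m tangent_mx S (chart_at S p) x \in Eu x]
    & forall u, [/\ `|u *m Ps x| <= K * `|u|, `|u *m Pc x| <= K * `|u|
                  & `|u *m Pu x| <= K * `|u|]].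

Lemma adapted_le K K' p Ps Pc Pu x : K <= K' ->
  adapted K p Ps Pc Pu x -> adapted K' p Ps Pc Pu x.
Proof.
move=> KK [ax hK cP rP bP]; split=> // u.
  have [h1 h2] := hK u; split; [apply: le_trans h1 _|apply: le_trans h2 _].
    by rewrite ler_wpM2r// tnorm_ge0.
  by rewrite ler_wpM2r.
have [h1 h2 h3] := bP u.
by split; [apply: le_trans h1 _|apply: le_trans h2 _|apply: le_trans h3 _];
  rewrite ler_wpM2r.
Qed.

Lemma near_norm_mx (P : M -> 'M[R]_n) p : {for p, continuous P} ->
  \forall x \near p, forall u, `|u *m P x| <= n%:R * (`|P p| + 1) * `|u|.
Proof.
move=> cP; have : \forall x \near p, `|P p - P x| < 1 by have /cvgrPdist_lt := cP; apply.
apply: filterS => x h u; apply: le_trans (norm_mulmx_le _ _) _.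
rewrite -mulrA [`|u| * _]mulrC mulrA ler_wpM2r// ler_wpM2l//.
rewrite -[P x](subrKC (P p)); apply: le_trans (ler_normD _ _) _.
by rewrite lerD2l distrC ltW.
Qed.

Lemma adapted_exists p :
  continuous_distribution S Es -> continuous_distribution S Ec ->
  continuous_distribution S Eu ->
  exists K Ps Pc Pu, \forall x \near p, adapted K p Ps Pc Pu x.
Proof.
move=> cs cc cu.
have [Ps [Pc [Pu nP]]] := splitting_mx_exists p dE cs cc cu.
have Sa : charts S (chart_at S p) by exact: chart_at_in.
have ap : pdom (chart_at S p) p by exact: chart_at_dom.
have [K0 K01 nK] := norm_bounds g Sa ap.
have [c1 c2 c3 _ _] := nbhs_singleton nP.
have n1 := near_norm_mx c1; have n2 := near_norm_mx c2; have n3 := near_norm_mx c3.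
pose K1 := n%:R * (`|Ps p| + 1); pose K2 := n%:R * (`|Pc p| + 1).
pose K3 := n%:R * (`|Pu p| + 1); pose K := K0 + K1 + K2 + K3.
have K10 : 0 <= K1 by rewrite mulr_ge0// addr_ge0.
have K20 : 0 <= K2 by rewrite mulr_ge0// addr_ge0.
have K30 : 0 <= K3 by rewrite mulr_ge0// addr_ge0.
have k0 : K0 <= K by rewrite /K; lra.
have k1 : K1 <= K by rewrite /K; lra.
have k2 : K2 <= K by rewrite /K; lra.
have k3 : K3 <= K by rewrite /K; lra.
exists K, Ps, Pc, Pu; near=> x.
have [d1 d2 d3 d4 rP] : [/\ {for x, continuous Ps}, {for x, continuous Pc},
  {for x, continuous Pu}, Ps x + Pc x + Pu x = 1%:M
  & forall u, [/\ u *m Ps x *m tangent_mx S (chart_at S p) x \in Es x,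
     u *m Pc x *m tangent_mx S (chart_at S p) x \in Ec x
   & u *m Pu x *m tangent_mx S (chart_at S p) x \in Eu x]] by near: x.
have [ax hK] : pdom (chart_at S p) x /\ forall u,
    `|u| <= K0 * tnorm g x (u *m tangent_mx S (chart_at S p) x) /\
    tnorm g x (u *m tangent_mx S (chart_at S p) x) <= K0 * `|u| by near: x.
have m1 : forall u, `|u *m Ps x| <= K1 * `|u| by near: x.
have m2 : forall u, `|u *m Pc x| <= K2 * `|u| by near: x.
have m3 : forall u, `|u *m Pu x| <= K3 * `|u| by near: x.
split=> // u.
  have [h1 h2] := hK u; split.
    by apply: le_trans h1 _; rewrite ler_wpM2r// tnorm_ge0.
  by apply: le_trans h2 _; rewrite ler_wpM2r.
by split; [apply: le_trans (m1 u) _|apply: le_trans (m2 u) _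
  |apply: le_trans (m3 u) _]; rewrite ler_wpM2r.
Unshelve. all: by end_near. Qed.

Section Adapted.
Variables (K : R) (p : M) (Ps Pc Pu : M -> 'M[R]_n) (x : M).
Hypothesis ad : adapted K p Ps Pc Pu x.
Let T := tangent_mx S (chart_at S p) x.

Let uT : T \in unitmx.
Proof. by case: ad => ax _ _ _ _; apply: tangent_mx_unit; [exact: chart_at_in|]. Qed.

Let T0 v : v *m T = 0 -> v = 0.
Proof. by move=> h; rewrite -(mulmxK uT v) h mul0mx. Qed.

Let decomp v : v = v *m Ps x + v *m Pc x + v *m Pu x.
Proof. by case: ad => _ _ [_ _ _ e] _ _; rewrite -!mulmxDr e mulmx1. Qed.

Lemma adapted_s v : v *m T \in Es x ->
  [/\ v *m Ps x = v, v *m Pc x = 0 & v *m Pu x = 0].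
Proof.
move=> vE; have [_ _ _ /(_ v)[h1 h2 h3] _] := ad.
have [] := @directv3_eq0 x (v *m Ps x *m T - v *m T) _ _ (rpredB h1 vE) h2 h3.
  rewrite -mulmxBl -!mulmxDl (_ : _ + _ = 0) ?mul0mx//.
  by rewrite {2}(decomp v) opprD opprD !addrA; apply/rowP => i; rewrite !mxE; ring.
rewrite -mulmxBl => /T0/eqP; rewrite subr_eq0 => /eqP e1 /T0 e2 /T0 e3.
by split.
Qed.

Lemma adapted_c v : v *m T \in Ec x ->
  [/\ v *m Ps x = 0, v *m Pc x = v & v *m Pu x = 0].
Proof.
move=> vE; have [_ _ _ /(_ v)[h1 h2 h3] _] := ad.
have [] := @directv3_eq0 x _ (v *m Pc x *m T - v *m T) _ h1 (rpredB h2 vE) h3.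
  rewrite -mulmxBl -!mulmxDl (_ : _ + _ = 0) ?mul0mx//.
  by rewrite {3}(decomp v) opprD opprD !addrA; apply/rowP => i; rewrite !mxE; ring.
rewrite -mulmxBl => /T0 e1 /T0/eqP; rewrite subr_eq0 => /eqP e2 /T0 e3.
by split.
Qed.

Lemma adapted_u v : v *m T \in Eu x ->
  [/\ v *m Ps x = 0, v *m Pc x = 0 & v *m Pu x = v].
Proof.
move=> vE; have [_ _ _ /(_ v)[h1 h2 h3] _] := ad.
have [] := @directv3_eq0 x _ _ (v *m Pu x *m T - v *m T) h1 h2 (rpredB h3 vE).
  rewrite -mulmxBl -!mulmxDl (_ : _ + _ = 0) ?mul0mx//.
  by rewrite {4}(decomp v) opprD opprD !addrA; apply/rowP => i; rewrite !mxE; ring.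
rewrite -mulmxBl => /T0 e1 /T0 e2 /T0/eqP; rewrite subr_eq0 => /eqP e3.
by split.
Qed.

Lemma adapted_splitting : splitting_mx (Ps x) (Pc x) (Pu x).
Proof.
have [_ _ [_ _ _ e] rP _] := ad.
have e0 (A B : 'M[R]_n) : (forall u, u *m A *m B = 0) -> A *m B = 0.
  by move=> h; apply: eq_mx_mul => u; rewrite mulmx0 mulmxA.
split; [exact: e|split|split|split]; apply: e0 => u; have [h1 h2 h3] := rP u.
- by case: (adapted_s h1).
- by case: (adapted_s h1).
- by case: (adapted_c h2).
- by case: (adapted_c h2).
- by case: (adapted_u h3).
- by case: (adapted_u h3).
Qed.

End Adapted.

Lemma tangent_mapE f x u : smooth1 S f ->
  tangent_map S f x u = u *m map_jac (chart_at S x) (chart_at S (f x)) f x.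
Proof.
move=> sf; have [_ h] := sf x.
have [[_ d] _] := h _ _ (chart_at_in S x) (chart_at_in S (f x)) (chart_at_dom S x)
  (chart_at_dom S (f x)).
exact: (congr1 (fun k => k u) d).
Qed.

Lemma tangent_map_comp f h x u : smooth1 S f -> smooth1 S h ->
  tangent_map S (h \o f) x u = tangent_map S h (f x) (tangent_map S f x u).
Proof.
move=> sf sh; have sc := smooth1_comp sf sh.
rewrite (tangent_mapE _ _ sf) (tangent_mapE _ _ sh) (tangent_mapE _ _ sc) -mulmxA.
by rewrite -(map_jacM sf sh (chart_at_in S x) (chart_at_in S (f x))
  (chart_at_in S (h (f x))) (chart_at_dom S x) (chart_at_dom S (f x))
  (chart_at_dom S (h (f x)))).
Qed.

(** Expansion on [Eu] is written as a contraction by [lam] of the inverse, so one factor serves both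
    directions and multiplies under composition. On [Ec] only invariance is kept. *)
Definition hyp_step (lam : R) (F : M -> M) := forall x v,
  [/\ v \in Es x -> tangent_map S F x v \in Es (F x) /\
        tnorm g (F x) (tangent_map S F x v) <= lam * tnorm g x v,
      v \in Ec x -> tangent_map S F x v \in Ec (F x)
    & v \in Eu x -> tangent_map S F x v \in Eu (F x) /\
        tnorm g x v <= lam * tnorm g (F x) (tangent_map S F x v)].

Lemma hyp_step_comp lam mu F G : 0 <= lam -> 0 <= mu -> smooth1 S F -> smooth1 S G ->
  hyp_step lam F -> hyp_step mu G -> hyp_step (mu * lam) (G \o F).
Proof.
move=> l0 m0 sF sG hF hG x v; rewrite (tangent_map_comp _ _ sF sG).
have [s1 c1 u1] := hF x v.
have [s2 c2 u2] := hG (F x) (tangent_map S F x v).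
split=> [/s1[/s2[h1 h2] h3]|/c1/c2//|/u1[/u2[h1 h2] h3]]; split=> //.
  by apply: le_trans h2 _; rewrite -mulrA ler_wpM2l.
by apply: le_trans h3 _; rewrite [mu * _]mulrC -mulrA ler_wpM2l.
Qed.

Lemma hyp_step_iter lam F k : 0 <= lam -> smooth1 S F -> hyp_step lam F ->
  hyp_step (lam ^+ k) (iter k F).
Proof.
move=> l0 sF hF; elim: k => [|k IH].
  have si := smooth1_id S; move=> x v.
  have -> : tangent_map S (iter 0 F) x v = v.
    rewrite (tangent_mapE _ _ si) map_jac_id.
    by rewrite (tjac_id (chart_at_in S x) (chart_at_dom S x)) mulmx1.
  by rewrite expr0 mul1r; split.
rewrite exprS; apply: hyp_step_comp => //; first by rewrite exprn_ge0.
exact: smooth1_iter.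
Qed.

Lemma tnorm_eq0 x v : tnorm g x v = 0 -> v = 0.
Proof.
move=> h; apply/eqP; apply: contraT => /(gram_pos g x) h1.
by move: h1; rewrite -sqrtr_gt0 -/(tnorm g x v) h ltxx.
Qed.

Lemma hyp_step_unit lam F : smooth1 S F ->
  (forall x v, tnorm g x v = 1 ->
    [/\ v \in Es x -> tangent_map S F x v \in Es (F x) /\
          tnorm g (F x) (tangent_map S F x v) <= lam,
      v \in Ec x -> tangent_map S F x v \in Ec (F x)
    & v \in Eu x -> tangent_map S F x v \in Eu (F x) /\
        1 <= lam * tnorm g (F x) (tangent_map S F x v)]) -> hyp_step lam F.
Proof.
move=> sF h x v; have [v0|v0] := eqVneq (tnorm g x v) 0.
  have -> := tnorm_eq0 v0.
  have -> : tangent_map S F x 0 = 0 by rewrite (tangent_mapE _ _ sF) mul0mx.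
  have t0 y : tnorm g y 0 = 0.
    by rewrite -(scale0r (0 : 'rV[R]_n)) tnormZ normr0 mul0r.
  by rewrite !t0 mulr0 !mem0v; split.
set c := tnorm g x v in v0; pose w := c^-1 *: v.
have c0 : 0 < c by rewrite lt_neqAle eq_sym v0 tnorm_ge0.
have w1 : tnorm g x w = 1 by rewrite /w tnormZ normfV (gtr0_norm c0) mulVf.
have vw : v = c *: w by rewrite /w scalerA mulfV// scale1r.
have tw : tangent_map S F x v = c *: tangent_map S F x w.
  by rewrite !(tangent_mapE _ _ sF) vw -scalemxAl.
have inE (E : {vspace 'rV[R]_n}) : v \in E -> w \in E by exact: memvZ.
have [s1 c1 u1] := h x w w1.
rewrite tw tnormZ (gtr0_norm c0); split.
- move=> /inE/s1[h1 h2]; split; first exact: memvZ.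
  by rewrite mulrC ler_wpM2r// ltW.
- by move=> /inE/c1 h1; exact: memvZ.
- move=> /inE/u1[h1 h2]; split; first exact: memvZ.
  by rewrite mulrCA ler_peMr// ltW.
Qed.

Section Step.
Variables (K lam : R) (p q : M) (Ps Pc Pu Qs Qc Qu : M -> 'M[R]_n) (F H : M -> M) (x : M).
Hypotheses (K0 : 0 <= K) (lam0 : 0 <= lam).
Hypothesis ax : adapted K p Ps Pc Pu x.
Hypothesis aFx : adapted K q Qs Qc Qu (F x).
Hypothesis iF : inverse_pair S F H.
Hypothesis hF : hyp_step lam F.
Let a := chart_at S p.
Let b := chart_at S q.
Let A := map_jac a b F x.
Let T := tangent_mx S a x.
Let T' := tangent_mx S b (F x).

Let tm u : tangent_map S F x (u *m T) = u *m A *m T'.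
Proof.
case: iF => sF _ _ _; apply: tangent_map_chart => //; try exact: chart_at_in.
- by case: ax.
- by case: aFx.
Qed.

Lemma step_unit : A \in unitmx.
Proof.
apply: (map_jac_unit iF); try exact: chart_at_in.
- by case: ax.
- by case: aFx.
Qed.

Let decomp u : u = u *m Ps x + u *m Pc x + u *m Pu x.
Proof. by case: ax => _ _ [_ _ _ e] _ _; rewrite -!mulmxDr e mulmx1. Qed.

(** The differential preserves each of the three subspaces, so splitting a vector at [x] and then
    mapping it gives the splitting of its image at [F x]. *)
Lemma step_commute :
  [/\ A *m Qs (F x) = Ps x *m A, A *m Qc (F x) = Pc x *m A
    & A *m Qu (F x) = Pu x *m A].
Proof.
have [_ _ _ rP _] := ax.
have ms u : u *m Ps x *m A *m T' \in Es (F x).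
  by rewrite -tm; have [h _ _] := rP u; case: (hF x (u *m Ps x *m T)) => /(_ h)[].
have mc u : u *m Pc x *m A *m T' \in Ec (F x).
  by rewrite -tm; have [_ h _] := rP u; case: (hF x (u *m Pc x *m T)) => _ /(_ h).
have mu u : u *m Pu x *m A *m T' \in Eu (F x).
  by rewrite -tm; have [_ _ h] := rP u; case: (hF x (u *m Pu x *m T)) => _ _ /(_ h)[].
split; apply: eq_mx_mul => u; rewrite !mulmxA {1}(decomp u) !mulmxDl;
  have [s1 s2 s3] := adapted_s aFx (ms u);
  have [c1 c2 c3] := adapted_c aFx (mc u);
  have [u1 u2 u3] := adapted_u aFx (mu u).
- by rewrite s1 c1 u1 !addr0.
- by rewrite s2 c2 u2 add0r addr0.
- by rewrite s3 c3 u3 !add0r.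
Qed.

(** One factor [K] each for the norm comparison at [F x], the norm comparison at [x] and the
    projection at [x]. *)
Lemma step_s u : `|u *m A *m Qs (F x)| <= K ^+ 3 * lam * `|u|.
Proof.
have [e _ _] := step_commute; rewrite -mulmxA e mulmxA.
have [_ nT' _ _ _] := aFx; have [_ nT _ rP bP] := ax.
have [h1 _] := nT' (u *m Ps x *m A); apply: le_trans h1 _.
rewrite -/T' -tm; have [h2 _ _] := rP u.
have [/(_ h2)[_ h3] _ _] := hF x (u *m Ps x *m T).
have [_ h4] := nT (u *m Ps x); have [h5 _ _] := bP u.
rewrite !exprS expr0 mulr1 -!mulrA ler_wpM2l//.
apply: le_trans h3 _; rewrite 2!mulrA [K * K * lam]mulrC -!mulrA ler_wpM2l//.
by apply: le_trans h4 _; rewrite ler_wpM2l.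
Qed.

(** [w] is an unstable vector whose image is the unstable part of [u], so expansion read backward
    bounds it. *)
Lemma step_u u : `|u *m invmx A *m Pu x| <= K ^+ 3 * lam * `|u|.
Proof.
have [_ _ e] := step_commute.
have [_ nT' _ _ bQ] := aFx; have [_ nT _ rP bP] := ax.
set w := u *m invmx A *m Pu x.
have wA : w *m A = u *m Qu (F x).
  by rewrite /w -mulmxA -e mulmxA -[u *m _ *m A]mulmxA mulVmx ?step_unit// mulmx1.
have [_ _ h2] := rP (u *m invmx A).
have h3 : tnorm g x (w *m T) <= lam * tnorm g (F x) (u *m Qu (F x) *m T').
  by rewrite -wA -tm; have [_ _ hu] := hF x (w *m T); exact: (hu h2).2.
have [h1 _] := nT w; apply: le_trans h1 _.
have [_ h4] := nT' (u *m Qu (F x)); have [_ _ h5] := bQ u.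
rewrite !exprS expr0 mulr1 -!mulrA ler_wpM2l//.
apply: le_trans h3 _; rewrite 2!mulrA [K * K * lam]mulrC -!mulrA ler_wpM2l//.
by apply: le_trans h4 _; rewrite ler_wpM2l.
Qed.

(** With projections taken at [F x] itself, this mixed term and that of [step_cu] vanish;
    [step_constants] moves the base point to a nearby [y] and gets terms of order [dl]. *)
Lemma step_uu : Qu (F x) *m invmx A *m (1%:M - Pu x) = 0.
Proof.
have [_ _ e] := step_commute; have [_ _ id] := splitting_mx_idem (adapted_splitting ax).
have -> : Qu (F x) *m invmx A = invmx A *m Pu x.
  by rewrite -[LHS]mul1mx -(mulVmx step_unit) -!mulmxA [A *m (_ *m _)]mulmxA e
    -!mulmxA mulmxV ?step_unit// mulmx1.
by rewrite -mulmxA mulmxBr id mulmx1 subrr mulmx0.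
Qed.

Lemma step_cu : Qc (F x) *m invmx A *m Pu x = 0.
Proof.
have [_ e _] := step_commute; have [_ _ [_ cu] _] := adapted_splitting ax.
have -> : Qc (F x) *m invmx A = invmx A *m Pc x.
  by rewrite -[LHS]mul1mx -(mulVmx step_unit) -!mulmxA [A *m (_ *m _)]mulmxA e
    -!mulmxA mulmxV ?step_unit// mulmx1.
by rewrite -mulmxA cu mulmx0.
Qed.

End Step.

End Splittings.

(** * Uniform estimates on a compact manifold *)

Section LocalGeometry.
Variables (R : realType) (n : nat) (M : topologicalType).
Variables (S : smooth_atlas R n M) (g : riemannian_metric S).
Hypothesis haus : hausdorff_space M.
Implicit Types (a b c : chart R n M) (x y z : M) (u v : 'rV[R]_n).

Lemma near_coord a x0 (r : R) : pdom a x0 -> 0 < r ->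
  \forall x \near x0, pdom a x /\ `|pmap a x - pmap a x0| < r.
Proof.
move=> ax r0; apply: filterI; first exact: near_pdom.
have := pmap_cont ax => /cvgrPdist_lt /(_ r r0).
by apply: filterS => y; rewrite distrC.
Qed.

Lemma near_rdist x0 (N : set M) : nbhs x0 N -> exists2 r : R, 0 < r &
  \forall x \near x0, forall y d, 0 < d < r -> (rdist g x y <= d%:E)%E -> N y.
Proof.
move=> nN; pose a := chart_at S x0; have ax : pdom a x0 by exact: chart_at_dom.
have [rho [C [rho0 C0 low]]] := rdist_lower g haus (chart_at_in S x0) ax.
have [r r0 hr] := chart_ball ax nN.
have r2 : 0 < r / 2 by rewrite divr_gt0.
exists (Num.min rho (r / 2 / C)); first by rewrite lt_min rho0 divr_gt0.
apply: filterS2 low (near_coord ax r2) => x lx [_ xr] y d /andP[d0].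
rewrite lt_min => /andP[dr1 dr2] xy.
have [|_ ay h] := lx y d _ xy; first by rewrite d0.
have [|_] := hr (pmap a y); last by rewrite pmapK.
rewrite -(subrK (pmap a x) (pmap a y)) -addrA [r]splitr.
apply: le_lt_trans (ler_normD _ _) _; apply: ltrD => //.
by apply: le_lt_trans h _; rewrite mulrC -ltr_pdivlMr.
Qed.

(* Symmetry and the triangle inequality for [rdist] would require reversing and
   concatenating C^1 paths; this weaker inequality, with a common source and a
   multiplicative constant, is enough. *)
Lemma rdist_triangle_near x0 : exists2 r : R, 0 < r & \forall x \near x0,
  forall y z d, 0 < d < r -> (rdist g x y <= d%:E)%E -> (rdist g x z <= d%:E)%E ->
  (rdist g y z <= (d / r)%:E)%E.
Proof.
pose a := chart_at S x0; have ax : pdom a x0 by exact: chart_at_dom.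
have Sa : charts S a by exact: chart_at_in.
have [rho [C1 [rho0 C10 low]]] := rdist_lower g haus Sa ax.
have [r [C2 [r0 C20 up]]] := rdist_upper g Sa ax.
have [e e0 ne] := near_rdist (near_coord ax r0).
pose s := Num.min (Num.min rho e) (C2 * (2 * C1))^-1.
have s0 : 0 < s by rewrite !lt_min rho0 e0 invr_gt0 !mulr_gt0.
exists s => //; apply: filterS2 low ne => x lx nx y z d /andP[d0].
rewrite !lt_min -andbA => /and3P[ds1 ds2 _] xy xz.
have dr : 0 < d < rho by rewrite d0.
have de : 0 < d < e by rewrite d0.
have [ay yr] := nx y d de xy; have [az zr] := nx z d de xz.
have [_ _ h1] := lx y d dr xy; have [_ _ h2] := lx z d dr xz.
have [_ _] := up _ _ yr zr; rewrite !pmapK// => /le_trans; apply; rewrite lee_fin.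
have h3 : `|pmap a y - pmap a z| <= 2 * C1 * d.
  rewrite -(subrKA (pmap a x)); apply: le_trans (ler_normD _ _) _.
  rewrite -mulrA mulr_natl mulr2n; apply: lerD => //.
  by rewrite distrC.
apply: le_trans (ler_wpM2l (ltW C20) h3) _.
rewrite mulrA mulrC ler_pM2l//.
have : s <= (C2 * (2 * C1))^-1 by rewrite ge_min lexx orbT.
by rewrite -lef_pV2 ?posrE ?invr_gt0 ?mulr_gt0// invrK.
Qed.

Lemma smooth1_in_charts (F : M -> M) a b x0 : smooth1 S F -> charts S a -> charts S b ->
  pdom a x0 -> pdom b (F x0) -> \forall z \near pmap a x0,
    [/\ pcod a z, pdom b (F (pinv a z)) &
      has_diff (in_charts a b F) z (fun u => u *m jac (in_charts a b F) z)].
Proof.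
move=> sF Sa Sb ax bx.
have nb : \forall x \near x0, pdom b (F x).
  by have [cF _] := sF x0; apply: cF; exact: near_pdom.
apply: filterS2 (near_pcod (pmap_cod ax)) (near_chart (P := fun x => pdom b (F x)) ax nb).
move=> z az bz; split=> //.
have [_ /(_ a b Sa Sb (pinv_dom az) bz)[h _]] := sF (pinv a z).
by rewrite /map_jac pinvK in h.
Qed.

Lemma jac_continuous_in_charts (F : M -> M) a b x0 : smooth1 S F ->
  charts S a -> charts S b -> pdom a x0 -> pdom b (F x0) ->
  {for pmap a x0, continuous (jac (in_charts a b F))}.
Proof.
move=> sF Sa Sb ax bx.
have [_ /(_ a b Sa Sb ax bx)[_ cJ]] := sF x0.
have h1 := pinv_cont (pmap_cod ax).
have cJ' : {for pinv a (pmap a x0), continuous (map_jac a b F)} by rewrite pmapK.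
have h2 := continuous_comp h1 cJ'.
apply: near_continuous h2; apply: filterS (near_pcod (pmap_cod ax)) => z az.
by rewrite /map_jac /= pinvK.
Qed.

Lemma strict_diff_near (F : M -> M) a b x0 (eta : R) : smooth1 S F ->
  charts S a -> charts S b -> pdom a x0 -> pdom b (F x0) -> 0 < eta ->
  exists2 r : R, 0 < r & \forall x \near x0, pdom a x /\ forall v, `|v| <= r ->
    [/\ pcod a (pmap a x + v), pdom b (F (pinv a (pmap a x + v))) &
      `|pmap b (F (pinv a (pmap a x + v))) - pmap b (F x) - v *m map_jac a b F x|
        <= eta * `|v|].
Proof.
move=> sF Sa Sb ax bx eta0.
have nd := smooth1_in_charts sF Sa Sb ax bx.
have nd' : \forall z \near pmap a x0,
    has_diff (in_charts a b F) z (fun u => u *m jac (in_charts a b F) z).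
  by apply: filterS nd => z [].
have [r1 r10 h1] := strict_diff nd' (jac_continuous_in_charts sF Sa Sb ax bx) eta0.
have /nbhs_ballP[r2 r20 h2] := nd.
pose r := Num.min r1 r2 / 2; have r0 : 0 < r by rewrite divr_gt0// lt_min r10.
exists r => //; apply: filterS (near_coord ax r0) => x [axx xr]; split=> // v vr.
have r12 : r + r <= r1 /\ r + r <= r2 by rewrite /r -splitr !ge_min !lexx orbT.
have xvr : `|pmap a x + v - pmap a x0| < r + r.
  by rewrite addrAC; apply: le_lt_trans (ler_normD _ _) _; rewrite ltr_leD.
have xr' : `|pmap a x - pmap a x0| < r + r by apply: lt_trans xr _; rewrite ltrDl.
have [|c1 c2 _] := h2 (pmap a x + v).
  by rewrite -ball_normE /= distrC; apply: lt_le_trans xvr _; case: r12.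
split=> //; have := h1 (pmap a x) v.
rewrite /in_charts /= pmapK//; apply.
  by apply: lt_le_trans xr' _; case: r12.
by apply: lt_le_trans xvr _; case: r12.
Qed.

(** Distances bound coordinates near [x0] by [rdist_lower], strict differentiability transports the
    coordinates, and [rdist_upper] returns to distances near [F x0]. *)
Lemma lipschitz_near (F : M -> M) x0 : smooth1 S F -> exists2 r : R, 0 < r &
  \forall x \near x0, forall y d, 0 < d < r -> (rdist g x y <= d%:E)%E ->
  (rdist g (F x) (F y) <= (d / r)%:E)%E.
Proof.
move=> sF; pose a := chart_at S x0; have ax : pdom a x0 by exact: chart_at_dom.
have Sa : charts S a by exact: chart_at_in.
pose b := chart_at S (F x0); have bx : pdom b (F x0) by exact: chart_at_dom.
have Sb : charts S b by exact: chart_at_in.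
have [rho [C1 [rho0 C10 low]]] := rdist_lower g haus Sa ax.
have [r [C2 [r0 C20 up]]] := rdist_upper g Sb bx.
have [r1 r10 sd] := strict_diff_near sF Sa Sb ax bx (@ltr01 R).
have [cF /(_ a b Sa Sb ax bx)[_ cJ]] := sF x0.
have nJ := near_norm_mx cJ; set K := n%:R * _ in nJ.
have K0 : 0 <= K by rewrite mulr_ge0// addr_ge0.
have nF : \forall x \near x0, pdom b (F x) /\ `|pmap b (F x) - pmap b (F x0)| < r.
  exact: cF _ (near_coord bx r0).
have [e e0 ne] := near_rdist nF.
pose L := C2 * ((1 + K) * C1).
have L0 : 0 < L by rewrite !mulr_gt0// ltr_wpDr.
pose s := Num.min (Num.min rho e) (Num.min (r1 / C1) L^-1).
have s0 : 0 < s by rewrite !lt_min rho0 e0 divr_gt0// invr_gt0.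
exists s => //; near=> x => y d /andP[d0].
rewrite !lt_min -!andbA => /and4P[ds1 ds2 ds3 _] xy.
have dr : 0 < d < rho by rewrite d0.
have de : 0 < d < e by rewrite d0.
have nx : forall y d, 0 < d < e -> (rdist g x y <= d%:E)%E ->
   pdom b (F y) /\ `|pmap b (F y) - pmap b (F x0)| < r by near: x.
have [by_ yr] := nx y d de xy.
have [bxx xr] : pdom b (F x) /\ `|pmap b (F x) - pmap b (F x0)| < r by near: x.
have lx : forall y d, 0 < d < rho -> (rdist g x y <= d%:E)%E ->
  [/\ pdom a x, pdom a y & `|pmap a y - pmap a x| <= C1 * d] by near: x.
have [axx ay h1] := lx y d dr xy.
have [_ sx] : pdom a x /\ forall v, `|v| <= r1 ->
    [/\ pcod a (pmap a x + v), pdom b (F (pinv a (pmap a x + v))) &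
      `|pmap b (F (pinv a (pmap a x + v))) - pmap b (F x) - v *m map_jac a b F x|
        <= 1 * `|v|] by near: x.
have bJ : forall u, `|u *m map_jac a b F x| <= K * `|u| by near: x.
have [|_ _] := sx (pmap a y - pmap a x).
  by apply: le_trans h1 _; rewrite mulrC -ler_pdivlMr// ltW.
rewrite subrKC pmapK// mul1r => h2.
have h3 : `|pmap b (F x) - pmap b (F y)| <= (1 + K) * (C1 * d).
  rewrite distrC -(subrK ((pmap a y - pmap a x) *m map_jac a b F x) (_ - _)).
  apply: le_trans (ler_normD _ _) _; rewrite mulrDl mul1r; apply: lerD.
    exact: le_trans h2 h1.
  by apply: le_trans (bJ _) _; rewrite ler_wpM2l.
have [_ _] := up _ _ xr yr; rewrite !pmapK// => /le_trans; apply; rewrite lee_fin.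
apply: le_trans (ler_wpM2l (ltW C20) h3) _.
rewrite !mulrA mulrC ler_pM2l//.
have : s <= L^-1 by rewrite !ge_min lexx !orbT.
by rewrite -lef_pV2 ?posrE ?invr_gt0// invrK /L mulrA.
Unshelve. all: by end_near. Qed.

End LocalGeometry.

Section Cover.
Variables (R : realType) (n : nat) (M : topologicalType).
Variables (S : smooth_atlas R n M) (g : riemannian_metric S).
Variables (Es Ec Eu : M -> {vspace 'rV[R]_n}).
Hypotheses (haus : hausdorff_space M) (cM : compact [set: M]).
Variables (K : M -> R) (Ps Pc Pu : M -> M -> 'M[R]_n) (C C' : M -> set M).
Local Notation ad p x := (adapted g Es Ec Eu (K p) p (Ps p) (Pc p) (Pu p) x).
Hypotheses (clC : forall p, closed (C p)) (clC' : forall p, closed (C' p)).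
Hypothesis CC' : forall p x, C p x -> nbhs x (C' p).
Hypothesis C'ad : forall p x, C' p x -> \forall y \near x, ad p y.
Implicit Types (x y : M) (u v : 'rV[R]_n).

(** The uniform estimates below assume membership in a closed set; around a point outside it they
    hold vacuously on a whole neighbourhood, so the local hypothesis of [compact_seq_unif] is met
    there too. *)
Lemma near_out (A : set M) x : closed A -> ~ A x -> \forall y \near x, ~ A y.
Proof.
by move=> cA nA; apply: open_nbhs_nbhs; split=> //; exact: closed_openC.
Qed.

Lemma nbhsI x (A B : set M) : nbhs x A -> nbhs x B -> nbhs x (A `&` B).
Proof. exact: filterI. Qed.

Lemma near_mx_close (P : M -> 'M[R]_n) x0 (eta : R) : 0 < eta ->
  {for x0, continuous P} ->
  \forall x \near x0, forall u, `|u *m P x - u *m P x0| <= eta * `|u|.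
Proof.
move=> eta0 cP; have n0 : 0 < n%:R + 1 :> R by rewrite ltr_wpDl.
have : \forall x \near x0, `|P x0 - P x| < eta / (n%:R + 1).
  by have /cvgrPdist_lt := cP; apply; rewrite divr_gt0.
apply: filterS => x h u; rewrite -mulmxBr; apply: le_trans (norm_mulmx_le _ _) _.
rewrite distrC in h; apply: le_trans (ler_wpM2l _ (ltW h)) _; first by rewrite mulr_ge0.
rewrite mulrAC ler_wpM2r// mulrCA ler_piMr ?(ltW eta0)//.
by rewrite ler_pdivrMr// mul1r lerDl.
Qed.

Lemma uniform_rdist_triangle : exists2 r : R, 0 < r & forall x y z d, 0 < d < r ->
  (rdist g x y <= d%:E)%E -> (rdist g x z <= d%:E)%E -> (rdist g y z <= (d / r)%:E)%E.
Proof.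
have [|x0|r r0 h] := compact_unif cM (G := fun x r => forall y z d, 0 < d < r ->
  (rdist g x y <= d%:E)%E -> (rdist g x z <= d%:E)%E ->
  (rdist g y z <= (d / r)%:E)%E) (R := R).
- move=> x r r' /andP[r'0 r'r] h y z d /andP[d0 dr] xy xz.
  apply: le_trans (h y z d _ xy xz) _; first by rewrite d0 (lt_le_trans dr).
  by rewrite lee_fin ler_wpM2l ?(ltW d0)// lef_pV2// posrE (lt_le_trans r'0).
- exact: rdist_triangle_near.
- by exists r.
Qed.

Lemma uniform_lipschitz (F : M -> M) : smooth1 S F ->
  exists2 r : R, 0 < r & forall x y d, 0 < d < r ->
  (rdist g x y <= d%:E)%E -> (rdist g (F x) (F y) <= (d / r)%:E)%E.
Proof.
move=> sF.
have [|x0|r r0 h] := compact_unif cM (G := fun x r => forall y d, 0 < d < r ->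
  (rdist g x y <= d%:E)%E -> (rdist g (F x) (F y) <= (d / r)%:E)%E) (R := R).
- move=> x r r' /andP[r'0 r'r] h y d /andP[d0 dr] xy.
  apply: le_trans (h y d _ xy) _; first by rewrite d0 (lt_le_trans dr).
  by rewrite lee_fin ler_wpM2l ?(ltW d0)// lef_pV2// posrE (lt_le_trans r'0).
- exact: lipschitz_near.
- by exists r.
Qed.

Lemma uniform_upper (s : seq M) : exists2 r : R, 0 < r & forall p, p \in s ->
  forall x, C' p x -> forall z1 z2 : 'rV[R]_n,
  `|z1 - pmap (chart_at S p) x| < r -> `|z2 - pmap (chart_at S p) x| < r ->
  [/\ pcod (chart_at S p) z1, pcod (chart_at S p) z2 &
  (rdist g (pinv (chart_at S p) z1) (pinv (chart_at S p) z2) <=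
    (`|z1 - z2| / r)%:E)%E].
Proof.
apply: compact_seq_unif => // [p x r r' /andP[r'0 r'r] h C'x z1 z2 h1 h2|p x0].
  have [c1 c2 h3] := h C'x z1 z2 (lt_le_trans h1 r'r) (lt_le_trans h2 r'r).
  split=> //; apply: le_trans h3 _.
  by rewrite lee_fin ler_wpM2l// lef_pV2// posrE (lt_le_trans r'0).
have [C'x|nC'x] := pselect (C' p x0); last first.
  by exists 1 => //; apply: filterS (near_out (clC' (p := p)) nC'x) => x nx /nx.
have Sa : charts S (chart_at S p) by exact: chart_at_in.
have [ax _ _ _ _] := nbhs_singleton (C'ad C'x).
have [r [C0 [r0 C00 h]]] := rdist_upper g Sa ax.
have r2 : 0 < r / 2 by rewrite divr_gt0.
pose e := Num.min (r / 2) C0^-1.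
have e0 : 0 < e by rewrite lt_min r2 invr_gt0.
exists e => //; apply: filterS (near_coord ax r2) => x [axx xr] _ z1 z2 h1 h2.
have near z : `|z - pmap (chart_at S p) x| < e -> `|z - pmap (chart_at S p) x0| < r.
  move=> zr; rewrite -(subrKA (pmap (chart_at S p) x)) [r]splitr.
  apply: le_lt_trans (ler_normD _ _) _; apply: ltrD => //.
  by apply: lt_le_trans zr _; rewrite ge_min lexx.
have [c1 c2 h3] := h _ _ (near _ h1) (near _ h2); split=> //.
apply: le_trans h3 _; rewrite lee_fin mulrC ler_wpM2l//.
have : e <= C0^-1 by rewrite ge_min lexx orbT.
by rewrite -lef_pV2 ?posrE ?invr_gt0// invrK.
Qed.

(** The reason for two nested families: if [F (x k)] is in [C p], the next point [x (k + 1)] is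
    still in [C' p], and both are read in the same chart and frame. *)
Lemma uniform_close (s : seq M) (eta : R) : 0 < eta ->
  exists2 r : R, 0 < r & forall p, p \in s -> forall x, C p x ->
  forall y d, 0 < d < r -> (rdist g x y <= d%:E)%E ->
  [/\ C' p y, `|pmap (chart_at S p) y - pmap (chart_at S p) x| <= d / r
    & forall u, [/\ `|u *m Ps p y - u *m Ps p x| <= eta * `|u|,
        `|u *m Pc p y - u *m Pc p x| <= eta * `|u|
      & `|u *m Pu p y - u *m Pu p x| <= eta * `|u|]].
Proof.
move=> eta0.
apply: compact_seq_unif => // [p x r r' /andP[r'0 r'r] h Cx y d /andP[d0 dr] xy|p x0].
  have [|c1 h3 h4] := h Cx y d _ xy; first by rewrite d0 (lt_le_trans dr).
  split=> //; apply: le_trans h3 _.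
  by rewrite ler_wpM2l ?(ltW d0)// lef_pV2// posrE (lt_le_trans r'0).
have [Cx|nCx] := pselect (C p x0); last first.
  by exists 1 => //; apply: filterS (near_out (clC (p := p)) nCx) => x nx /nx.
have Sa : charts S (chart_at S p) by exact: chart_at_in.
have [ax _ [cs cc cu _] _ _] := nbhs_singleton (C'ad (nbhs_singleton (CC' Cx))).
have [rho [C1 [rho0 C10 low]]] := rdist_lower g haus Sa ax.
have eta2 : 0 < eta / 2 by rewrite divr_gt0.
have ns := near_mx_close eta2 cs; have nc := near_mx_close eta2 cc.
have nu := near_mx_close eta2 cu.
have nN := nbhsI (CC' Cx) (nbhsI ns (nbhsI nc nu)).
have [r r0 nr] := near_rdist g haus nN.
pose e := Num.min (Num.min rho r) C1^-1.
have e0 : 0 < e by rewrite !lt_min rho0 r0 invr_gt0.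
exists e => //; apply: filterS3 low nr nN => x lx nx [_ [sx [cx ux]]] _ y d /andP[d0].
rewrite !lt_min -andbA => /and3P[d1 d2 _] xy.
have [|_ _ h] := lx y d _ xy; first by rewrite d0.
have [|c1 [sy [cy uy]]] := nx y d _ xy; first by rewrite d0.
split=> //.
  apply: le_trans h _; rewrite mulrC ler_pM2l//.
  have : e <= C1^-1 by rewrite ge_min lexx orbT.
  by rewrite -lef_pV2 ?posrE ?invr_gt0// invrK.
have tri (P : M -> 'M[R]_n) u : `|u *m P x - u *m P x0| <= eta / 2 * `|u| ->
    `|u *m P y - u *m P x0| <= eta / 2 * `|u| -> `|u *m P y - u *m P x| <= eta * `|u|.
  move=> h1 h2; rewrite -(subrKA (u *m P x0)) [eta]splitr mulrDl.
  by apply: le_trans (ler_normD _ _) _; apply: lerD => //; rewrite distrC.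
by move=> u; split; apply: tri.
Qed.

Lemma uniform_strict_diff (F : M -> M) (s : seq M) (eta : R) : smooth1 S F -> 0 < eta ->
  exists2 r : R, 0 < r & forall pq, pq \in [seq (p, q) | p <- s, q <- s] ->
  forall x, C' pq.1 x -> C pq.2 (F x) ->
  let a := chart_at S pq.1 in let b := chart_at S pq.2 in
  forall v, `|v| <= r ->
  [/\ pcod a (pmap a x + v), ad pq.1 (pinv a (pmap a x + v)),
      forall u, `|u *m Pc pq.1 (pinv a (pmap a x + v)) - u *m Pc pq.1 x| <= eta * `|u|,
      pdom b (F (pinv a (pmap a x + v)))
    & `|pmap b (F (pinv a (pmap a x + v))) - pmap b (F x) - v *m map_jac a b F x|
        <= eta * `|v|].
Proof.
move=> sF eta0; apply: compact_seq_unif => // [pq x r r' /andP[r'0 r'r] h Cx CFx a b v vr|].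
  by apply: h => //; exact: le_trans r'r.
move=> [p q] x0 /=; set a := chart_at S p; set b := chart_at S q.
have [cF _] := sF x0.
have [C'x|nC'x] := pselect (C' p x0); last first.
  by exists 1 => //; apply: filterS (near_out (clC' (p := p)) nC'x) => x nx /nx.
have [CFx|nCFx] := pselect (C q (F x0)); last first.
  have nF : \forall x \near x0, ~ C q (F x).
    exact: cF _ (near_out (clC (p := q)) nCFx).
  by exists 1 => //; apply: filterS nF => x nx _ /nx.
have Sa : charts S a by exact: chart_at_in.
have Sb : charts S b by exact: chart_at_in.
have [ax _ [_ cc _ _] _ _] := nbhs_singleton (C'ad C'x).
have [bx _ _ _ _] := nbhs_singleton (C'ad (nbhs_singleton (CC' CFx))).
have [r1 r10 sd] := strict_diff_near sF Sa Sb ax bx eta0.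
have eta2 : 0 < eta / 2 by rewrite divr_gt0.
have nN := nbhsI (C'ad C'x) (near_mx_close eta2 cc).
have [r2 r20 h2] := chart_ball ax nN.
have r22 : 0 < r2 / 2 by rewrite divr_gt0.
pose r := Num.min r1 (r2 / 2).
exists r; first by rewrite lt_min r10.
apply: filterS3 sd nN (near_coord ax r22) => x [axx sx] [_ cx] [_ xr] _ _ v.
rewrite le_min => /andP[v1 v2].
have [c1 c2 c3] := sx v v1.
have [|_ [ady cy]] := h2 (pmap a x + v).
  rewrite addrAC [r2]splitr; apply: le_lt_trans (ler_normD _ _) _.
  by rewrite ltr_leD.
split=> // u; rewrite -(subrKA (u *m Pc p x0)) [eta]splitr mulrDl.
by apply: le_trans (ler_normD _ _) _; apply: lerD => //; rewrite distrC.
Qed.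

Lemma uniform_jacobian (F H : M -> M) (s : seq M) : inverse_pair S F H ->
  exists2 r : R, 0 < r & forall pq, pq \in [seq (p, q) | p <- s, q <- s] ->
  forall x, C' pq.1 x -> C pq.2 (F x) ->
  forall u, `|u *m map_jac (chart_at S pq.1) (chart_at S pq.2) F x| <= `|u| / r /\
    `|u *m invmx (map_jac (chart_at S pq.1) (chart_at S pq.2) F x)| <= `|u| / r.
Proof.
move=> iF; have [sF _ _ _] := iF.
apply: compact_seq_unif => // [pq x r r' /andP[r'0 r'r] h Cx CFx u|].
  have [h1 h2] := h Cx CFx u; have le : `|u| / r <= `|u| / r'.
    by rewrite ler_wpM2l// lef_pV2// posrE (lt_le_trans r'0).
  by split; apply: le_trans le.
move=> [p q] x0 /=; set a := chart_at S p; set b := chart_at S q.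
have [cF sF0] := sF x0.
have [C'x|nC'x] := pselect (C' p x0); last first.
  by exists 1 => //; apply: filterS (near_out (clC' (p := p)) nC'x) => x nx /nx.
have [CFx|nCFx] := pselect (C q (F x0)); last first.
  have nF : \forall x \near x0, ~ C q (F x).
    exact: cF _ (near_out (clC (p := q)) nCFx).
  by exists 1 => //; apply: filterS nF => x nx _ /nx.
have Sa : charts S a by exact: chart_at_in.
have Sb : charts S b by exact: chart_at_in.
have [ax _ _ _ _] := nbhs_singleton (C'ad C'x).
have [bx _ _ _ _] := nbhs_singleton (C'ad (nbhs_singleton (CC' CFx))).
have [_ cJ] := sF0 a b Sa Sb ax bx.
have cI : {for x0, continuous (fun x => invmx (map_jac a b F x))}.
  by apply: cvg_invmx => //; exact: map_jac_unit iF Sa Sb ax bx.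
have n1 := near_norm_mx cJ; have n2 := near_norm_mx cI.
set K1 := n%:R * _ in n1; set K2 := n%:R * _ in n2.
have K10 : 0 <= K1 by rewrite mulr_ge0// addr_ge0.
have K20 : 0 <= K2 by rewrite mulr_ge0// addr_ge0.
have K120 : 0 < K1 + K2 + 1 by rewrite ltr_wpDl// addr_ge0.
exists (K1 + K2 + 1)^-1; first by rewrite invr_gt0.
apply: filterS2 n1 n2 => x h1 h2 _ _ u; rewrite invrK.
split; [apply: le_trans (h1 u) _|apply: le_trans (h2 u) _];
  rewrite mulrC ler_wpM2l//; lra.
Qed.

End Cover.

(** * Central shadowing *)

Section Shadowing.
Variables (R : realType) (n : nat) (M : topologicalType).
Variables (S : smooth_atlas R n M) (g : riemannian_metric S).
Variables (Es Ec Eu : M -> {vspace 'rV[R]_n}).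
Hypotheses (haus : hausdorff_space M) (cM : compact [set: M]).
Implicit Types (x y : M) (u v : 'rV[R]_n).

Lemma ramp_onto (s : R) : 0 <= s <= 1 -> exists2 t : R, 0 <= t <= 1 & ramp t = s.
Proof.
move=> s01; have [||t t01 <-] := @IVT R (@ramp R) 0 1 s ler01.
- apply: continuous_subspaceT => t; apply: differentiable_continuous.
  by case: (has_diff_ramp t).
- by rewrite ramp0 ramp1 min_l ?ler01// max_r ?ler01.
by exists t => //; move: t01; rewrite in_itv.
Qed.

(** Run along [ramp], the curve is a C^1 path tangent to [Ec], so unique integrability puts it in
    one leaf; since [ramp] maps [0, 1] onto [0, 1], this concerns every point of [P]. *)
Lemma leaf_curve (Wc : M -> set M) (a : chart R n M) (P : R -> 'rV[R]_n)
    (G : 'rV[R]_n -> 'rV[R]_n) : uniquely_integrates S Ec Wc -> charts S a ->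
  integral_curve G P ->
  (forall t, 0 <= t <= 1 -> {for P t, continuous G}) ->
  (forall t, 0 <= t <= 1 -> pcod a (P t)) ->
  (forall t, 0 <= t <= 1 ->
     G (P t) *m tangent_mx S a (pinv a (P t)) \in Ec (pinv a (P t))) ->
  forall t, 0 <= t <= 1 -> Wc (pinv a (P 1)) (pinv a (P t)).
Proof.
move=> [k [_ [[_ Weq] _ _] _ uniq]] Sa dP cG aP EP.
have cr := @continuous_ramp' R.
have [c v] := chart_curve Sa dP cG aP (@ramp_itv R) (@has_diff_ramp R) cr.
have [|L [[[x0 Lx0] sub] _]] := uniq _ c.
  by move=> t _; rewrite v -scalemxAl; apply/memvZ/EP/ramp_itv.
have inL t : 0 <= t <= 1 -> Wc x0 (pinv a (P t)).
  move=> /ramp_onto[t' t'01 <-]; rewrite -Lx0; apply: sub.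
  by exists t' => //; rewrite /= in_itv.
have h1 : Wc x0 (pinv a (P 1)) by apply: inL; rewrite lexx ler01.
by move=> t t01; rewrite (Weq _ _ h1); exact: inL.
Qed.

Lemma cover_exists :
  (forall x, directv (Es x + Ec x + Eu x) /\ (Es x + Ec x + Eu x)%VS = fullv) ->
  continuous_distribution S Es -> continuous_distribution S Ec ->
  continuous_distribution S Eu ->
  exists (K : M -> R) (Ps Pc Pu : M -> M -> 'M[R]_n) (C C' : M -> set M) (s : seq M),
  [/\ (forall p, closed (C p)) /\ (forall p, closed (C' p)),
      forall p x, C p x -> nbhs x (C' p),
      forall p x, C' p x -> \forall y \near x,
        adapted g Es Ec Eu (K p) p (Ps p) (Pc p) (Pu p) y
    & forall x, exists2 p, p \in s & C p x].
Proof.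
move=> dE cs cc cu.
have /choice[KP hKP] : forall p, exists KP : R * (M -> 'M[R]_n) * (M -> 'M[R]_n) * (M -> 'M[R]_n),
    \forall x \near p, adapted g Es Ec Eu KP.1.1.1 p KP.1.1.2 KP.1.2 KP.2 x.
  move=> p; have [K [Ps [Pc [Pu h]]]] := adapted_exists g dE p cs cc cu.
  by exists (K, Ps, Pc, Pu).
pose K p := (KP p).1.1.1; pose Ps p := (KP p).1.1.2; pose Pc p := (KP p).1.2.
pose Pu p := (KP p).2.
have /choice[C' hC'] := fun p => closed_nbhs cM haus (hKP p).
have /choice[C hC] : forall p, exists C : set M,
    [/\ closed C, nbhs p C & forall x, C x -> nbhs x (C' p)].
  by move=> p; apply: closed_nbhs => //; case: (hC' p).
have [s hs] : exists s : seq M, forall x, exists2 p, p \in s & C p x.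
  by apply: compact_centers => // p; case: (hC p).
exists K, Ps, Pc, Pu, C, C', s; split=> //.
- by split=> p; [case: (hC p)|case: (hC' p)].
- by move=> p; case: (hC p).
- by move=> p x C'x; case: (hC' p) => _ _ /(_ x C'x).
Qed.

(** Both orders are recorded: the distance from [y'] serves for the leaf ball, the distance to [y']
    for the pseudotrajectory. *)
Definition central_step (Wc : M -> set M) (F : M -> M) (e : R) y y' :=
  [/\ Wc y' (F y), (dist_in g (Wc y') y' (F y) <= e%:E)%E
    & (dist_in g (Wc y') (F y) y' <= e%:E)%E].

Section Step.
Variables (Kc lam : R) (Ps Pc Pu : M -> M -> 'M[R]_n) (C C' : M -> set M) (s : seq M).
Local Notation ad p x := (adapted g Es Ec Eu Kc p (Ps p) (Pc p) (Pu p) x).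
Hypothesis dE : forall x,
  directv (Es x + Ec x + Eu x) /\ (Es x + Ec x + Eu x)%VS = fullv.
Hypotheses (K1 : 1 <= Kc) (lam0 : 0 <= lam) (Klam : Kc ^+ 3 * lam <= 16^-1).
Hypothesis CC' : forall p x, C p x -> nbhs x (C' p).
Hypothesis C'ad : forall p, p \in s -> forall x, C' p x -> ad p x.
Variables (F H : M -> M).
Hypotheses (iF : inverse_pair S F H) (hF : hyp_step g Es Ec Eu lam F).
Variables (rJ : R).
Hypothesis hJ : forall p q, p \in s -> q \in s -> forall x, C' p x -> C q (F x) ->
  forall u, `|u *m map_jac (chart_at S p) (chart_at S q) F x| <= rJ * `|u| /\
    `|u *m invmx (map_jac (chart_at S p) (chart_at S q) F x)| <= rJ * `|u|.

Let K := Kc + rJ.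

(** [y] stands for the next point of the pseudotrajectory, close to [F x]. The tolerance
    [dl / (2 * K ^+ 2)] absorbs the factor [K] of [invmx A] and the factor [2 * K] of
    [1%:M - Pu p x]. In the stable rate, one [16^-1] is the hyperbolic estimate at [F x] and the
    other pays for moving to [y]. *)
Lemma step_constants p q x y (dl : R) : p \in s -> q \in s -> 0 <= rJ ->
  0 <= dl <= 40^-1 -> C' p x -> C q (F x) ->
  let A := map_jac (chart_at S p) (chart_at S q) F x in
  (forall u, [/\ `|u *m Ps q y - u *m Ps q (F x)| <= dl / (2 * K ^+ 2) * `|u|,
      `|u *m Pc q y - u *m Pc q (F x)| <= dl / (2 * K ^+ 2) * `|u|
    & `|u *m Pu q y - u *m Pu q (F x)| <= dl / (2 * K ^+ 2) * `|u|]) ->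
  [/\ A *m invmx A = 1%:M /\ invmx A *m A = 1%:M,
      forall u, `|u *m A| <= K * `|u| /\ `|u *m invmx A| <= K * `|u|,
      forall u, `|u *m A *m Ps q y| <= 8^-1 * `|u| /\
        `|u *m invmx A *m Pu p x| <= 8^-1 * `|u|,
      forall u, `|u *m Pu q y *m invmx A *m (1%:M - Pu p x)| <= dl * `|u|
    & forall u, `|u *m Pc q y *m invmx A *m Pu p x| <= dl * `|u|].
Proof.
move=> ps qs rJ0 /andP[dl0 dl40] C'x CFx A close.
have ax := C'ad ps C'x; have aFx := C'ad qs (nbhs_singleton (CC' CFx)).
have Kc0 : 0 <= Kc by rewrite (le_trans ler01).
have K0 : 0 <= K by rewrite addr_ge0.
have KcK : Kc <= K by rewrite lerDl.
have K1' : 1 <= K by exact: le_trans K1 KcK.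
have rJK : rJ <= K by rewrite lerDr.
have uA : A \in unitmx by exact: step_unit ax aFx iF.
have bA u : `|u *m A| <= K * `|u|.
  by have [h _] := hJ ps qs C'x CFx u; apply: le_trans h _; rewrite ler_wpM2r.
have bB u : `|u *m invmx A| <= K * `|u|.
  by have [_ h] := hJ ps qs C'x CFx u; apply: le_trans h _; rewrite ler_wpM2r.
have bPu u : `|u *m Pu p x| <= K * `|u|.
  have [_ _ _ _ /(_ u)[_ _ h]] := ax.
  by apply: le_trans h _; rewrite ler_wpM2r.
have b1Pu u : `|u *m (1%:M - Pu p x)| <= 2 * K * `|u|.
  rewrite mulmxBr mulmx1; apply: le_trans (ler_normB _ _) _.
  rewrite -mulrA mulr_natl mulr2n; apply: lerD; last exact: bPu.
  by rewrite ler_peMl.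
set e := dl / (2 * K ^+ 2) in close.
have K20 : 0 < 2 * K ^+ 2 by rewrite mulr_gt0// exprn_gt0// (lt_le_trans ltr01).
have eK : e * (2 * K ^+ 2) = dl by rewrite /e divfK// gt_eqF.
have e0 : 0 <= e by rewrite divr_ge0// ltW.
have eK1 : K * e <= 16^-1.
  apply: (@le_trans _ _ dl); last by apply: le_trans dl40 _; rewrite lef_pV2 ?posrE// ler_nat.
  rewrite -eK mulrC ler_wpM2l// expr2 mulrA ler_peMl//.
  by apply: le_trans K1' _; rewrite ler_peMl// ler1n.
split.
- by split; [exact: mulmxV|exact: mulVmx].
- by [].
- move=> u; split.
    rewrite -(subrK (u *m A *m Ps q (F x)) (u *m A *m Ps q y)).
    apply: le_trans (ler_normD _ _) _.
    have -> : 8^-1 = 16^-1 + 16^-1 :> R by field.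
    rewrite mulrDl; apply: lerD.
      have [h _ _] := close (u *m A); apply: le_trans h _.
      apply: le_trans (ler_wpM2l e0 (bA u)) _.
      by rewrite mulrA [e * K]mulrC ler_wpM2r.
    have h := step_s dE Kc0 lam0 ax aFx iF hF u.
    by apply: le_trans h _; rewrite ler_wpM2r.
  have h := step_u dE Kc0 lam0 ax aFx iF hF u.
  apply: le_trans h _; rewrite ler_wpM2r//; apply: le_trans Klam _.
  by rewrite lef_pV2 ?posrE// ler_nat.
- move=> u; have h := step_uu dE ax aFx iF hF.
  have -> : u *m Pu q y *m invmx A *m (1%:M - Pu p x) =
      (u *m Pu q y - u *m Pu q (F x)) *m invmx A *m (1%:M - Pu p x).
    by rewrite !mulmxBl -!mulmxA [Pu q (F x) *m _]mulmxA h mulmx0 subr0.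
  apply: le_trans (b1Pu _) _.
  apply: le_trans (ler_wpM2l _ (bB _)) _; first by rewrite mulr_ge0.
  have [_ _ h3] := close u.
  apply: le_trans (ler_wpM2l _ (ler_wpM2l K0 h3)) _; first by rewrite mulr_ge0.
  rewrite -eK; rewrite le_eqVlt; apply/orP; left; apply/eqP; ring.
- move=> u; have h := step_cu dE ax aFx iF hF.
  have -> : u *m Pc q y *m invmx A *m Pu p x =
      (u *m Pc q y - u *m Pc q (F x)) *m invmx A *m Pu p x.
    by rewrite !mulmxBl -!mulmxA [Pc q (F x) *m _]mulmxA h mulmx0 subr0.
  apply: le_trans (bPu _) _; apply: le_trans (ler_wpM2l K0 (bB _)) _.
  have [_ h3 _] := close u.
  apply: le_trans (ler_wpM2l K0 (ler_wpM2l K0 h3)) _.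
  have -> : K * (K * (e * `|u|)) = e * K ^+ 2 * `|u| by ring.
  rewrite -eK; apply: ler_wpM2r => //; apply: ler_wpM2l => //.
  by rewrite ler_peMl ?exprn_ge0// ler1n.
Qed.

End Step.

Lemma central_shadowing_step (Wc : M -> set M) (Kc lam : R)
    (Ps Pc Pu : M -> M -> 'M[R]_n) (C C' : M -> set M) (s : seq M) (K : M -> R)
    (F H : M -> M) :
  (forall x, directv (Es x + Ec x + Eu x) /\ (Es x + Ec x + Eu x)%VS = fullv) ->
  uniquely_integrates S Ec Wc ->
  (forall p, closed (C p)) -> (forall p, closed (C' p)) ->
  (forall p x, C p x -> nbhs x (C' p)) ->
  (forall p x, C' p x -> \forall y \near x,
     adapted g Es Ec Eu (K p) p (Ps p) (Pc p) (Pu p) y) ->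
  (forall x, exists2 p, p \in s & C p x) ->
  1 <= Kc -> (forall p, p \in s -> K p <= Kc) ->
  0 <= lam -> Kc ^+ 3 * lam <= 16^-1 ->
  inverse_pair S F H -> hyp_step g Es Ec Eu lam F ->
  exists d0 L : R, [/\ 0 < d0, 0 < L & forall d, 0 < d < d0 -> forall x : int -> M,
    (forall k, (rdist g (F (x k)) (x (k + 1)%R) <= d%:E)%E) ->
    exists y : int -> M, forall k, (rdist g (x k) (y k) <= (L * d)%:E)%E /\
      central_step Wc F (L * d) (y k) (y (k + 1))].
Proof.
move=> dE uW clC clC' CC' C'ad cov Kc1 KKc lam0 Klam iF hF.
have [sF _ _ _] := iF.
have [rJ rJ0 hJ] := uniform_jacobian cM clC clC' CC' C'ad s iF.
have [c cP] : exists c : M -> M, forall x, c x \in s /\ C (c x) x.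
  have /choice[c cP] : forall x, exists p, p \in s /\ C p x.
    by move=> x; have [p ps Cp] := cov x; exists p.
  by exists c.
have ad p : p \in s -> forall x, C' p x -> adapted g Es Ec Eu Kc p (Ps p) (Pc p) (Pu p) x.
  move=> ps x C'x; apply: (adapted_le (KKc p ps)).
  exact: nbhs_singleton (C'ad p x C'x).
have hJ' p q : p \in s -> q \in s -> forall x, C' p x -> C q (F x) ->
    forall u, `|u *m map_jac (chart_at S p) (chart_at S q) F x| <= rJ^-1 * `|u| /\
    `|u *m invmx (map_jac (chart_at S p) (chart_at S q) F x)| <= rJ^-1 * `|u|.
  move=> ps qs x C'x CFx u; have [|h1 h2] := hJ (p, q) _ x C'x CFx u.
    by apply/allpairsP; exists (p, q).
  by rewrite ![rJ^-1 * _]mulrC.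
pose k0 := Kc + rJ^-1.
have rJi : 0 < rJ^-1 by rewrite invr_gt0.
have Kck : Kc <= k0 by rewrite lerDl ltW.
have k1 : 1 <= k0 by exact: le_trans Kck.
have k00 : 0 < k0 by exact: lt_le_trans k1.
pose dl := 40^-1 / k0 ^+ 4.
have dl0 : 0 < dl by rewrite divr_gt0// exprn_gt0.
have dlK : dl * k0 ^+ 4 <= 40^-1 by rewrite /dl divfK// gt_eqF// exprn_gt0.
have dl40 : 0 <= dl <= 40^-1.
  rewrite ltW//= /dl ler_pdivrMr ?exprn_gt0// ler_peMr//.
  exact: exprn_ege1.
pose eta := dl / (2 * k0 ^+ 2).
have eta0 : 0 < eta by rewrite divr_gt0// mulr_gt0// exprn_gt0.
have [rc rc0 hclose] := uniform_close haus cM clC CC' C'ad s eta0.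
have [ru ru0 hup] := uniform_upper cM clC' C'ad s.
have [rs rs0 hsd] := uniform_strict_diff cM clC clC' CC' C'ad s sF dl0.
pose r0 := Num.min rs (ru / 2).
have ru2 : 0 < ru / 2 by rewrite divr_gt0.
have r00 : 0 < r0 by rewrite lt_min rs0.
have r0s : r0 <= rs by rewrite ge_min lexx.
have r0u : r0 < ru by rewrite gt_min ltr_pdivrMr// ltr_pMr// ltr1n orbT.
(* Jumps read in charts are at most [d / rc], and the second bound keeps the curves, of size
   [50 * k0 ^+ 5 * d / rc], within the radius [r0] of validity. In [L], the first term bounds the
   distance from [x k] to [y k], the second the central curves. *)
pose d0 := Num.min rc (r0 * rc / (50 * k0 ^+ 5)).
pose L := 8 * k0 ^+ 2 / rc / ru + k0 * (2 * (16 * k0 ^+ 4 * k0 / rc)).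
have L0 : 0 < L by rewrite addr_gt0// !(divr_gt0, mulr_gt0, exprn_gt0).
have d00 : 0 < d0 by rewrite lt_min rc0 !(divr_gt0, mulr_gt0, exprn_gt0).
exists d0, L; split=> // d /andP[d_gt0]; rewrite lt_min => /andP[drc dr0'] x hx.
(* The chart used at time [k] is chosen from [F (x (k - 1))] rather than [x k]:
   [F (x k)] and [x (k + 1)] are then both well inside the same chart. *)
pose p (k : int) := c (F (x (k - 1))).
have ps k : p k \in s by case: (cP (F (x (k - 1)))).
have pC k : C (p (k + 1)) (F (x k)).
  by rewrite /p addrK; case: (cP (F (x k))).
have close k := hclose (p (k + 1)) (ps _) (F (x k)) (pC k) (x (k + 1)) d
  (introT andP (conj d_gt0 drc)) (hx k).
have pC' k : C' (p k) (x k) by rewrite -[k](subrK 1); case: (close (k - 1)).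
pose a k := chart_at S (p k); pose z k := pmap (a k) (x k).
have Sa k : charts S (a k) by exact: chart_at_in.
have adx k := ad _ (ps k) _ (pC' k).
have ax k : pdom (a k) (x k) by case: (adx k).
pose A k := map_jac (a k) (a (k + 1)) F (x k).
have sd k v : `|v| <= r0 ->
  [/\ pcod (a k) (z k + v),
      adapted g Es Ec Eu Kc (p k) (Ps (p k)) (Pc (p k)) (Pu (p k)) (pinv (a k) (z k + v)),
      forall u, `|u *m Pc (p k) (pinv (a k) (z k + v)) - u *m Pc (p k) (x k)| <= dl * `|u|,
      pdom (a (k + 1)) (F (pinv (a k) (z k + v)))
    & `|pmap (a (k + 1)) (F (pinv (a k) (z k + v))) - pmap (a (k + 1)) (F (x k))
        - v *m A k| <= dl * `|v|].
  move=> vr; have [||c1 c2 c3 c4 c5] := hsd (p k, p (k + 1)) _ (x k) (pC' k) (pC k) v.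
  - by apply/allpairsP; exists (p k, p (k + 1)); split=> //; exact: ps.
  - exact: le_trans r0s.
  by split=> //; exact: adapted_le (KKc _ (ps k)) c2.
(* Coordinates are centred at [z k]. Truncation makes [F'] and [Q] continuous on the whole space and
   changes nothing on the ball of radius [r0], where the solutions lie. *)
pose F' k v := pmap (a (k + 1)) (F (pinv (a k) (z k + trunc_ball r0 v))) - z (k + 1).
pose Q k v := Pc (p k) (pinv (a k) (z k + trunc_ball r0 v)).
pose e := d / rc.
have e0 : 0 < e by rewrite divr_gt0.
have er0 : 50 * k0 ^+ 5 * e <= r0.
  rewrite /e mulrA ler_pdivrMr// mulrC -ler_pdivlMr ?mulr_gt0 ?exprn_gt0//.
  exact: ltW.
have k5 : 8 * k0 ^+ 2 <= 50 * k0 ^+ 5.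
  apply: ler_pM; rewrite ?exprn_ge0 ?(ltW k00)// ?ler_nat//.
  by rewrite ler_weXn2l.
have er0' : 8 * k0 ^+ 2 * e <= r0.
  by apply: le_trans er0; rewrite ler_wpM2r// ltW.
have cst k := step_constants dE Kc1 lam0 Klam CC' ad iF hF hJ' (ps k) (ps (k + 1))
  (ltW rJi) dl40 (pC' k) (pC k) (let: And3 _ _ h := close k in h).
have bP k u : [/\ `|u *m Ps (p k) (x k)| <= k0 * `|u|, `|u *m Pc (p k) (x k)| <= k0 * `|u|
    & `|u *m Pu (p k) (x k)| <= k0 * `|u|].
  have [_ _ _ _ /(_ u)[h1 h2 h3]] := adx k.
  by split; [apply: le_trans h1 _|apply: le_trans h2 _|apply: le_trans h3 _];
    rewrite ler_wpM2r.
have tr v : `|trunc_ball r0 v| <= r0 by exact: trunc_ball_le.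
have tid v : `|v| <= r0 -> trunc_ball r0 v = v by exact: trunc_ball_id.
have t0 : trunc_ball r0 (0 : 'rV[R]_n) = 0 by apply: tid; rewrite normr0 ltW.
have cpinv k v : {for v, continuous (fun v => pinv (a k) (z k + trunc_ball r0 v))}.
  have [c1 _ _ _ _] := sd k _ (tr v).
  apply: (@continuous_comp _ _ _ (fun v => z k + trunc_ball r0 v) (pinv (a k))).
    have FV : Filter (nbhs v) by exact: nbhs_filter.
    suff : z k + trunc_ball r0 v' @[v' --> nbhs v] --> z k + trunc_ball r0 v by [].
    by apply: (@cvgD _ _ _ (nbhs v) FV); [exact: cvg_cst|exact: cvg_trunc_ball].
  exact: pinv_cont.
have cQ k : continuous (Q k).
  move=> v; have [_ [_ _ [_ cc _ _] _ _] _ _ _] := sd k _ (tr v).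
  exact: continuous_comp (cpinv k v) cc.
have cF' k : continuous (F' k).
  move=> v; have [_ _ _ c4 _] := sd k _ (tr v).
  have [cF _] := sF (pinv (a k) (z k + trunc_ball r0 v)).
  have h := continuous_comp (continuous_comp (cpinv k v) cF) (pmap_cont c4).
  have FV : Filter (nbhs v) by exact: nbhs_filter.
  suff : F' k v' @[v' --> nbhs v] --> F' k v by [].
  by apply: (@cvgB _ _ _ (nbhs v) FV); [exact: h|exact: cvg_cst].
have F'0 k : `|F' k 0| <= e.
  rewrite /F' t0 addr0 pmapK// distrC.
  by case: (close k).
have F'd k v : `|v| <= r0 -> `|F' k v - F' k 0 - v *m A k| <= dl * `|v|.
  move=> vr; have [_ _ _ _] := sd k v vr.
  by rewrite /F' t0 addr0 pmapK// tid// opprB addrA subrK.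
have Qd k v u : `|u *m Q k v - u *m Pc (p k) (x k)| <= dl * `|u|.
  by have [_ _ h _ _] := sd k _ (tr v); exact: h.
have [||||||||||v [w [pp [hv hw hp hpp hd]]]] := @infinite_shadowing R n k0 dl e r0
  (fun k => Ps (p k) (x k)) (fun k => Pc (p k) (x k)) (fun k => Pu (p k) (x k))
  A (fun k => invmx (A k)) F' Q k1 (ltW dl0) dlK e0 er0' (fun k => adapted_splitting dE (adx k))
  _ _ _ _ _ _ _ _ _ _ (@cF') F'0 F'd (@cQ) Qd.
- by move=> k; case: (cst k).
- by move=> k u; case: (bP k u).
- by move=> k u; case: (bP k u).
- by move=> k u; case: (bP k u).
- by move=> k u; have [_ /(_ u)[]] := cst k.
- by move=> k u; have [_ /(_ u)[]] := cst k.
- by move=> k u; have [_ _ /(_ u)[]] := cst k.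
- by move=> k u; have [_ _ /(_ u)[]] := cst k.
- by move=> k u; have [_ _ _ /(_ u)] := cst k.
- by move=> k u; have [_ _ _ _ /(_ u)] := cst k.
have vr k : `|v k| <= r0 by apply: le_trans (hv k) _.
pose y k := pinv (a k) (z k + v k).
have Fy k : F (y k) = pinv (a (k + 1)) (z (k + 1) + F' k (v k)).
  have [_ _ _ c4 _] := sd k _ (vr k).
  by rewrite /F' tid// subrKC pmapK.
exists y => k; split.
  have [||_ _] := hup (p k) (ps k) (x k) (pC' k) (z k) (z k + v k).
  - by rewrite subrr normr0.
  - by rewrite addrAC subrr add0r; exact: le_lt_trans (vr k) r0u.
  rewrite (_ : pinv (chart_at S (p k)) (z k) = x k); last exact: pmapK (ax k).
  move=> /le_trans; apply; rewrite lee_fin opprD addrA subrr sub0r normrN.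
  apply: (@le_trans _ _ (8 * k0 ^+ 2 * e / ru)); first by rewrite ler_wpM2r// invr_ge0 ltW.
  rewrite /L [leRHS]mulrDl (_ : 8 * k0 ^+ 2 * e / ru = 8 * k0 ^+ 2 / rc / ru * d); last by rewrite /e; ring.
  by rewrite lerDl !(divr_ge0, mulr_ge0, exprn_ge0)// ltW.
pose q := k + 1; pose P (t : R) := z q + pp k t.
pose G u := w q *m Q q (u - z q).
have Pz t : P t - z q = pp k t by rewrite /P addrAC subrr add0r.
have ppr t : 0 <= t <= 1 -> `|pp k t| <= r0.
  by move=> t01; apply: le_trans (hpp k t t01) er0.
have GP t : 0 <= t <= 1 -> G (P t) = w q *m Pc (p q) (pinv (a q) (P t)).
  by move=> t01; rewrite /G Pz /Q tid//; exact: ppr.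
have dP : integral_curve G P.
  move=> t0' e' t0'01 e'0; have [et et0 h] := hd k t0' e' t0'01 e'0.
  exists et => // t t01 tt; rewrite /G Pz /P opprD addrACA subrr add0r.
  exact: h.
have cG t : 0 <= t <= 1 -> {for P t, continuous G}.
  move=> _; have FV : Filter (nbhs (P t)) by exact: nbhs_filter.
  suff : G u @[u --> nbhs (P t)] --> G (P t) by [].
  have h1 : u - z q @[u --> nbhs (P t)] --> P t - z q.
    by apply: (@cvgB _ _ _ (nbhs (P t)) FV) => //; exact: cvg_cst.
  apply: cvg_mulmx; first exact: cvg_cst.
  exact: (cvg_comp _ _ h1 (@cQ q (P t - z q))).
have aP t : 0 <= t <= 1 -> pcod (a q) (P t).
  by move=> /ppr h; case: (sd q _ h).
have adP t : 0 <= t <= 1 -> adapted g Es Ec Eu Kc (p q) (Ps (p q)) (Pc (p q)) (Pu (p q))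
    (pinv (a q) (P t)).
  by move=> /ppr h; case: (sd q _ h).
have EP t : 0 <= t <= 1 ->
    G (P t) *m tangent_mx S (a q) (pinv (a q) (P t)) \in Ec (pinv (a q) (P t)).
  by move=> t01; rewrite GP//; have [_ _ _ /(_ (w q))[]] := adP t t01.
have leaf := leaf_curve uW (Sa q) dP cG aP EP.
have P0 : pinv (a q) (P 0) = F (y k) by rewrite Fy /P; have [-> _] := hp k.
have P1 : pinv (a q) (P 1) = y (k + 1) by rewrite /P; have [_ ->] := hp k.
pose B := k0 * (16 * k0 ^+ 4 * e).
have B0 : 0 <= B by rewrite mulr_ge0 ?(ltW k00)// mulr_ge0 ?(ltW e0)// mulr_ge0// exprn_ge0// ltW.
have [|||h1 h2] := @curve_dist R n M S g (a q) P G k0 B (Wc (y (k + 1))) (Sa q)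
  (ltW k00) B0 dP cG aP _ _ _.
- by move=> t t01; rewrite -P1; exact: leaf.
- move=> t t01; rewrite GP//; have [_ _ _ _ /(_ (w q))[_ h _]] := adP t t01.
  apply: le_trans h _; apply: (@le_trans _ _ (k0 * `|w q|)).
    by rewrite ler_wpM2r.
  by rewrite ler_wpM2l// ltW.
- move=> t t01 u; have [_ /(_ u)[_ h] _ _ _] := adP t t01.
  by apply: le_trans h _; rewrite ler_wpM2r.
rewrite P0 P1 in h1 h2.
have BL : k0 * (2 * B) <= L * d.
  rewrite /L [leRHS]mulrDl (_ : k0 * (2 * B) = k0 * (2 * (16 * k0 ^+ 4 * k0 / rc)) * d).
    by rewrite lerDr; apply: ltW; rewrite !(divr_gt0, mulr_gt0, exprn_gt0).
  by rewrite /B /e; ring.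
split.
- by rewrite -P1 -P0; apply: leaf; rewrite lexx ler01.
- by apply: le_trans h2 _; rewrite lee_fin.
- by apply: le_trans h1 _; rewrite lee_fin.
Qed.

End Shadowing.

(** * From an iterate back to the map itself *)

Section Iterates.
Variables (R : realType) (n : nat) (M : topologicalType).
Variables (S : smooth_atlas R n M) (g : riemannian_metric S).
Variables (Es Ec Eu : M -> {vspace 'rV[R]_n}).
Hypotheses (haus : hausdorff_space M) (cM : compact [set: M]).
Implicit Types (x y z : M).

Lemma compact_lt1 (h : M -> R) : continuous h -> (forall x, h x < 1) ->
  exists lam : R, [/\ 0 <= lam, lam < 1 & forall x, h x <= lam].
Proof.
move=> ch h1; have [[x0 _]|no] := pselect ([set: M] !=set0); last first.
  exists 0; rewrite lexx ltr01; split=> // x; exfalso; apply: no; by exists x.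
have [|xm _ hm] := compact_EVT_max _ cM (continuous_subspaceT ch); first by exists x0.
exists (Num.max 0 (h xm)); split.
- by rewrite le_max lexx.
- by rewrite gt_max ltr01 h1.
- by move=> x; rewrite le_max hm ?orbT// inE.
Qed.

Lemma invariant_mem (F : M -> M) (E : M -> {vspace 'rV[R]_n}) x v :
  invariant_distribution S F E -> v \in E x -> tangent_map S F x v \in E (F x).
Proof.
move=> /(_ x) h vE; suff : [set` E (F x)] (tangent_map S F x v) by [].
by rewrite -h; exists v.
Qed.

(** By compactness the functions [nu] and [nuh] stay below a constant less than 1, which gives a
    single rate. *)
Lemma hyp_step_exists (F : M -> M) (nu nuh : M -> R) : smooth1 S F ->
  [/\ invariant_distribution S F Es, invariant_distribution S F Ec
    & invariant_distribution S F Eu] ->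
  continuous nu -> continuous nuh -> (forall x, nu x < 1) ->
  (forall x, 0 < nuh x) -> (forall x, nuh x < 1) ->
  (forall x v, tnorm g x v = 1 ->
    (v \in Es x -> tnorm g (F x) (tangent_map S F x v) <= nu x) /\
    (v \in Eu x -> (nuh x)^-1 <= tnorm g (F x) (tangent_map S F x v))) ->
  exists lam : R, [/\ 0 <= lam, lam < 1 & hyp_step g Es Ec Eu lam F].
Proof.
move=> sF [iEs iEc iEu] cnu cnuh nu1 nuh0 nuh1 hF.
have [l1 [l10 l11 h1]] := compact_lt1 cnu nu1.
have [l2 [l20 l21 h2]] := compact_lt1 cnuh nuh1.
exists (Num.max l1 l2); split; [by rewrite le_max l10|by rewrite gt_max l11|].
apply: hyp_step_unit => // x v v1; have [hs hu] := hF x v v1; split.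
- move=> vE; split; first exact: invariant_mem.
  by apply: le_trans (hs vE) _; rewrite le_max h1.
- exact: invariant_mem.
- move=> vE; split; first exact: invariant_mem.
  rewrite -(mulfV (lt0r_neq0 (nuh0 x))); apply: ler_pM => //.
  + exact: ltW.
  + by rewrite invr_ge0 ltW.
  + by rewrite le_max h2 orbT.
  + exact: hu.
Qed.

Lemma dist_in_sub (A B : set M) x y : A `<=` B ->
  (dist_in g B x y <= dist_in g A x y)%E.
Proof.
move=> AB; apply: le_ereal_inf => _ [p [cp p0 p1 pA] <-]; exists p => //; split=> //.
exact: subset_trans AB.
Qed.

Lemma rdist_refl x : (rdist g x x <= 0)%E.
Proof. exact: dist_in_refl. Qed.

Section Constants.
Variables (f : M -> M) (rho : R).
Hypotheses (rho0 : 0 < rho) (rho1 : rho <= 1).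
Hypothesis tri : forall x y z d, 0 < d < rho -> (rdist g x y <= d%:E)%E ->
  (rdist g x z <= d%:E)%E -> (rdist g y z <= (d / rho)%:E)%E.
Hypothesis lip : forall x y d, 0 < d < rho -> (rdist g x y <= d%:E)%E ->
  (rdist g (f x) (f y) <= (d / rho)%:E)%E.

Lemma iter_lipschitz j x y d : 0 < d < rho ^+ j -> (rdist g x y <= d%:E)%E ->
  (rdist g (iter j f x) (iter j f y) <= (d / rho ^+ j)%:E)%E.
Proof.
elim: j => [|j IH] /andP[d0 dr] xy; first by rewrite expr0 divr1.
have rj : 0 < rho ^+ j by rewrite exprn_gt0.
have dj : d / rho ^+ j < rho by rewrite ltr_pdivrMr// -exprS.
rewrite !iterS exprSr invfM mulrA; apply: lip; first by rewrite divr_gt0.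
apply: IH => //; rewrite d0; apply: lt_le_trans dr _.
by rewrite exprS ler_piMl// ltW.
Qed.

(** Each step costs three factors [rho]: one for the Lipschitz bound, one to exchange the end points
    of a distance, and one for the weak triangle inequality, whose two distances must start at the
    same point. *)
Lemma iter_pseudotrajectory j d (x : int -> M) (k : int) : 0 < d < rho ^+ (3 * j) ->
  pseudotrajectory g f d x ->
  (rdist g (iter j f (x k)) (x (k + j%:Z)%R) <= (d / rho ^+ (3 * j))%:E)%E.
Proof.
move=> + px; elim: j => [|j IH] /andP[d0 dr].
  by rewrite addr0; apply: le_trans (rdist_refl _) _; rewrite lee_fin divr_ge0// ltW.
set e := d / rho ^+ (3 * j).
have rj : 0 < rho ^+ (3 * j) by rewrite exprn_gt0.
have e0 : 0 < e by rewrite divr_gt0.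
have E : rho ^+ (3 * j.+1) = rho ^+ 3 * rho ^+ (3 * j) by rewrite -exprD mulnS.
have e3 : e < rho ^+ 3 by rewrite ltr_pdivrMr// -E.
have de : d <= e.
  by rewrite ler_pdivlMr// ler_piMr ?(ltW d0)// exprn_ile1// ltW.
have {}IH : (rdist g (iter j f (x k)) (x (k + j%:Z)%R) <= e%:E)%E.
  apply: IH; rewrite d0 (lt_le_trans dr)// E ler_piMl ?(ltW rj)//.
  by rewrite exprn_ile1// ltW.
have r2 : rho ^+ 2 <= rho by rewrite expr2 ler_piMl// ltW.
have r3 : rho ^+ 3 <= rho by rewrite exprS ler_piMr ?(ltW rho0)// exprn_ile1// ltW.
have e1 : e / rho < rho ^+ 2 by rewrite ltr_pdivrMr// -exprSr.
have e2 : e / rho / rho < rho by rewrite ltr_pdivrMr// -expr2.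
have h1 : (rdist g (f (iter j f (x k))) (f (x (k + j%:Z)%R)) <= (e / rho)%:E)%E.
  by apply: lip => //; rewrite e0 (lt_le_trans e3).
have h2 : (rdist g (f (x (k + j%:Z)%R)) (f (iter j f (x k))) <= (e / rho / rho)%:E)%E.
  apply: (tri _ h1); first by rewrite divr_gt0//= (lt_le_trans e1).
  by apply: le_trans (rdist_refl _) _; rewrite lee_fin divr_ge0// ltW.
have h3 : (rdist g (f (x (k + j%:Z)%R)) (x (k + j%:Z + 1)%R) <= (e / rho / rho)%:E)%E.
  apply: le_trans (px _) _; rewrite lee_fin; apply: le_trans de _.
  rewrite -mulrA ler_peMr ?(ltW e0)// -invfM invf_ge1 ?mulr_gt0//.
  by rewrite -expr2 exprn_ile1// ltW.
have -> : k + j.+1%:Z = k + j%:Z + 1 by rewrite -addn1 PoszD addrA.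
have -> : d / rho ^+ (3 * j.+1) = e / rho / rho / rho.
  rewrite E /e; field; by rewrite !gt_eqF.
by apply: (tri _ h2 h3); rewrite e2 !divr_gt0.
Qed.

End Constants.

End Iterates.

Lemma uniform_step (R : realType) (n : nat) (M : topologicalType)
    (S : smooth_atlas R n M) (g : riemannian_metric S) (f : M -> M) :
  hausdorff_space M -> compact [set: M] -> smooth1 S f ->
  exists rho : R, [/\ 0 < rho, rho <= 1,
    forall x y z d, 0 < d < rho -> (rdist g x y <= d%:E)%E ->
      (rdist g x z <= d%:E)%E -> (rdist g y z <= (d / rho)%:E)%E
  & forall x y d, 0 < d < rho -> (rdist g x y <= d%:E)%E ->
      (rdist g (f x) (f y) <= (d / rho)%:E)%E].
Proof.
move=> haus cM sf.
have [r1 r10 h1] := uniform_rdist_triangle g haus cM.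
have [r2 r20 h2] := uniform_lipschitz g haus cM sf.
pose rho := Num.min 1 (Num.min r1 r2).
have rho0 : 0 < rho by rewrite !lt_min ltr01 r10.
have le1 : rho <= r1 by rewrite !ge_min lexx orbT.
have le2 : rho <= r2 by rewrite !ge_min lexx !orbT.
exists rho; split=> [//||x y z d /andP[d0 dr] xy xz|x y d /andP[d0 dr] xy].
- by rewrite ge_min lexx.
- apply: le_trans (h1 x y z d _ xy xz) _; first by rewrite d0 (lt_le_trans dr).
  by rewrite lee_fin ler_wpM2l ?(ltW d0)// lef_pV2// posrE.
- apply: le_trans (h2 x y d _ xy) _; first by rewrite d0 (lt_le_trans dr).
  by rewrite lee_fin ler_wpM2l ?(ltW d0)// lef_pV2// posrE.
Qed.

Lemma divz_modz_succ (N : nat) (k : int) : (0 < N)%N ->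
  let r := absz (k %% N%:Z)%Z in
  [/\ (r < N)%N, k = (k %/ N%:Z)%Z * N%:Z + r%:Z &
   if (r.+1 < N)%N then
     ((k + 1) %/ N%:Z)%Z = (k %/ N%:Z)%Z /\ absz ((k + 1) %% N%:Z)%Z = r.+1
   else [/\ r.+1 = N, ((k + 1) %/ N%:Z)%Z = (k %/ N%:Z)%Z + 1 &
     absz ((k + 1) %% N%:Z)%Z = 0%N]].
Proof.
move=> N0 r; have N0' : N%:Z != 0 by rewrite eqz_nat -lt0n.
have rE : (k %% N%:Z)%Z = r%:Z by rewrite /r gez0_abs// modz_ge0.
have rN : (r < N)%N by rewrite -ltz_nat -rE ltz_mod.
have kE : k = (k %/ N%:Z)%Z * N%:Z + r%:Z by rewrite -rE -divz_eq.
have k1E : k + 1 = (k %/ N%:Z)%Z * N%:Z + r.+1%:Z.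
  by rewrite {1}kE -addrA -addn1 PoszD.
split=> //; case: ifPn => [rN1|]; rewrite k1E divzMDl// modzMDl divz_nat modz_nat.
  by rewrite divn_small// modn_small// addr0.
rewrite -leqNgt => Nr; have -> : r.+1 = N by apply/eqP; rewrite eqn_leq rN.
by rewrite divnn N0 modnn.
Qed.

Lemma iter_shadowing (R : realType) (n : nat) (M : topologicalType)
    (S : smooth_atlas R n M) (g : riemannian_metric S) (f : M -> M)
    (Wc : M -> set M) (N : nat) (d0 L0 : R) :
  hausdorff_space M -> compact [set: M] -> smooth1 S f -> (forall x, Wc x x) ->
  (0 < N)%N -> 0 < d0 -> 0 < L0 ->
  (forall d, 0 < d < d0 -> forall x : int -> M,
    (forall k, (rdist g (iter N f (x k)) (x (k + 1)%R) <= d%:E)%E) ->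
    exists y : int -> M, forall k, (rdist g (x k) (y k) <= (L0 * d)%:E)%E /\
      central_step g Wc (iter N f) (L0 * d) (y k) (y (k + 1))) ->
  lipschitz_central_shadowing g f Wc.
Proof.
move=> haus cM sf Wxx N0 d00 L00 shadow.
have [rho [rho0 rho1 tri lip]] := uniform_step g haus cM sf.
pose s := rho ^+ (3 * N); have s0 : 0 < s by rewrite exprn_gt0.
pose s' := rho ^+ N; have s'0 : 0 < s' by rewrite exprn_gt0.
have s'1 : s' <= 1 by rewrite exprn_ile1// ltW.
have L10 : 0 < L0 + 1 by rewrite addr_gt0.
(* [D] below bounds the distances from [iter r f (x (q * N))] to both [x k] and [y k]; the weak
   triangle inequality gives [D / rho = L1 * d]. The final constant is [L1 + 1] because leaf balls
   are defined by a strict inequality. *)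
pose L1 := (L0 + 1) / s / s' / rho.
pose d1 := Num.min (Num.min s (d0 * s)) (rho * s' * s / (L0 + 1)).
have d10 : 0 < d1 by rewrite !lt_min s0 mulr_gt0// divr_gt0// !mulr_gt0.
have L1p : 0 < L1 by rewrite !divr_gt0.
exists d1, (L1 + 1); split=> //; first by rewrite addr_gt0.
move=> d /andP[dp]; rewrite !lt_min -andbA => /and3P[ds dd0 dD] x px.
pose e := d / s; have e0 : 0 < e by rewrite divr_gt0.
have ed0 : 0 < e < d0 by rewrite e0 ltr_pdivrMr.
pose D := (L0 + 1) * e / s'.
have Dp : 0 < D by rewrite divr_gt0// mulr_gt0.
have Drho : D < rho.
  rewrite /D /e ltr_pdivrMr// mulrA ltr_pdivrMr// mulrC -ltr_pdivlMr//.
have DL1 : D / rho = L1 * d by rewrite /D /e /L1; field; rewrite !gt_eqF.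
have eD : e <= D.
  rewrite /D ler_pdivlMr//; apply: (@le_trans _ _ e); first by rewrite ler_piMr// ltW.
  by rewrite ler_peMl ?(ltW e0)// lerDr ltW.
have LeD : L0 * e / s' <= D.
  by rewrite ler_wpM2r ?invr_ge0 ?(ltW s'0)// ler_wpM2r ?(ltW e0)// lerDl.
have Le0 : 0 <= L0 * e by apply/ltW/mulr_gt0.
have LeD' : L0 * e <= D.
  by apply: le_trans LeD; rewrite ler_peMr// invf_ge1.
have DL : D <= L1 * d.
  by rewrite -DL1 ler_peMr ?(ltW Dp)// invf_ge1.
have LL : L1 * d < (L1 + 1) * d by rewrite mulrDl mul1r ltrDl.
have powN j : (j <= N)%N -> s' <= rho ^+ j.
  by move=> jN; rewrite ler_wiXn2l// ltW.
have pow3N j : (j <= N)%N -> s <= rho ^+ (3 * j).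
  by move=> jN; rewrite ler_wiXn2l ?leq_mul2l ?jN ?orbT// ltW.
have follow j k : (j <= N)%N ->
    (rdist g (iter j f (x k)) (x (k + j%:Z)%R) <= e%:E)%E.
  move=> jN; have rj : 0 < rho ^+ (3 * j) by rewrite exprn_gt0.
  apply: le_trans (iter_pseudotrajectory rho0 rho1 tri lip k _ px) _.
    by rewrite dp (lt_le_trans ds)// pow3N.
  by rewrite lee_fin ler_wpM2l ?(ltW dp)// lef_pV2 ?posrE// pow3N.
have [k|Y hY] := shadow e ed0 (fun k => x (k * N%:Z)).
  by rewrite mulrDl mul1r; exact: follow.
(* Time [k] is written as [q * N + r], and [y k] is the exact image under [r] steps of [f] of the
   shadowing point at [q]. Jumps occur only when [k + 1] is a multiple of [N], and there they are
   those of [iter N f]. *)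
pose y k := iter (absz (k %% N%:Z)%Z) f (Y (k %/ N%:Z)%Z).
have step k : y (k + 1) = f (y k) \/ exists q,
    y (k + 1) = Y (q + 1) /\ f (y k) = iter N f (Y q).
  have [rN _] := divz_modz_succ k N0.
  case: ifPn => [rN1 [eq er]|_ [eN eq er]]; first by left; rewrite /y eq er iterS.
  by right; exists (k %/ N%:Z)%Z; rewrite /y eq er -iterS eN.
have Ld0 : 0 < (L1 + 1) * d by rewrite mulr_gt0// addr_gt0.
exists y; split; last first.
  move=> k; have [rN kE _] := divz_modz_succ k N0.
  set r := absz _ in rN kE *; set q := (k %/ N%:Z)%Z in kE *.
  have h1 := follow r (q * N%:Z) (ltnW rN); rewrite -kE in h1.
  have [h2 _] := hY q.
  have h3 : (rdist g (iter r f (x (q * N%:Z)%R)) (y k) <= (L0 * e / rho ^+ r)%:E)%E.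
    apply: iter_lipschitz h2 => //; rewrite mulr_gt0//=.
    apply: (@lt_le_trans _ _ s'); last exact: powN (ltnW rN).
    rewrite -(@ltr_pM2r _ s'^-1) ?invr_gt0// mulfV ?gt_eqF//.
    by apply: le_lt_trans LeD _; exact: lt_le_trans Drho rho1.
  apply: (@le_trans _ _ (D / rho)%:E).
    apply: (tri (iter r f (x (q * N%:Z)))); first by rewrite Dp.
      by apply: le_trans h1 _; rewrite lee_fin.
    apply: le_trans h3 _; rewrite lee_fin; apply: le_trans LeD.
    rewrite ler_wpM2l// lef_pV2 ?posrE ?exprn_gt0//.
    exact: powN (ltnW rN).
  by rewrite lee_fin DL1 ltW.
have LeLd : L0 * e < (L1 + 1) * d by apply: le_lt_trans LL; exact: le_trans DL.
split=> k.
  have [->|[q [-> ->]]] := step k.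
    by apply: le_trans (rdist_refl g _) _; rewrite lee_fin ltW.
  have [_ [_ _ h]] := hY q; apply: le_trans (dist_in_sub g _ _ (@subsetT _ _)) _.
  by apply: le_trans h _; rewrite lee_fin ltW.
have [->|[q [-> ->]]] := step k.
  split; first exact: Wxx.
  by apply: le_lt_trans (dist_in_refl g (Wxx _)) _; rewrite lte_fin.
have [_ [h1 h2 _]] := hY q; split=> //.
by apply: le_lt_trans h2 _; rewrite lte_fin.
Qed.

Theorem theorem1 (R : realType) (n : nat) (M : topologicalType)
  (S : smooth_atlas R n M) (g : riemannian_metric S) (f : M -> M)
  (Es Ec Eu : M -> {vspace 'rV[R]_n}) (Wc : M -> set M) :
  hausdorff_space M -> compact [set: M] ->
  Diff1 S f ->
  partially_hyperbolic g f Es Ec Eu ->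
  dynamically_coherent S Es Ec Eu ->
  uniquely_integrates S Ec Wc ->
  lipschitz_central_shadowing g f Wc.
Proof.
move=> haus cM [Cf [h [Ch fh hf]]] [m [m0]] /=.
move=> [dE [cEs cEc cEu] iE [nu [nuh [gam [gamh [[cnu cnuh _ _] pos lt1 hyp]]]]]] _ uW.
have iF : inverse_pair S f h by split=> //; exact: C1_map_smooth1.
have [sf _ _ _] := iF.
have [sfm _ _ _] := inverse_pair_iter m iF.
have [||||lam [lam0 lam1 hlam]] := @hyp_step_exists R n M S g Es Ec Eu cM (iter m f) nu nuh
  sfm iE cnu cnuh.
- by move=> x; case: (lt1 x).
- by move=> x; case: (pos x).
- by move=> x; case: (lt1 x).
- by move=> x v v1; have [h1 _ h3] := hyp x v v1; split.
have [K [Ps [Pc [Pu [C [C' [s [[clC clC'] CC' C'ad cov]]]]]]]] :=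
  cover_exists g haus cM dE cEs cEc cEu.
have [Kc Kc1 KKc] : exists2 Kc : R, 1 <= Kc & forall p, p \in s -> K p <= Kc.
  have [|p|r r0 hr] := @seq_unif R M s (fun p r => K p <= r^-1).
  - by move=> p r r' /andP[r'0 rr'] /le_trans; apply; rewrite lef_pV2// posrE (lt_le_trans r'0).
  - exists (`|K p| + 1)^-1; first by rewrite invr_gt0 ltr_wpDl.
    by rewrite invrK (le_trans (ler_norm _))// lerDl.
  exists (r^-1 + 1); first by rewrite lerDr invr_ge0 ltW.
  by move=> p ps; apply: le_trans (hr p ps) _; rewrite lerDl.
(* [Kc] comes from charts and frames alone, before any iterate is chosen, so a high enough power of
   [lam] beats it. *)
have [N lamN] : exists N, Kc ^+ 3 * lam ^+ N.+1 <= 16^-1.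
  have Kc30 : 0 < Kc ^+ 3 by rewrite exprn_gt0// (lt_le_trans ltr01).
  have e0 : 0 < 16^-1 / Kc ^+ 3 by rewrite divr_gt0.
  have := @cvg_expr R lam; rewrite ger0_norm// => /(_ lam1) /cvgrPdist_lt /(_ _ e0).
  case=> N _ /(_ N (leqnn N)); rewrite /= sub0r normrN ger0_norm ?exprn_ge0// => hN.
  exists N; rewrite mulrC -ler_pdivlMr//; apply: le_trans (ltW hN).
  by rewrite exprS ler_piMl ?exprn_ge0// ltW.
have hF := hyp_step_iter N.+1 lam0 sfm hlam.
have [d0 [L0 [d00 L00 shadow]]] := central_shadowing_step haus cM dE uW clC clC' CC' C'ad
  cov Kc1 KKc (exprn_ge0 N.+1 lam0) lamN (inverse_pair_iter N.+1 (inverse_pair_iter m iF)) hF.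
have iterE : iter N.+1 (iter m f) = iter (N.+1 * m) f.
  by apply/funext => x; rewrite iterM.
rewrite iterE in shadow.
have [k [_ [[Wxx _] _ _] _ _]] := uW.
apply: (iter_shadowing haus cM sf Wxx _ d00 L00 shadow).
by rewrite muln_gt0.
Qed.
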